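(* Let $\mu\in\mathcal M(\mathbf S)$ and let $\mu(dx)=f(x)\sigma(dx)+\nu(dx)$ be the Lebesgue decomposition of $\mu$ with respect to $\sigma$ (so $f\in L^1(\mathbf S,\sigma)$ and $\nu\perp\sigma$). Then $\mathcal P_{\mathbb D}[\mu]$ has the nontangential limit $f(y)$ at $\sigma$-almost every $y\in\mathbf S$.
   Context: Let $d\ge 2$ and $\alpha\in(1,2)$. $\mathbf S=\{x\in\mathbb R^d:|x|=1\}$, $\mathbb D=\mathbb R^d\setminus\mathbf S$, $\sigma$ is the normalized surface measure on $\mathbf S$, and $\mathcal M(\mathbf S)$ is the space of finite signed Borel measures on $\mathbf S$. Let $\mathcal C_2=\pi^{1/2}2^{2-\alpha}\Gamma((\alpha+d)/2-1)/\Gamma((\alpha-1)/2)$ and $\mathcal P_{\mathbb D}(x,y)=\frac{\mathcal C_2}{\Gamma(d/2)}\frac{||x|^2-1|^{\alpha-1}}{|x-y|^{d+\alpha-2}}$ for $x\in\mathbb D$, $y\in\mathbf S$; for $\mu\in\mathcal M(\mathbf S)$, $\mathcal P_{\mathbb D}[\mu](x)=\int_{\mathbf S}\mathcal P_{\mathbb D}(x,y)\mu(dy)$, $x\in\mathbb D$. For $y\in\mathbf S$ and $\beta>0$ let $\Gamma_\beta(y)=\{x\in\mathbb D:|x-y|<(1+\beta)|1-|x||\}$. A function $u$ on $\mathbb D$ has nontangential limit $L$ at $y\in\mathbf S$ if for every $\beta>0$, $\lim_{\Gamma_\beta(y)\ni x\to y}u(x)=L$. *)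

(* Defs.v *)
From HB Require Import structures.
From mathcomp Require Import all_boot all_order all_algebra.
From mathcomp Require Import all_classical all_reals all_analysis.
Unset Printing Implicit Defensive.
Import Order.TTheory GRing.Theory Num.Theory.
Import numFieldNormedType.Exports.
Local Open Scope classical_set_scope.
Local Open Scope ring_scope.

(** Points of R^d are row vectors 'rV[R]_d (with the product topology,
    which is the Euclidean topology). *)

Definition enorm (R : realType) (d : nat) (x : 'rV[R]_d) : R :=
  Num.sqrt (\sum_(i < d) x ord0 i ^+ 2).

Definition Sph (R : realType) (d : nat) : set 'rV[R]_d := [set x | enorm R d x = 1].
Definition Dom (R : realType) (d : nat) : set 'rV[R]_d := ~` Sph R d.

Definition Rd (R : realType) (d : nat) := g_sigma_algebraType (@open 'rV[R]_d).

Definition Gamma (R : realType) (s : R) : R :=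
  fine (\int[@lebesgue_measure R]_(t in `]0%R, +oo[%classic)
          ((t `^ (s - 1)) * expR (- t))%:E)%E.

Definition C2 (R : realType) (d : nat) (alpha : R) : R :=
  Num.sqrt pi * (2 `^ (2 - alpha)) * Gamma R ((alpha + d%:R) / 2 - 1)
  / Gamma R ((alpha - 1) / 2).

Definition PD (R : realType) (d : nat) (alpha : R) (x y : 'rV[R]_d) : R :=
  C2 R d alpha / Gamma R (d%:R / 2) *
  ((`| enorm R d x ^+ 2 - 1 | `^ (alpha - 1)) / (enorm R d (x - y) `^ (d%:R + alpha - 2))).

(** Integral of the kernel against a finite signed Borel measure mu on S:
    int P_D(x,y) mu(dy) := int P_D(x,y) mu^+(dy) - int P_D(x,y) mu^-(dy),
    where mu = mu^+ - mu^- is the Jordan decomposition of mu obtained from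
    a Hahn decomposition (P, N) of mu (the value does not depend on it). *)
Definition PD_int (R : realType) (d : nat) (alpha : R)
  (mu : {charge set Rd R d -> \bar R}) (P N : set (Rd R d))
  (PN : hahn_decomposition mu P N) (x : 'rV[R]_d) : \bar R :=
  (\int[jordan_pos PN]_(y in Sph R d) (PD R d alpha x y)%:E
   - \int[jordan_neg PN]_(y in Sph R d) (PD R d alpha x y)%:E)%E.

Definition ntcone (R : realType) (d : nat) (beta : R) (y : 'rV[R]_d) : set 'rV[R]_d :=
  [set x | Dom R d x /\ enorm R d (x - y) < (1 + beta) * `| 1 - enorm R d x |].

Definition nt_limit (R : realType) (d : nat) (u : 'rV[R]_d -> \bar R)
  (y : 'rV[R]_d) (L : \bar R) : Prop :=
  forall beta : R, 0 < beta ->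
    u @ within (ntcone R d beta y) (nbhs y) --> L.

(* Main.v *)
(** A rotation-invariant probability on the sphere has explicit even moments
    (Gamma quotients), obtained from a recurrence by expanding
    [int (y_i + s y_j)^(2k) = (1 + s^2)^k int y_i^(2k)] in [s].  They give the
    asymptotics of the Laplace transform
    [int exp (- z (1 - e.y)) sigma(dy) ~ c z^(-(d-1)/2)] as [z -> +oo], and, since
    [Gamma a * A^(-a) = int_0^oo t^(a-1) exp (- t A) dt], those of the mass of
    the kernel: [P_D[sigma](x) -> 1] as [|x| -> 1].

    For a positive measure [m] with density [g] off a [sigma]-null set, let [E]
    be the set where [a <= g < a + h] and let [tau] be [m + sigma] restricted to
    the complement of [E].  By a Vitali covering argument [tau] has density 0
    with respect to [sigma] at almost every point [y] of [E].  Inside a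
    nontangential cone at [y] the kernel is at most a constant multiple of the
    kernel with radial pole [|x| y], whose superlevel sets are caps centred at
    [y]; comparing the measures of these caps shows that [P_D[tau]] vanishes in
    the limit, while on [E] the measure [m] lies between [a sigma] and
    [(a + h) sigma].  Letting [h -> 0] gives the limit [g y], and the signed
    case follows from the Jordan decomposition. *)

Require Import Defs.
From HB Require Import structures.
From mathcomp Require Import all_boot all_order all_algebra.
From mathcomp Require Import all_classical all_reals all_analysis measurable_realfun.
From mathcomp Require Import ring lra.
Import Order.TTheory GRing.Theory Num.Theory.
Import numFieldNormedType.Exports.
Local Open Scope classical_set_scope.
Local Open Scope ring_scope.

Set Implicit Arguments.
Unset Strict Implicit.
Unset Printing Implicit Defensive.

Arguments enorm {R d} x.
Arguments Gamma {R} s.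
Arguments PD {R d} alpha x y.

(** * The Gamma function *)

(** [sigma] is known only through rotation invariance, total mass and support, so areas of caps are
    not at hand. Yet the limit equals [f y] only if the mass of the kernel tends to exactly 1: a
    sharp constant has to be extracted from invariance alone, and moments are what invariance
    determines. They are matched with the Laplace transform by comparing w^n with exp(-n(1 - w))
    near w = 1, and Gamma quotients are estimated by AM-GM instead of Stirling's formula. The
    asymptotics hold for large arguments only; the resulting error, once integrated in [t], is less
    singular in 1 - |x| than the main term. [sigma] is included in [tau] because its own share of
    the kernel off [E] must vanish as well: only then does the mass 1 concentrate on [E], where [m]
    is squeezed. All estimates are uniform over the points of the cone with a given norm, so limits
    are taken in the single variable |x|. *)

Definition gammaf (R : realType) (s t : R) : R := t `^ (s - 1) * expR (- t).

Definition egamma (R : realType) (s : R) : \bar R :=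
  (\int[@lebesgue_measure R]_(t in `]0%R, +oo[%classic) (gammaf s t)%:E)%E.

Section gamma.
Context {R : realType}.
Local Notation leb := (@lebesgue_measure R).
Implicit Types a b s t x A : R.

Lemma GammaE s : Gamma s = fine (egamma s).
Proof. by []. Qed.

Lemma gammaf_ge0 s t : 0 <= gammaf s t.
Proof. by rewrite mulr_ge0 ?powR_ge0 ?expR_ge0. Qed.

Lemma measurable_gammaf s : measurable_fun [set: R] (gammaf s).
Proof.
apply: measurable_funM; first exact: measurable_powR.
by apply: measurableT_comp => //; exact: measurable_expR.
Qed.

Lemma measurable_expRN A : measurable_fun [set: R] (fun t => expR (- (t * A))).
Proof.
apply: measurableT_comp; first exact: measurable_expR.
by apply: measurableT_comp => //; apply: measurable_funM.
Qed.

Lemma egamma_ge0 s : (0 <= egamma s)%E.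
Proof. by apply: integral_ge0 => t _; rewrite lee_fin gammaf_ge0. Qed.

(** For [s < 1] the Gamma integrand blows up at 0. Changes of variable are therefore made on closed
    rays inside the half-line, and the endpoint is sent to 0 afterwards. *)
Lemma cvg_integral_ray (f : R -> R) (a : R^nat) :
  (forall n, 0 < a n) -> nonincreasing_seq a -> a n @[n --> \oo] --> 0 ->
  measurable_fun [set: R] f -> (forall t, 0 <= f t) ->
  (\int[leb]_(t in `[a n, +oo[%classic) (f t)%:E)%E @[n --> \oo]
    --> (\int[leb]_(t in `]0%R, +oo[%classic) (f t)%:E)%E.
Proof.
move=> a0 na ca mf f0.
have -> : `]0, +oo[%classic = \bigcup_n `[a n, +oo[%classic :> set R.
  apply/seteqP; split=> [t|t [n _]] /=; rewrite !in_itv/= !andbT; last first.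
    by apply: lt_le_trans.
  move=> t0.
  have /cvgrPdist_lt/(_ _ t0)[n _ /(_ _ (leqnn n))] := ca.
  rewrite sub0r normrN gtr0_norm// => h; exists n => //=.
  by rewrite in_itv/= andbT ltW.
apply: ge0_nondecreasing_set_cvg_integral => //.
- move=> m n mn; apply/subsetPset => t /=; rewrite !in_itv/= !andbT.
  by apply: le_trans; exact: na.
- by move=> n; apply/measurable_EFinP; exact: measurable_funTS.
- by move=> n t _; rewrite lee_fin.
Qed.

Lemma bigcup_segment :
  \bigcup_n `[n.+2%:R^-1, n.+2%:R]%classic = `]0, +oo[%classic :> set R.
Proof.
apply/seteqP; split=> [t [n _] /=|t /=]; rewrite !in_itv/= !andbT.
  by move=> /andP[+ _]; apply: lt_le_trans; rewrite invr_gt0.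
move=> t0; exists (Num.trunc (t + t^-1)) => //=; rewrite in_itv/=.
have i0 : 0 < t^-1 by rewrite invr_gt0.
have h : t + t^-1 <= (Num.trunc (t + t^-1)).+2%:R.
  by rewrite (le_trans (ltW (truncnS_gt _)))// ler_nat.
apply/andP; split; last by rewrite (le_trans _ h)// lerDl ltW.
rewrite -[leRHS]invrK lef_pV2 ?posrE ?invr_gt0//.
by rewrite (le_trans _ h)// lerDr ltW.
Qed.

(** Prepares integration by parts on compact segments; [n.+2] makes them nondegenerate from the
    start. *)
Lemma cvg_integral_segment (f : R -> R) :
  measurable_fun [set: R] f -> (forall t, 0 <= f t) ->
  (\int[leb]_(t in `[(n.+2%:R^-1)%R, n.+2%:R]%classic) (f t)%:E)%E @[n --> \oo]
    --> (\int[leb]_(t in `]0%R, +oo[%classic) (f t)%:E)%E.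
Proof.
move=> mf f0; rewrite -bigcup_segment.
apply: ge0_nondecreasing_set_cvg_integral => //.
- move=> m n mn; apply/subsetPset => t /=; rewrite !in_itv/= => /andP[h1 h2].
  apply/andP; split.
    by rewrite (le_trans _ h1)// lef_pV2 ?posrE// ler_nat.
  by rewrite (le_trans h2)// ler_nat.
- by move=> n; apply/measurable_EFinP; exact: measurable_funTS.
- by move=> n t _; rewrite lee_fin.
Qed.

(* [t <= 2s exp(t/(2s))] since [1 + u <= exp u]. *)
Lemma powR_le_expR s t : 0 < s -> 0 <= t ->
  t `^ s <= (2 * s) `^ s * expR (t / 2).
Proof.
move=> s0 t0.
have -> : expR (t / 2) = (expR (t / (2 * s))) `^ s.
  by rewrite -expRM; congr expR; field; rewrite gt_eqF.
rewrite -powRM ?expR_ge0//; last by rewrite mulr_ge0// ltW.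
apply: ge0_ler_powR; rewrite ?nnegrE ?mulr_ge0 ?expR_ge0// ?(ltW s0)//.
rewrite mulrC -ler_pdivrMr ?mulr_gt0//.
by rewrite (le_trans _ (expR_ge1Dx _))// lerDr.
Qed.

Lemma cvg_powR_expRN s : 0 < s ->
  (n.+2%:R `^ s * expR (- n.+2%:R) : R) @[n --> \oo] --> (0 : R).
Proof.
move=> s0.
apply: (@squeeze_cvgr _ _ _ _ (fun=> 0)
  (fun n : nat => (2 * s) `^ s * (expR (- 2^-1)) ^+ n)).
- near=> n; rewrite mulr_ge0 ?powR_ge0 ?expR_ge0//=.
  apply: (@le_trans _ _ ((2 * s) `^ s * expR (n.+2%:R / 2) * expR (- n.+2%:R))).
    by rewrite ler_pM2r ?expR_gt0// powR_le_expR.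
  rewrite -mulrA ler_wpM2l ?powR_ge0// -expRD -expRM_natl ler_expR.
  rewrite -[n.+2]addn2 natrD; lra.
- exact: cvg_cst.
- rewrite -[X in _ --> X](mulr0 ((2 * s) `^ s)); apply: cvgMr.
  apply: cvg_expr; rewrite ger0_norm ?expR_ge0// expR_lt1; lra.
Unshelve. all: by end_near. Qed.

Lemma cvg_invn_powR s : 0 < s ->
  ((n.+2%:R^-1 : R) `^ s) @[n --> \oo] --> (0 : R).
Proof.
move=> s0; apply: (cvg_comp (fun n : nat => n.+2%:R^-1 : R) _ _ (powR_cvg0 s0)).
move=> A /= [e /= e0 eA].
have : \forall n \near \oo, (n.+1%:R^-1 : R) < e.
  exact: near_infty_natSinv_lt (PosNum e0).
apply: filterS => n /= ne; apply: eA => /=; last by rewrite invr_gt0.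
rewrite sub0r normrN ger0_norm ?invr_ge0//.
by apply: le_lt_trans ne; rewrite lef_pV2 ?posrE// ler_nat.
Qed.

Lemma gammaf_is_derive s x : 0 < x ->
  is_derive x 1 (fun t => t `^ s * expR (- t)) (s * gammaf s x - gammaf (s + 1) x).
Proof.
move=> x0.
have := is_derive1_powR s x0.
move=> h; apply: is_derive_eq.
rewrite /gammaf addrK /GRing.scale/=; ring.
Qed.

Lemma within_gammaf s x y : 0 < x -> {within `[x, y], continuous (gammaf s)}.
Proof.
move=> x0; apply: derivable_within_continuous => t; rewrite in_itv/= => /andP[xt _].
have t0 : 0 < t by exact: lt_le_trans xt.
have := is_derive1_powR (s - 1) t0.
by move=> h; apply: ex_derive.
Qed.

(** Integration by parts on segments, with boundary term [r n] tending to 0. It is stated in the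
    extended reals because finiteness of [egamma] is itself deduced from it. *)
Lemma egammaS s : 0 < s -> egamma (s + 1) = (s%:E * egamma s)%E.
Proof.
move=> s0.
pose u n := (\int[leb]_(t in `[(n.+2%:R^-1)%R, n.+2%:R]%classic) (gammaf s t)%:E)%E.
pose v n := (\int[leb]_(t in `[(n.+2%:R^-1)%R, n.+2%:R]%classic) (gammaf (s + 1) t)%:E)%E.
pose r n : R := n.+2%:R `^ s * expR (- n.+2%:R)
   - (n.+2%:R^-1) `^ s * expR (- n.+2%:R^-1).
have lt n : (n.+2%:R^-1 : R) < n.+2%:R.
  by rewrite (@lt_trans _ _ 1)// ?invf_lt1// ltr1n.
have int s' n : leb.-integrable `[(n.+2%:R^-1)%R, n.+2%:R]%classic (EFin \o gammaf s').
  apply: continuous_compact_integrable; first exact: segment_compact.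
  by apply: within_gammaf; rewrite invr_gt0.
have E n : (s%:E * u n = v n + (r n)%:E)%E.
  have : (\int[leb]_(t in `[(n.+2%:R^-1)%R, n.+2%:R]%classic)
       (s * gammaf s t - gammaf (s + 1) t)%:E = (r n)%:E)%E.
    rewrite /r EFinB; apply: (@continuous_FTC2 _ _ (fun t => t `^ s * expR (- t))) => //.
    - move=> t; apply: cvgB; last by apply: within_gammaf; rewrite invr_gt0.
      by apply: cvgMr; apply: within_gammaf; rewrite invr_gt0.
    - have D t : 0 < t -> derivable (fun t => t `^ s * expR (- t)) t 1.
        by move=> t0; have h := gammaf_is_derive s t0; exact: ex_derive.
      have C t : 0 < t -> {for t, continuous (fun t => t `^ s * expR (- t))}.
        by move=> t0; apply: differentiable_continuous; apply/derivable1_diffP; exact: D.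
      split.
      + move=> t; rewrite in_itv/= => /andP[h _]; apply: D.
        by apply: lt_trans h; rewrite invr_gt0.
      + by apply: cvg_at_right_filter; apply: C; rewrite invr_gt0.
      + by apply: cvg_at_left_filter; exact: C.
    - move=> t; rewrite in_itv/= => /andP[h _].
      have t0 : 0 < t by apply: lt_trans h; rewrite invr_gt0.
      by have h' := gammaf_is_derive s t0; rewrite derive1E derive_val.
  move=> <-; rewrite /u -integralZl//; last exact: (int s n).
  under [in RHS]eq_integral do rewrite EFinB EFinM.
  rewrite integralB//=; last 2 first.
  - by apply: (@integrableZl _ _ _ _ _ _ s _ (int s n)).
  - exact: int.
  rewrite addeC subeK//; apply: integrable_fin_num => //; exact: int.
have cu : (s%:E * u n)%E @[n --> \oo] --> (s%:E * egamma s)%E.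
  apply: cvgeZl => //; apply: cvg_integral_segment => *; [exact: measurable_gammaf|exact: gammaf_ge0].
have cv : v n @[n --> \oo] --> egamma (s + 1).
  apply: cvg_integral_segment => *; [exact: measurable_gammaf|exact: gammaf_ge0].
have cr : (r n)%:E @[n --> \oo] --> 0%:E.
  apply: cvg_EFin; first by near=> n.
  rewrite -[X in _ --> X](subr0 0); apply: cvgB; first exact: cvg_powR_expRN.
  apply: (@squeeze_cvgr _ _ _ _ (fun=> 0) (fun n : nat => (n.+2%:R^-1) `^ s)).
  - near=> n; rewrite mulr_ge0 ?powR_ge0 ?expR_ge0//=.
    by rewrite ler_piMr ?powR_ge0// expR_le1 oppr_le0 invr_ge0.
  - exact: cvg_cst.
  - exact: cvg_invn_powR.
have : (v n + (r n)%:E)%E @[n --> \oo] --> (egamma (s + 1) + 0%:E)%E.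
  by apply: cvgeD => //; rewrite fin_num_adde_defl.
rewrite adde0 => c2.
have {}cu : (v n + (r n)%:E)%E @[n --> \oo] --> (s%:E * egamma s)%E.
  by move: cu; under eq_fun do rewrite E.
exact: (cvg_unique _ c2 cu).
Unshelve. all: by end_near. Qed.

(** The functional equation trades [s] for [s + 1], whose integrand t^s exp(-t) is below a multiple
    of exp(-t/2) on the whole half-line. *)
Lemma egamma_lty s : 0 < s -> (egamma s < +oo)%E.
Proof.
move=> s0.
suff: (egamma (s + 1) < +oo)%E.
  rewrite egammaS//; have := egamma_ge0 s; case: (egamma s) => //=; first by move=> *; rewrite ltry.
  by rewrite gt0_muley// lte_fin.
pose C := (2 * s) `^ s.
have C0 : 0 <= C by exact: powR_ge0.
pose F t : R := - (2 * C * expR (- (t / 2))).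
have dF t : is_derive t 1 F (C * expR (- (t / 2))).
  by apply: is_derive_eq; rewrite /GRing.scale/=; field.
have int : (\int[leb]_(t in `[0%R, +oo[%classic) (C * expR (- (t / 2)))%:E = 0%:E - (F 0)%:E)%E.
  have cF t : {for t, continuous F}.
    by apply: differentiable_continuous; apply/derivable1_diffP; exact: ex_derive.
  apply: ge0_continuous_FTC2y.
  - by move=> t _; rewrite mulr_ge0// expR_ge0.
  - apply: derivable_within_continuous => t _; exact: ex_derive.
  - rewrite /F -[X in _ --> X]oppr0 -(mulr0 (2 * C)); apply: cvgN; apply: cvgMr.
    apply: (cvg_comp (fun t : R => t / 2) (fun t : R => expR (- t))); last exact: cvgr_expR.
    by apply: gt0_cvgMly => //; rewrite invr_gt0.
  - by move=> t _; exact: ex_derive.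
  - by apply: cvg_at_right_filter; exact: cF.
  - by move=> t _; rewrite derive1E derive_val.
apply: (@le_lt_trans _ _ (\int[leb]_(t in `[0%R, +oo[%classic) (C * expR (- (t / 2)))%:E)%E); last first.
  by rewrite int -EFinB ltry.
have mC D : measurable_fun D (fun t : R => (C * expR (- (t / 2)))%:E).
  apply/measurable_EFinP; apply: measurable_funTS; apply: measurable_funM => //.
  exact: (measurable_expRN 2^-1).
apply: (@le_trans _ _ (\int[leb]_(t in `]0%R, +oo[%classic) (C * expR (- (t / 2)))%:E)%E).
  apply: ge0_le_integral => //.
  - by move=> t _; rewrite lee_fin gammaf_ge0.
  - by apply/measurable_EFinP; apply: measurable_funTS; exact: measurable_gammaf.
  - exact: mC.
  - move=> t; rewrite /= in_itv/= andbT => t0; rewrite lee_fin /gammaf addrK.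
    rewrite (_ : - (t / 2) = t / 2 - t); last by field.
    by rewrite expRD mulrA ler_wpM2r ?expR_ge0// powR_le_expR// ltW.
apply: ge0_subset_integral => //.
- exact: mC.
- by move=> t _; rewrite lee_fin mulr_ge0// expR_ge0.
- by move=> t /=; rewrite !in_itv/= !andbT => /ltW.
Qed.

Lemma egamma_fin s : 0 < s -> egamma s = (Gamma s)%:E.
Proof.
by move=> s0; rewrite GammaE fineK// ge0_fin_numE ?egamma_ge0// egamma_lty.
Qed.

Lemma GammaS s : 0 < s -> Gamma (s + 1) = s * Gamma s.
Proof.
move=> s0; apply: EFin_inj; rewrite EFinM -!egamma_fin ?egammaS//.
by rewrite ltr_wpDr.
Qed.

Lemma Gamma_gt0 s : 0 < s -> 0 < Gamma s.
Proof.
move=> s0; suff: 0 < Gamma (s + 1) by rewrite GammaS// pmulr_rgt0.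
apply: (@lt_le_trans _ _ (expR (- 2))); first exact: expR_gt0.
rewrite -lee_fin -egamma_fin; last by rewrite ltr_wpDr.
apply: (@le_trans _ _ (\int[leb]_(t in `[1%R, 2%R]%classic) (expR (- 2))%:E)%E).
  rewrite integral_cst//= lebesgue_measure_itv/= lte_fin ltr1n/= -EFinB -EFinM.
  by rewrite lee_fin; nra.
apply: (@le_trans _ _ (\int[leb]_(t in `[1%R, 2%R]%classic) (gammaf (s + 1) t)%:E)%E).
  apply: ge0_le_integral => //.
  - by apply/measurable_EFinP; apply: measurable_funTS; exact: measurable_gammaf.
  - move=> t; rewrite /= in_itv/= => /andP[t1 t2]; rewrite lee_fin /gammaf addrK.
    rewrite -[leLHS]mul1r ler_pM ?expR_ge0//; last by rewrite ler_expR lerN2.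
    by rewrite -(powRr0 t) ler_powR// ltW.
apply: ge0_subset_integral => //.
- by apply/measurable_EFinP; apply: measurable_funTS; exact: measurable_gammaf.
- by move=> t _; rewrite lee_fin gammaf_ge0.
- by move=> t /=; rewrite !in_itv/= andbT => /andP[+ _]; apply: lt_le_trans.
Qed.

(* AM-GM under the integral: [t^(1/2) <= (x^(1/2) + t / x^(1/2)) / 2]. *)
Lemma Gamma_half_step x : 0 < x -> Gamma (x + 2^-1) <= Num.sqrt x * Gamma x.
Proof.
move=> x0; set c := Num.sqrt x.
have c0 : 0 < c by rewrite sqrtr_gt0.
have xh : 0 < x + 2^-1 by rewrite ltr_wpDr.
have x1 : 0 < x + 1 by rewrite ltr_wpDr.
have mg s (D : set R) : measurable_fun D (fun t => (gammaf s t)%:E).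
  by apply/measurable_EFinP; apply: measurable_funTS; exact: measurable_gammaf.
(* The AM-GM weight [c], the square root of [x], is the one for which the two terms are equal, since
   [Gamma (x + 1)] is c^2 times [Gamma x]. *)
have E : c * Gamma x = c / 2 * Gamma x + (2 * c)^-1 * Gamma (x + 1).
  have xc : x = c ^+ 2 by rewrite sqr_sqrtr// ltW.
  have -> : Gamma (x + 1) = c ^+ 2 * Gamma x by rewrite GammaS// -xc.
  by field; exact: lt0r_neq0.
rewrite E -lee_fin EFinD [X in (_ <= X + _)%E]EFinM [X in (_ <= _ + X)%E]EFinM.
rewrite -!egamma_fin// /egamma.
have k1 : 0 <= c / 2 by rewrite mulr_ge0// ltW.
have k2 : 0 <= (2 * c)^-1 by rewrite invr_ge0 mulr_ge0// ltW.
have g0 s' (D : set R) t : D t -> (0%:E <= (gammaf s' t)%:E)%E.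
  by rewrite lee_fin gammaf_ge0.
have Z s' k : 0 <= k ->
    (k%:E * (\int[leb]_(t in `]0%R, +oo[%classic) (gammaf s' t)%:E) =
    \int[leb]_(t in `]0%R, +oo[%classic) (k%:E * (gammaf s' t)%:E))%E.
  move=> k0; rewrite ge0_integralZl_EFin//; first by move=> t; exact: g0.
  exact: mg.
rewrite !Z//.
have P (t : R) : 0 < t -> gammaf (x + 2^-1) t <=
    c / 2 * gammaf x t + (2 * c)^-1 * gammaf (x + 1) t.
  move=> t0; rewrite /gammaf !mulrA -mulrDl ler_wpM2r ?expR_ge0//.
  have -> : t `^ (x + 1 - 1) = t * t `^ (x - 1).
    by rewrite addrK mulr_powRB1// ltW.
  have -> : t `^ (x + 2^-1 - 1) = Num.sqrt t * t `^ (x - 1).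
    rewrite -powR12_sqrt ?ltW// -powRD ?(gt_eqF t0) ?implybT//.
    by congr (_ `^ _); ring.
  rewrite mulrA -mulrDl ler_wpM2r ?powR_ge0//.
  rewrite -{2}(sqr_sqrtr (ltW t0)); move: (Num.sqrt t) => w.
  rewrite -subr_ge0 (_ : _ - w = (w - c) ^+ 2 / (2 * c)).
    by rewrite divr_ge0 ?sqr_ge0// mulr_ge0// ltW.
  by field; exact: lt0r_neq0.
have kg s' (k : R) t : 0 <= k -> (0%:E <= k%:E * (gammaf s' t)%:E)%E.
  by move=> k0; rewrite mule_ge0// lee_fin gammaf_ge0.
rewrite -ge0_integralD//=; [|by move=> t _; exact: kg
  |by apply: emeasurable_funM => //; exact: mg
  |by move=> t _; exact: kg
  |by apply: emeasurable_funM => //; exact: mg].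
apply: ge0_le_integral => //=.
- by move=> t _; rewrite lee_fin gammaf_ge0.
- exact: mg.
- by apply: emeasurable_funD; apply: emeasurable_funM => //; exact: mg.
- move=> t; rewrite in_itv/= andbT => t0; rewrite -!EFinM -EFinD lee_fin.
  exact: P.
Qed.

(** Writes a negative power of [A] as a superposition of exponentials; this is how powers of a
    distance become Laplace transforms. *)
Lemma integral_gammaf_scale s A : 0 < A ->
  (\int[leb]_(t in `]0%R, +oo[%classic) (t `^ (s - 1) * expR (- (t * A)))%:E
    = (A `^ (- s))%:E * egamma s)%E.
Proof.
move=> A0.
pose a n : R := n.+1%:R^-1.
have a0 n : 0 < a n by rewrite invr_gt0.
have na : nonincreasing_seq a.
  by move=> m n mn; rewrite lef_pV2 ?posrE// ler_nat.
pose f t : R := t `^ (s - 1) * expR (- (t * A)).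
have mf : measurable_fun [set: R] f.
  apply: measurable_funM; first exact: measurable_powR.
  exact: measurable_expRN.
have f0 t : 0 <= f t by rewrite mulr_ge0 ?powR_ge0 ?expR_ge0.
have c1 := cvg_integral_ray a0 na (@cvg_harmonic R) mf f0.
have b0 n : 0 < A * a n by rewrite mulr_gt0.
have nb : nonincreasing_seq (fun n => A * a n).
  by move=> m n mn; rewrite ler_pM2l// na.
have cb : (A * a n) @[n --> \oo] --> 0.
  by rewrite -(mulr0 A); apply: cvgMr; exact: cvg_harmonic.
have c2 := cvg_integral_ray b0 nb cb (measurable_gammaf s) (gammaf_ge0 s).
have /(cvgeZl (y := (A `^ (- s))%:E)) c3 := c2.
have {}c3 := c3 isT.
apply: (cvg_unique _ c1); first exact: ereal_hausdorff.
have P t : 0 < t -> A `^ (- s) * (gammaf s (A * t) * A) = f t.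
  move=> t0; have AE : A `^ (- s) * A `^ (s - 1) * A = 1.
    rewrite -[X in _ * X](powRr1 (ltW A0)) -!powRD ?(gt_eqF A0) ?implybT//.
    by rewrite -[RHS](powRr0 A); congr (_ `^ _); ring.
  rewrite /gammaf /f (mulrC A t) powRM ?ltW//.
  transitivity (A `^ (- s) * A `^ (s - 1) * A * (t `^ (s - 1) * expR (- (t * A)))).
    by ring.
  by rewrite AE mul1r.
have E n : ((A `^ (- s))%:E * \int[leb]_(t in `[(A * a n)%R, +oo[%classic) (gammaf s t)%:E
    = \int[leb]_(t in `[a n, +oo[%classic) (f t)%:E)%E.
  have dA x : is_derive x 1 (fun t => A * t) A.
    by apply: is_derive_eq; rewrite /GRing.scale/= mulr1.
  have DA : (fun t : R => A * t)^`()%classic = cst A.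
    by apply/funext => x; rewrite derive1E derive_val.
  rewrite (@increasing_ge0_integration_by_substitutiony _ (fun t => A * t) (gammaf s) (a n)).
  - rewrite -ge0_integralZl_EFin//=; last 3 first.
    + by move=> t _; rewrite lee_fin mulr_ge0 ?gammaf_ge0// DA/= ltW.
    + apply/measurable_EFinP; apply: measurable_funTS; apply: measurable_funM.
        apply: measurableT_comp; first exact: measurable_gammaf.
        exact: measurable_funM.
      by rewrite DA.
    + exact: powR_ge0.
    apply: eq_integral => t; rewrite inE/= in_itv/= andbT => t1.
    have t0 : 0 < t by exact: lt_le_trans t1.
    by rewrite -EFinM fctE/= DA/= P.
  - by move=> x y _ _; rewrite ltr_pM2l.
  - by rewrite DA => x _; exact: cvg_cst.
  - by rewrite DA; exact: is_cvg_cst.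
  - by rewrite DA; exact: is_cvg_cst.
  - split; first by move=> x _; exact: ex_derive.
    by apply: cvg_at_right_filter; apply: cvgMr; exact: cvg_id.
  - by apply: gt0_cvgMry.
  - apply: derivable_within_continuous => t; rewrite in_itv/= andbT => h.
    have t0 : 0 < t by apply: lt_le_trans h; rewrite mulr_gt0.
    by have h' := is_derive1_powR (s - 1) t0; apply: ex_derive.
  - by move=> t _; exact: gammaf_ge0.
by move: c3; under eq_fun do rewrite E.
Qed.

(** The substitution of the square root of [t] turns the integral into the Gaussian one. *)
Lemma Gamma_half : Gamma 2^-1 = Num.sqrt pi :> R.
Proof.
have a0 n : 0 < (n.+1%:R^-1 : R) by rewrite invr_gt0.
have na : nonincreasing_seq (fun n : nat => n.+1%:R^-1 : R).
  by move=> m n mn; rewrite lef_pV2 ?posrE// ler_nat.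
pose b n : R := n.+1%:R^-1 ^+ 2.
have b0 n : 0 < b n by rewrite exprn_gt0.
have nb : nonincreasing_seq b.
  by move=> m n mn; rewrite /b lerXn2r ?nnegrE ?invr_ge0//; exact: (na _ _ mn).
have cb : b n @[n --> \oo] --> 0.
  by rewrite -[X in _ --> X](mulr0 0); apply: cvgM; exact: cvg_harmonic.
have c1 := cvg_integral_ray b0 nb cb (measurable_gammaf 2^-1) (gammaf_ge0 2^-1).
have c2 := cvg_integral_ray a0 na (@cvg_harmonic R) (@measurable_gauss_fun R) (@gauss_fun_ge0 R).
have /(cvgeZl (y := 2%:E)) c3 := c2.
have {}c3 := c3 isT.
have E n : (2%:E * \int[leb]_(t in `[(n.+1%:R^-1)%R, +oo[%classic) (gauss_fun t)%:E
    = \int[leb]_(t in `[b n, +oo[%classic) (gammaf 2^-1 t)%:E)%E.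
  have -> : (n.+1%:R^-1 : R) = Num.sqrt (b n) by rewrite sqrtr_sqr gtr0_norm.
  have dA x : 0 < x -> is_derive x 1 (@Num.sqrt R) (2 * Num.sqrt x)^-1.
    exact: is_derive1_sqrt.
  have DA x : 0 < x -> (@Num.sqrt R)^`()%classic x = (2 * Num.sqrt x)^-1.
    by move=> x0; have := dA x x0 => h; rewrite derive1E derive_val.
  have cA x : 0 < x -> {for x, continuous (fun x : R => (2 * Num.sqrt x)^-1)}.
    move=> x0; apply: cvgV; first by rewrite mulf_neq0// gt_eqF// sqrtr_gt0.
    by apply: cvgMr; exact: sqrt_continuous.
  have cD x : 0 < x -> {for x, continuous (@Num.sqrt R)^`()%classic}.
    move=> x0; rewrite /prop_for /continuous_at DA//.
    apply: cvg_trans (cA x x0); apply: near_eq_cvg; near=> y; rewrite DA//.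
    by near: y; exact: lt_nbhsr.
  have cy : (Num.sqrt x : R) @[x --> +oo] --> +oo.
    apply/cvgryPge => B; have := nbhs_pinfty_ge (num_real (B ^+ 2)).
    by apply: filterS => x /ler_wsqrtr; rewrite sqrtr_sqr; apply: le_trans (ler_norm B).
  have P t : 0 < t -> 2 * (gauss_fun (Num.sqrt t) * (2 * Num.sqrt t)^-1) = gammaf 2^-1 t.
    move=> t0; rewrite /gammaf /gauss_fun sqr_sqrtr ?ltW//.
    rewrite (_ : 2^-1 - 1 = - 2^-1); last by field.
    rewrite powRN powR12_sqrt ?ltW//; field.
    by rewrite gt_eqF// sqrtr_gt0.
  rewrite (@increasing_ge0_integration_by_substitutiony _ (@Num.sqrt R) gauss_fun (b n)).
  - rewrite -ge0_integralZl_EFin//=; last 2 first.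
    + move=> t; rewrite in_itv/= andbT => t1.
      have t0 : 0 < t by exact: lt_le_trans t1.
      by rewrite lee_fin fctE/= DA// mulr_ge0 ?gauss_fun_ge0// invr_ge0 mulr_ge0// sqrtr_ge0.
    + apply/measurable_EFinP.
      apply: (@eq_measurable_fun _ _ _ _ _ (fun t => gammaf 2^-1 t / 2)).
        move=> t; rewrite inE/= in_itv/= andbT => t1.
        have t0 : 0 < t by exact: lt_le_trans t1.
        by rewrite -P// fctE/= DA// mulrAC divff ?mul1r.
      by apply: measurable_funTS; apply: measurable_funM => //; exact: measurable_gammaf.
    apply: eq_integral => t; rewrite inE/= in_itv/= andbT => t1.
    have t0 : 0 < t by exact: lt_le_trans t1.
    by rewrite -EFinM fctE/= DA// P.
  - move=> x y; rewrite !in_itv/= !andbT => xb yb xy; rewrite ltr_sqrt//.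
    by apply: lt_trans xy; exact: lt_le_trans xb.
  - move=> x; rewrite in_itv/= andbT => xb; apply: cD.
    exact: lt_trans xb.
  - apply: cvgP; apply: cvg_at_right_filter; exact: cD.
  - apply: (cvgP (0 : R)).
    apply: (@cvg_trans _ ((2 * Num.sqrt x)^-1 @[x --> +oo])).
      by apply: near_eq_cvg; near=> x; rewrite DA.
    apply/gtr0_cvgV0; first by near=> x; rewrite mulr_gt0// sqrtr_gt0.
    by apply: gt0_cvgMry.
  - split; last by apply: cvg_at_right_filter; exact: sqrt_continuous.
    move=> x; rewrite in_itv/= andbT => xb.
    by have := dA x (lt_trans (b0 n) xb) => h; exact: ex_derive.
  - exact: cy.
  - by apply: continuous_subspaceT; exact: continuous_gauss_fun.
  - by move=> t _; exact: gauss_fun_ge0.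
have {}c3 : (2%:E * \int[leb]_(t in `]0%R, +oo[%classic) (gauss_fun t)%:E)%E = egamma 2^-1.
  by move: c3; under eq_fun do rewrite E; move=> c3; exact: (cvg_unique _ c3 c1).
apply: EFin_inj; rewrite -egamma_fin ?invr_gt0// -c3.
rewrite integral_itv_obnd_cbnd; last first.
  by apply/measurable_EFinP; apply: measurable_funTS; exact: measurable_gauss_fun.
by rewrite integral0y_gauss -EFinM; congr EFin; field.
Unshelve. all: by end_near. Qed.

End gamma.

(** * Euclidean geometry *)

Definition dotp (R : realType) (d : nat) (x y : 'rV[R]_d) : R :=
  \sum_(i < d) x ord0 i * y ord0 i.

(** Typed as a set of [Rd R d] so that measures apply to it. The balls of the ambient matrix space
    are cubes, hence the translation in [nbhs_eball]. *)
Definition eball (R : realType) (d : nat) (y : 'rV[R]_d) (r : R) : set (Rd R d) :=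
  [set z | enorm (z - y) < r].

Section euclidean.
Context {R : realType} {d : nat}.
Implicit Types (x y z u v : 'rV[R]_d) (r s : R).

Lemma dotpC x y : dotp x y = dotp y x.
Proof. by apply: eq_bigr => i _; rewrite mulrC. Qed.

Lemma dotpDl x y z : dotp (x + y) z = dotp x z + dotp y z.
Proof. by rewrite -big_split; apply: eq_bigr => i _; rewrite mxE mulrDl. Qed.

Lemma dotpDr x y z : dotp z (x + y) = dotp z x + dotp z y.
Proof. by rewrite dotpC dotpDl !(dotpC z). Qed.

Lemma dotpZl r x y : dotp (r *: x) y = r * dotp x y.
Proof. by rewrite mulr_sumr; apply: eq_bigr => i _; rewrite mxE mulrA. Qed.

Lemma dotpZr r x y : dotp y (r *: x) = r * dotp y x.
Proof. by rewrite dotpC dotpZl dotpC. Qed.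

Lemma dotpNl x y : dotp (- x) y = - dotp x y.
Proof. by rewrite -scaleN1r dotpZl mulN1r. Qed.

Lemma dotpBl x y z : dotp (x - y) z = dotp x z - dotp y z.
Proof. by rewrite dotpDl dotpNl. Qed.

Lemma dotpBr x y z : dotp z (x - y) = dotp z x - dotp z y.
Proof. by rewrite dotpC dotpBl !(dotpC z). Qed.

Lemma dotp_ge0 x : 0 <= dotp x x.
Proof. by apply: sumr_ge0 => i _; rewrite -expr2 sqr_ge0. Qed.

Lemma enormE x : enorm x = Num.sqrt (dotp x x).
Proof. by congr Num.sqrt; apply: eq_bigr => i _; rewrite expr2. Qed.

Lemma enorm_ge0 x : 0 <= enorm x.
Proof. exact: sqrtr_ge0. Qed.

Lemma sqr_enorm x : enorm x ^+ 2 = dotp x x.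
Proof. by rewrite enormE sqr_sqrtr// dotp_ge0. Qed.

Lemma enormN x : enorm (- x) = enorm x.
Proof. by rewrite !enormE dotpNl dotpC dotpNl opprK. Qed.

Lemma enorm_distC x y : enorm (x - y) = enorm (y - x).
Proof. by rewrite -enormN opprB. Qed.

Lemma enormZ r x : enorm (r *: x) = `|r| * enorm x.
Proof.
by rewrite !enormE dotpZl dotpZr mulrA -expr2 sqrtrM ?sqr_ge0// sqrtr_sqr.
Qed.

Lemma enorm0 : enorm (0 : 'rV[R]_d) = 0.
Proof. by rewrite -(scale0r (0 : 'rV[R]_d)) enormZ normr0 mul0r. Qed.

Lemma sqr_enormB x y :
  enorm (x - y) ^+ 2 = enorm x ^+ 2 + enorm y ^+ 2 - 2 * dotp x y.
Proof. by rewrite !sqr_enorm dotpBl !dotpBr (dotpC y x); ring. Qed.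

(** Cauchy-Schwarz, by expanding the squared norm of |y| x - |x| y. When one of the norms is 0 the
    expansion is void, and the vector is shown to vanish. *)
Lemma dotp_le x y : dotp x y <= enorm x * enorm y.
Proof.
have := dotp_ge0 (enorm y *: x - enorm x *: y).
rewrite dotpBl !dotpBr !dotpZl !dotpZr (dotpC y x) -!sqr_enorm.
set a := enorm x; set b := enorm y; set c := dotp x y => h.
have [a0|a0] := eqVneq (a * b) 0; last first.
  have {a0} : 0 < a * b by rewrite lt0r a0 mulr_ge0 ?enorm_ge0.
  by move=> ab; rewrite -(ler_pM2l ab); nra.
rewrite a0; move/eqP: a0; rewrite mulf_eq0.
have Z (u v : 'rV[R]_d) : enorm u == 0 -> dotp u v <= 0.
  rewrite enormE sqrtr_eq0 => u0.
  have {}u0 : dotp u u = 0 by apply/eqP; rewrite eq_le u0 dotp_ge0.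
  rewrite /dotp big1// => i _.
  move/eqP: u0; rewrite psumr_eq0; last by move=> j _; rewrite -expr2 sqr_ge0.
  by move=> /allP/(_ i); rewrite mem_index_enum -expr2 sqrf_eq0 => /(_ isT)/eqP ->; rewrite mul0r.
by case/orP => /Z; [exact|rewrite /c dotpC; exact].
Qed.

Lemma normr_dotp_le x y : `|dotp x y| <= enorm x * enorm y.
Proof.
by rewrite ler_norml dotp_le andbT lerNl -dotpNl (le_trans (dotp_le _ _))// enormN.
Qed.

Lemma enorm_triangle x y : enorm (x + y) <= enorm x + enorm y.
Proof.
rewrite -ler_sqr ?nnegrE ?addr_ge0 ?enorm_ge0//.
rewrite sqr_enorm dotpDl !dotpDr (dotpC y x) -!sqr_enorm sqrrD.
have := dotp_le x y; lra.
Qed.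

Lemma enorm_dist_triangle y x z : enorm (x - z) <= enorm (x - y) + enorm (y - z).
Proof. by rewrite (le_trans _ (enorm_triangle _ _))// addrA subrK. Qed.

Lemma enorm_lipschitz x y : `|enorm x - enorm y| <= enorm (x - y).
Proof.
rewrite ler_norml; apply/andP; split.
  have := enorm_triangle (y - x) x; rewrite subrK (enorm_distC x y); lra.
have := enorm_triangle (x - y) y; rewrite subrK; lra.
Qed.

Lemma enorm_entry x i : `|x ord0 i| <= enorm x.
Proof.
rewrite -(sqrtr_sqr (x ord0 i)) ler_wsqrtr// (bigD1 i)//= lerDl.
by apply: sumr_ge0 => j _; rewrite sqr_ge0.
Qed.

Lemma enorm_le_entries x r : (forall i, `|x ord0 i| <= r) -> enorm x <= d%:R * r.
Proof.
move=> xr; have [d0|d0] := posnP d.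
  rewrite enormE /dotp big1 ?sqrtr0; last by move=> i; have := ltn_ord i; rewrite {2}d0.
  by rewrite {1}d0 mul0r.
have r0 : 0 <= r by apply: le_trans (xr (Ordinal d0)).
rewrite -ler_sqr ?nnegrE ?enorm_ge0 ?mulr_ge0// sqr_enorm.
apply: (@le_trans _ _ (\sum_(i < d) r ^+ 2)).
  by apply: ler_sum => i _; rewrite -expr2 -real_normK ?num_real// ler_sqr ?nnegrE.
rewrite sumr_const card_ord -[leLHS]mulr_natl exprMn.
by rewrite ler_wpM2r ?sqr_ge0// expr2 ler_peMl// ler1n.
Qed.

Lemma nbhs_eball (y : 'rV[R]_d) (A : set 'rV[R]_d) :
  nbhs y A <-> exists2 e : R, 0 < e & eball y e `<=` A.
Proof.
split.
  move=> /nbhs_ballP[e /= e0 eA]; exists e => // z yz; apply: eA.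
  rewrite /ball/=; split => // i j; rewrite (ord1 i) /ball/=.
  have := enorm_entry (y - z) j; rewrite !mxE => /le_lt_trans; apply.
  by rewrite enorm_distC.
move=> [e e0 eA]; apply/nbhs_ballP.
(* Dividing by [d + 1] instead of [d] covers [d = 0] and leaves the strict inequality that is
   wanted. *)
have d1 : 0 < d%:R + 1 :> R by rewrite ltr_wpDl.
exists (e / (d%:R + 1)) => /=; first by rewrite divr_gt0.
move=> z [_ yz]; apply: eA; rewrite /eball/= enorm_distC.
apply: (@le_lt_trans _ _ (d%:R * (e / (d%:R + 1)))).
  apply: enorm_le_entries => i; rewrite !mxE ltW//; exact: yz.
by rewrite mulrA ltr_pdivrMr// mulrDr mulr1 mulrC ltrDl.
Qed.

Lemma open_eballP (A : set 'rV[R]_d) :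
  open A <-> forall y, A y -> exists2 e : R, 0 < e & eball y e `<=` A.
Proof.
rewrite openE; split=> h y /h; first by move=> /nbhs_eball.
by move=> /nbhs_eball.
Qed.

Lemma lipschitz_continuous (f : 'rV[R]_d -> R) (k : R) : 0 <= k ->
  (forall x y, `|f x - f y| <= k * enorm (x - y)) -> continuous f.
Proof.
move=> k0 kf x; apply/(@cvgrPdist_lt _ _ _ (nbhs x) _) => e e0; apply/nbhs_eball.
have k1 : 0 < k + 1 by rewrite ltr_wpDl.
exists (e / (k + 1)); first by rewrite divr_gt0.
move=> z /= xz; apply: (le_lt_trans (kf _ _)).
apply: (@le_lt_trans _ _ (k * (e / (k + 1)))).
  by rewrite ler_wpM2l// enorm_distC ltW.
by rewrite mulrA ltr_pdivrMr// mulrDr mulr1 mulrC ltrDl.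
Qed.

Lemma continuous_enorm : continuous (@enorm R d).
Proof.
by apply: (@lipschitz_continuous _ 1) => // x y; rewrite mul1r enorm_lipschitz.
Qed.

Lemma continuous_enormB z : continuous (fun x => enorm (x - z)).
Proof.
apply: (@lipschitz_continuous _ 1) => // x y; rewrite mul1r.
by apply: (le_trans (enorm_lipschitz _ _)); rewrite opprB addrA subrK.
Qed.

Lemma continuous_dotp z : continuous (dotp z).
Proof.
apply: (@lipschitz_continuous _ (enorm z)); first exact: enorm_ge0.
by move=> x y; rewrite -dotpBr normr_dotp_le.
Qed.

Lemma open_measurable_Rd (A : set (Rd R d)) : open (A : set 'rV[R]_d) -> measurable A.
Proof. by move=> oA; apply: sub_sigma_algebra. Qed.

Lemma continuous_measurable_Rd (f : 'rV[R]_d -> R) :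
  continuous f -> measurable_fun [set: Rd R d] (f : Rd R d -> R).
Proof.
move=> /continuousP cf; apply: (measurability _ (RGenOpens.measurableE R)).
move=> _ [_ [a [b ->] <-]]; rewrite setTI; apply: open_measurable_Rd.
by apply: cf; exact: interval_open.
Qed.

Lemma open_eball y r : open (eball y r : set 'rV[R]_d).
Proof.
apply/open_eballP => x xy; exists (r - enorm (x - y)); first by rewrite subr_gt0.
move=> z zx; rewrite /eball/=.
by apply: (le_lt_trans (enorm_dist_triangle x _ _)); rewrite -ltrBrDr.
Qed.

Lemma measurable_eball y r : measurable (eball y r).
Proof. by apply: open_measurable_Rd; exact: open_eball. Qed.

Lemma measurable_Sph : measurable (Sph R d : set (Rd R d)).
Proof.
have -> : Sph R d = [set: Rd R d] `&` (@enorm R d) @^-1` [set 1].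
  by rewrite setTI.
by apply: (continuous_measurable_Rd continuous_enorm) => //; exact: measurable_set1.
Qed.

Lemma dotp_mxE x y : dotp x y = (x *m y^T) ord0 ord0.
Proof. by rewrite mxE; apply: eq_bigr => i _; rewrite mxE. Qed.

Lemma dotp_orthogonal (Q : 'M[R]_d) x y : Q *m Q^T = 1%:M ->
  dotp (x *m Q) (y *m Q) = dotp x y.
Proof. by move=> QQ; rewrite !dotp_mxE trmx_mul mulmxA -(mulmxA x) QQ mulmx1. Qed.

Lemma enorm_orthogonal (Q : 'M[R]_d) x : Q *m Q^T = 1%:M ->
  enorm (x *m Q) = enorm x.
Proof. by move=> QQ; rewrite !enormE dotp_orthogonal. Qed.

Lemma measurable_mulmxr (Q : 'M[R]_d) : Q *m Q^T = 1%:M ->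
  measurable_fun [set: Rd R d] ((fun x => x *m Q) : Rd R d -> Rd R d).
Proof.
move=> QQ; apply: (@measurability _ _ (Rd R d) (Rd R d) _ _ (@open 'rV[R]_d)) => //.
move=> _ [A oA <-]; rewrite setTI; apply: open_measurable_Rd.
apply/open_eballP => y; move/open_eballP : oA => /[apply] -[e e0 eA].
exists e => // z zy; apply: eA.
by rewrite /eball/= -mulmxBl enorm_orthogonal.
Qed.

(* The reflection exchanging [a] and [b]. *)
Lemma orthogonal_transitive (a b : 'rV[R]_d) : enorm a = enorm b ->
  exists2 Q : 'M[R]_d, Q *m Q^T = 1%:M & a *m Q = b.
Proof.
move=> ab; have [->|neq] := eqVneq a b.
  by exists 1%:M; [rewrite trmx1 mulmx1|rewrite mulmx1].
pose w := a - b; pose k := dotp w w.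
have k0 : k != 0.
  rewrite /k -sqr_enorm sqrf_eq0; apply: contra neq => /eqP w0.
  apply/eqP/rowP => i; apply/eqP; rewrite -subr_eq0 -normr_le0 -w0.
  by have := enorm_entry w i; rewrite !mxE.
(* Equality of the norms enters here: it makes [dotp a w] half of [k], so that reflecting [a] along
   [w] subtracts exactly [w]. *)
have kE : k = 2 * (dotp a a - dotp a b).
  rewrite /k /w dotpBl !dotpBr (dotpC b a) -!sqr_enorm ab; ring.
have wwE : w *m w^T = k%:M.
  by apply/matrixP => i j; rewrite !ord1 -dotp_mxE mxE eqxx mulr1n.
pose W := w^T *m w.
pose Q : 'M[R]_d := 1%:M - (2 / k) *: W.
have QT : Q^T = Q.
  by rewrite /Q linearB/= trmx1 linearZ/= trmx_mul trmxK.
have WW : W *m W = k *: W.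
  by rewrite /W mulmxA -(mulmxA _ w) wwE mul_mx_scalar scalemxAl.
have WQ : W *m Q = - W.
  rewrite /Q mulmxBr -scalemxAr WW mulmx1 scalerA divfK//.
  by rewrite scaler_nat mulr2n opprD addrA subrr add0r.
exists Q.
  rewrite QT {1}/Q mulmxBl mul1mx -scalemxAl WQ scalerN opprK.
  by rewrite /Q subrK.
rewrite /Q mulmxBr mulmx1 -scalemxAr mulmxA.
have -> : a *m w^T = (k / 2)%:M.
  apply/matrixP => i j; rewrite !ord1 -dotp_mxE mxE eqxx mulr1n.
  by rewrite kE /w dotpBr; field.
rewrite mul_scalar_mx scalerA (_ : 2 / k * (k / 2) = 1); last by field.
by rewrite scale1r /w opprB addrCA subrr addr0.
Qed.

End euclidean.

(** * Moments of the surface measure *)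

(** The determinant of [Q] is unrestricted, so that reflections are included;
    [orthogonal_transitive] produces one. *)
Definition surface_measure (R : realType) (d : nat)
    (sigma : {measure set Rd R d -> \bar R}) : Prop :=
  [/\ sigma setT = 1%E, sigma (~` Sph R d) = 0%E &
    forall Q : 'M[R]_d, Q *m Q^T = 1%:M ->
     forall A : set (Rd R d), measurable A ->
       sigma [set x : Rd R d | A (x *m Q)] = sigma A].

(** The constant coefficient carries the induction for the coefficient of degree 2. *)
Lemma coef_1DX2_exp (R : nzRingType) k :
  (((1 + 'X^2) ^+ k : {poly R})`_0 = 1) * (((1 + 'X^2) ^+ k : {poly R})`_2 = k%:R).
Proof.
elim: k => [|k [IH0 IH2]]; first by rewrite expr0 !coefC.
rewrite exprS mulrDl mul1r !coefD !coefXnM/= IH0 IH2 addr0.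
by rewrite natr1.
Qed.

Lemma poly_eval_inj (R : numDomainType) (p q : {poly R}) :
  (forall x, p.[x] = q.[x]) -> p = q.
Proof.
move=> pq; apply/eqP; rewrite -subr_eq0; apply/eqP.
apply: (@roots_geq_poly_eq0 _ _ [seq i%:R | i <- iota 0 (size (p - q))]).
- by apply/allP => x _; rewrite /root hornerD hornerN pq subrr.
- by rewrite map_inj_uniq ?iota_uniq//; move=> i j /eqP; rewrite eqr_nat => /eqP.
- by rewrite size_map size_iota.
Qed.

Lemma Rintegral_sum d (T : measurableType d) (R : realType)
    (mu : {measure set T -> \bar R}) (D : set T) (mD : measurable D)
    (I : Type) (s : seq I) (f : I -> T -> R) :
  (forall i, mu.-integrable D (EFin \o f i)) ->
  (\int[mu]_(x in D) (\sum_(i <- s) f i x) = \sum_(i <- s) \int[mu]_(x in D) f i x)%R.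
Proof.
move=> fi; rewrite /Rintegral.
under eq_integral do rewrite -sumEFin.
rewrite (integral_sum mD fi s xpredT) sum_fine//.
by move=> i _; exact: integrable_fin_num (fi i).
Qed.

Section surface_measure_moments.
Context {R : realType} {d : nat} (sigma : {measure set Rd R d -> \bar R}).
Context (sm : surface_measure sigma).
Implicit Types (a b e y : 'rV[R]_d).

Lemma surface_measure_Sph : sigma (Sph R d) = 1%E.
Proof.
have [s1 s0 _] := sm.
have mS := @measurable_Sph R d.
have := measureU sigma mS (measurableC mS).
move=> /(_ (setICr _)); rewrite setUv => h.
have h0 : (sigma (Sph R d) + sigma (~` Sph R d) = sigma (Sph R d) + 0)%E.
  by congr (_ + _)%E; exact: s0.
by rewrite adde0 in h0; rewrite -h0 -h.
Qed.

Lemma surface_measure_fin A : measurable A -> (sigma A < +oo)%E.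
Proof.
move=> mA; have [s1 _ _] := sm.
apply: (@le_lt_trans _ _ (sigma setT)); last by rewrite s1 ltry.
by apply: le_measure; rewrite ?inE.
Qed.

Lemma integrable_Sph (f : Rd R d -> R) c : measurable_fun setT f ->
  (forall y, Sph R d y -> `|f y| <= c) ->
  sigma.-integrable (Sph R d) (EFin \o (f : Rd R d -> R)).
Proof.
move=> mf fc; apply: measurable_bounded_integrable.
- exact: measurable_Sph.
- by apply: surface_measure_fin; exact: measurable_Sph.
- exact: measurable_funTS.
- exists c; split; first exact: num_real.
  by move=> x cx y Sy; apply: (le_trans (fc _ Sy)); rewrite ltW.
Qed.

Lemma integral_rotation (Q : 'M[R]_d) (h : Rd R d -> \bar R) : Q *m Q^T = 1%:M ->
  measurable_fun setT h -> (forall y, 0 <= h y)%E ->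
  (\int[sigma]_(y in Sph R d) h ((y : 'rV[R]_d) *m Q) = \int[sigma]_(y in Sph R d) h y)%E.
Proof.
move=> QQ mh h0; have [_ _ rot] := sm.
have mQ := measurable_mulmxr QQ.
pose phi : Rd R d -> Rd R d := fun y : 'rV[R]_d => y *m Q.
transitivity (\int[sigma]_(y in phi @^-1` (Sph R d)) (h \o phi) y)%E.
  congr (integral _ _ _); apply/seteqP; split => y; rewrite /Sph/phi/= enorm_orthogonal//.
rewrite -(@ge0_integral_pushforward _ _ _ _ R phi mQ sigma)//.
- apply: eq_measure_integral => A mA _.
  by rewrite /pushforward -[RHS](rot Q QQ).
- exact: measurable_Sph.
- exact: measurable_funTS.
Qed.

Lemma integral_dotp_rotation (h : R -> R) a b : enorm a = enorm b ->
  measurable_fun setT h -> (forall t, 0 <= h t) ->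
  (\int[sigma]_(y in Sph R d) (h (dotp a y))%:E = \int[sigma]_(y in Sph R d) (h (dotp b y))%:E)%E.
Proof.
move=> ab mh h0; have [Q QQ <-] := orthogonal_transitive ab.
rewrite -(integral_rotation (h := fun y => (h (dotp (a *m Q) y))%:E) QQ)//.
- by apply: eq_integral => y _; rewrite dotp_orthogonal.
- apply/measurable_EFinP; apply: measurableT_comp => //.
  by apply: continuous_measurable_Rd; exact: continuous_dotp.
- by move=> y; rewrite lee_fin.
Qed.

Definition moment e k : R := (\int[sigma]_(y in Sph R d) dotp e y ^+ k.*2)%R.

(** A rotation carries [a] to a multiple of [e], and the integrand is homogeneous. Moving [a] along
    a line then gives access to mixed moments. *)
Lemma moment_scale a e k : enorm e = 1 ->
  moment a k = enorm a ^+ k.*2 * moment e k.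
Proof.
move=> e1; rewrite /moment -RintegralZl//; last 2 first.
- exact: measurable_Sph.
- apply: (@integrable_Sph _ 1).
    apply: measurable_funX; apply: continuous_measurable_Rd.
    exact: continuous_dotp.
  move=> y /= Sy; rewrite normrX exprn_ile1// (le_trans (normr_dotp_le _ _))//.
  by rewrite e1 Sy mulr1.
congr fine.
have -> : (\int[sigma]_(y in Sph R d) (dotp a y ^+ k.*2)%:E =
  \int[sigma]_(y in Sph R d) (dotp (enorm a *: e) y ^+ k.*2)%:E)%E.
  apply: (integral_dotp_rotation (h := fun t => t ^+ k.*2)).
  - by rewrite enormZ e1 mulr1 ger0_norm// enorm_ge0.
  - exact: exprn_measurable.
  - by move=> t; rewrite -mul2n exprM exprn_ge0// sqr_ge0.
by apply: eq_integral => y _; rewrite dotpZl exprMn.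
Qed.

Lemma moment0 e : moment e 0 = 1.
Proof.
rewrite /moment; under eq_Rintegral do rewrite expr0.
by rewrite Rintegral_cst ?surface_measure_Sph ?mul1r//; exact: measurable_Sph.
Qed.

Lemma Sph_entry y i : Sph R d y -> `|y ord0 i| <= 1.
Proof. by move=> <-; exact: enorm_entry. Qed.

Lemma integrable_entries i j p q :
  sigma.-integrable (Sph R d) (EFin \o ((fun y : 'rV[R]_d => y ord0 i ^+ p * y ord0 j ^+ q) : Rd R d -> R)).
Proof.
apply: (@integrable_Sph _ 1).
  have me i' : measurable_fun setT (fun y : Rd R d => (y : 'rV[R]_d) ord0 i').
    by apply: continuous_measurable_Rd; exact: coord_continuous.
  by apply: measurable_funM; apply: measurable_funX.
move=> y Sy; rewrite normrM !normrX.
by rewrite mulr_ile1 ?exprn_ge0// exprn_ile1// Sph_entry.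
Qed.

Lemma dotp_delta i y : dotp (delta_mx ord0 i) y = y ord0 i.
Proof.
rewrite /dotp (bigD1 i)//= !mxE !eqxx mul1r big1 ?addr0// => j ji.
by rewrite mxE (negbTE ji) andbF mul0r.
Qed.

Lemma enorm_delta i : enorm (delta_mx ord0 i : 'rV[R]_d) = 1.
Proof. by rewrite enormE dotp_delta mxE !eqxx sqrtr1. Qed.

(* The coefficient of [s^2] in the identity
   [int (y_i + s y_j)^(2k) = (1 + s^2)^k int y_i^(2k)]. *)
Lemma moment_mixed i j k : i != j ->
  (\int[sigma]_(y in Sph R d) ((y : 'rV[R]_d) ord0 i ^+ k.*2 * (y : 'rV[R]_d) ord0 j ^+ 2))%R
    *+ 'C(k.+1.*2, 2) = moment (delta_mx ord0 i) k.+1 *+ k.+1.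
Proof.
move=> ij.
pose n := k.+1.*2.
pose I l := (\int[sigma]_(y in Sph R d) ((y : 'rV[R]_d) ord0 i ^+ (n - l) * (y : 'rV[R]_d) ord0 j ^+ l))%R.
pose p := \poly_(l < n.+1) (I l *+ 'C(n, l)).
pose q := moment (delta_mx ord0 i) k.+1 *: (1 + 'X^2) ^+ k.+1 : {poly R}.
have pq : p = q.
  apply: poly_eval_inj => s.
  rewrite /p /q hornerZ horner_exp !hornerE.
  pose a : 'rV[R]_d := delta_mx ord0 i + s *: delta_mx ord0 j.
  have aE : enorm a ^+ 2 = 1 + s ^+ 2.
    rewrite sqr_enorm dotpDl !dotpDr !dotpZl !dotpZr !dotp_delta !mxE !eqxx.
    by rewrite (negbTE ij) eq_sym (negbTE ij)/=; ring.
  have := moment_scale a k.+1 (enorm_delta i).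
  rewrite -mul2n exprM aE mulrC => <-.
  rewrite horner_poly /moment.
  transitivity (\int[sigma]_(y in Sph R d) (\sum_(l < n.+1)
      (s ^+ l *+ 'C(n, l)) * ((y : 'rV[R]_d) ord0 i ^+ (n - l) * (y : 'rV[R]_d) ord0 j ^+ l)))%R.
    rewrite (Rintegral_sum measurable_Sph); last first.
      by move=> l; exact: (@integrableZl _ _ _ sigma _ measurable_Sph (s ^+ l *+ 'C(n, l)) _ (integrable_entries i j (n - l) l)).
    apply: eq_bigr => l _; rewrite RintegralZl ?mulrnAl 1?mulrC//.
      exact: measurable_Sph.
    exact: integrable_entries.
  apply: eq_Rintegral => y _; rewrite dotpDl dotpZl !dotp_delta exprDn.
  by apply: eq_bigr => l _; rewrite exprMn mulrnAl; congr (_ *+ _); ring.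
have /(congr1 (fun r : {poly R} => r`_2)) := pq.
rewrite /p /q coef_poly coefZ coef_1DX2_exp ltnS.
rewrite (_ : (2 <= n)%N); last by rewrite /n doubleS.
by rewrite /I /n doubleS subn2/= mulr_natr.
Qed.

(** Inserting |y|^2 = 1 splits the moment into mixed ones: the diagonal term is the next moment, and
    each of the [d - 1] others is the next moment divided by 2k + 1. *)
Lemma moment_rec i k : (k.*2.+1)%:R * moment (delta_mx ord0 i) k
  = (k.*2 + d)%:R * moment (delta_mx ord0 i) k.+1.
Proof.
set m := moment _.
pose J j := (\int[sigma]_(y in Sph R d) ((y : 'rV[R]_d) ord0 i ^+ k.*2 * (y : 'rV[R]_d) ord0 j ^+ 2))%R.
have sumJ : \sum_(j < d) J j = m k.
  rewrite -(Rintegral_sum measurable_Sph); last first.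
    by move=> j; exact: integrable_entries.
  apply: eq_Rintegral => y; rewrite inE => Sy.
  rewrite -mulr_sumr dotp_delta (_ : \sum_(j < d) _ = enorm (y : 'rV[R]_d) ^+ 2).
    by rewrite Sy expr1n mulr1.
  by rewrite sqr_enorm; apply: eq_bigr => j _; rewrite expr2.
have Ji : J i = m k.+1.
  by apply: eq_Rintegral => y _; rewrite dotp_delta -exprD addn2 doubleS.
have Jj j : i != j -> k.*2.+1%:R * J j = m k.+1.
  move=> /(moment_mixed k); rewrite -/(J j) -/m => E.
  have k1 : (k.+1%:R : R) != 0 by rewrite pnatr_eq0.
  apply: (mulfI k1); rewrite [RHS]mulr_natl -E -[RHS]mulr_natl mulrA -natrM.
  (* The binomial coefficient is (k + 1)(2k + 1), and [k.+1] cancels. *)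
  by congr (_%:R * _); rewrite bin2 -doubleMl doubleK doubleS.
rewrite -sumJ (bigD1 i)//= mulrDr mulr_sumr.
rewrite (eq_bigr (fun=> m k.+1)); last by move=> j; rewrite eq_sym => /Jj.
rewrite Ji sumr_const -[X in _ + X]mulr_natl -mulrDl -natrD; congr (_%:R * _).
rewrite cardC1 card_ord addSnnS prednK//.
exact: leq_ltn_trans (ltn_ord i).
Qed.

End surface_measure_moments.

(** * Asymptotics of the Laplace transform *)

Local Opaque Gamma.

Section gamma_ratio.
Context {R : realType}.

(** [Gamma_half_step] at [x] is the lower bound. At [x + 1/2] it bounds [Gamma (x + 1)], which is
    [x * Gamma x], and gives the upper one. *)
Lemma Gamma_step_bounds (x : R) : 0 < x ->
  1 <= Num.sqrt x * Gamma x / Gamma (x + 2^-1) <= Num.sqrt ((x + 2^-1) / x).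
Proof.
move=> x0; have xh : 0 < x + 2^-1 by rewrite ltr_wpDr.
have G1 := Gamma_gt0 xh.
have h1 := Gamma_half_step x0.
have h2 := Gamma_half_step xh.
have xE : x + 2^-1 + 2^-1 = x + 1 by field.
rewrite xE GammaS// in h2.
have sx : 0 < Num.sqrt x by rewrite sqrtr_gt0.
move: (Gamma x) (Gamma (x + 2^-1)) G1 h1 h2 => g h G1 h1 h2.
rewrite ler_pdivlMr// mul1r h1/= ler_pdivrMr// sqrtrM ?(ltW xh)// sqrtrV ?(ltW x0)//.
rewrite mulrAC ler_pdivlMr//; apply: le_trans h2.
by rewrite mulrAC -expr2 sqr_sqrtr ?(ltW x0).
Qed.

Lemma cvg_Gamma_step (c : R) : 0 < c ->
  (Num.sqrt n.+1%:R * Gamma (n.+1%:R + c) / Gamma (n.+1%:R + c + 2^-1) : R)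
    @[n --> \oo] --> (1 : R).
Proof.
move=> c0.
have r0 n : 0 < n.+1%:R + c by rewrite ltr_wpDl.
have cr (b : R) : 0 <= b -> ((n.+1%:R + b) / (n.+1%:R + c)) @[n --> \oo] --> (1 : R).
  move=> b0.
  have E n : (n.+1%:R + b) / (n.+1%:R + c) = (1 + b * n.+1%:R^-1) / (1 + c * n.+1%:R^-1).
    have := r0 n; have : 0 < n.+1%:R :> R by [].
    move: (n.+1%:R : R) => x x0 xc; field.
    by rewrite !gt_eqF//= addrC.
  rewrite (funext E).
  rewrite -[X in _ --> X](divr1 1); apply: cvgM; last apply: cvgV.
  - rewrite -[X in _ --> X](addr0 1) -[in X in _ --> X](mulr0 b).
    by apply: cvgD; [exact: cvg_cst|apply: cvgMr; exact: cvg_harmonic].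
  - by rewrite oner_neq0.
  - rewrite -[X in _ --> X](addr0 1) -[in X in _ --> X](mulr0 c).
    by apply: cvgD; [exact: cvg_cst|apply: cvgMr; exact: cvg_harmonic].
have sq (b : R) : 0 <= b ->
    Num.sqrt ((n.+1%:R + b) / (n.+1%:R + c)) @[n --> \oo] --> (1 : R).
  move=> b0; rewrite -[X in _ --> X]sqrtr1.
  apply: (@continuous_cvg _ _ _ _ _ _ (@Num.sqrt R)); first exact: sqrt_continuous.
  exact: cr.
have E n : Num.sqrt n.+1%:R * Gamma (n.+1%:R + c) / Gamma (n.+1%:R + c + 2^-1)
    = Num.sqrt ((n.+1%:R + 0) / (n.+1%:R + c)) *
      (Num.sqrt (n.+1%:R + c) * Gamma (n.+1%:R + c) / Gamma (n.+1%:R + c + 2^-1)).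
  have := r0 n; set x := n.+1%:R + c => x0.
  have sx : Num.sqrt x != 0 by rewrite gt_eqF// sqrtr_gt0.
  rewrite addr0 sqrtrM// sqrtrV ?ltW// !mulrA; congr (_ * _ / _).
  by rewrite divfK.
rewrite (funext E) -[X in _ --> X](mulr1 1); apply: cvgM; first exact: sq.
apply: (@squeeze_cvgr _ _ _ _ (fun=> 1)
   (fun n : nat => Num.sqrt ((n.+1%:R + (c + 2^-1)) / (n.+1%:R + c)))).
- by near=> n; rewrite addrA; exact: Gamma_step_bounds.
- exact: cvg_cst.
- by apply: sq; rewrite addr_ge0// ltW.
Unshelve. all: by end_near. Qed.

(** Induction by half steps. The moments compare the arguments k + 1/2 and k + d/2, which is the
    case [j = d - 1]. *)
Lemma cvg_Gamma_ratio j :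
  (Gamma (n.+1%:R + 2^-1) / Gamma (n.+1%:R + j.+1%:R / 2) * Num.sqrt n.+1%:R ^+ j : R)
    @[n --> \oo] --> (1 : R).
Proof.
elim: j => [|j IH].
  have E (n : nat) : Gamma (n.+1%:R + 2^-1) / Gamma (n.+1%:R + 1 / 2) * Num.sqrt n.+1%:R ^+ 0 = 1 :> R.
    by rewrite expr0 mulr1 mul1r divff// gt_eqF// Gamma_gt0.
  by rewrite (funext E); exact: cvg_cst.
have c0 : 0 < j.+1%:R / 2 :> R by rewrite divr_gt0.
rewrite -[X in _ --> X](mulr1 1).
apply: cvg_trans (cvgM IH (cvg_Gamma_step c0)); apply: near_eq_cvg; near=> n.
have -> : j.+2%:R / 2 = j.+1%:R / 2 + 2^-1 :> R.
  by rewrite -[j.+2]addn1 natrD mulrDl mul1r.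
rewrite /= addrA exprSr.
have G1 : 0 < Gamma (n.+1%:R + j.+1%:R / 2 : R) by rewrite Gamma_gt0// ltr_wpDl.
have G2 : 0 < Gamma (n.+1%:R + j.+1%:R / 2 + 2^-1 : R).
  by rewrite Gamma_gt0// ltr_wpDr// ltr_wpDl.
by field; rewrite !gt_eqF.
Unshelve. all: by end_near. Qed.

End gamma_ratio.

(** * Closed form of the moments, and their comparison with the Laplace transform *)

Section cap_asymptotics.
Context {R : realType} {d : nat} (sigma : {measure set Rd R d -> \bar R}).
Context (sm : surface_measure sigma).
Implicit Types (a b e y : 'rV[R]_d).

(** Both sides obey the recurrence [moment_rec]; the values at [k = 0] agree because [Gamma 2^-1] is
    the square root of pi. *)
Lemma moment_Gamma i k : moment sigma (delta_mx ord0 i) k =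
  Gamma (k%:R + 2^-1) * Gamma (d%:R / 2) / (Num.sqrt pi * Gamma (k%:R + d%:R / 2)).
Proof.
have d0 : 0 < d%:R / 2 :> R.
  by rewrite divr_gt0// ltr0n (leq_ltn_trans _ (ltn_ord i)).
have sp : 0 < Num.sqrt pi :> R by rewrite sqrtr_gt0 pi_gt0.
elim: k => [|k IH].
  rewrite (moment0 sm) !add0r Gamma_half divff// mulf_neq0// gt_eqF//.
  exact: Gamma_gt0.
have kd : 0 < k%:R + d%:R / 2 :> R by rewrite ltr_wpDl.
have kh : 0 < k%:R + 2^-1 :> R by rewrite ltr_wpDl.
have kS (c : R) : k.+1%:R + c = k%:R + c + 1 by rewrite -natr1 addrAC.
have := moment_rec sm i k; rewrite IH !kS !GammaS//.
have G1 := Gamma_gt0 kd; have G2 := Gamma_gt0 d0.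
rewrite -natr1 natrD -mul2n natrM => E.
have kd2 : 2 * k%:R + d%:R != 0 :> R by rewrite gt_eqF//; move: kd; lra.
apply: (mulfI kd2); rewrite -E.
have G1' : Gamma (k%:R + d%:R / 2 : R) != 0 by rewrite gt_eqF.
have sp' : Num.sqrt (pi : R) != 0 by rewrite gt_eqF.
move: (Gamma _) (Gamma _) (Gamma _) (Num.sqrt _) G1' sp' => g1 g2 g3 s g30 s0.
by field; rewrite g30 s0 mulrC kd2.
Qed.

Lemma cvg_moment i :
  (n.+1%:R `^ ((d%:R - 1) / 2) * moment sigma (delta_mx ord0 i) n.+1) @[n --> \oo]
    --> Gamma (d%:R / 2) / Num.sqrt pi.
Proof.
have d0 : (0 < d)%N by exact: leq_ltn_trans (ltn_ord i).
have sp : 0 < Num.sqrt pi :> R by rewrite sqrtr_gt0 pi_gt0.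
have /(cvgMl (b := Gamma (d%:R / 2) / Num.sqrt pi)) := @cvg_Gamma_ratio R d.-1.
rewrite mul1r; apply: cvg_trans; apply: near_eq_cvg; near=> n.
rewrite prednK// moment_Gamma.
have -> : n.+1%:R `^ ((d%:R - 1) / 2) = Num.sqrt n.+1%:R ^+ d.-1 :> R.
  rewrite -powR12_sqrt// -powR_mulrn ?powR_ge0// -powRrM; congr (_ `^ _).
  by rewrite -subn1 natrB// mulrC.
have G1 : 0 < Gamma (n.+1%:R + d%:R / 2 : R) by rewrite Gamma_gt0// ltr_wpDr// divr_ge0.
by field; rewrite !gt_eqF.
Unshelve. all: by end_near. Qed.

(** The variable [1 - dotp e y] is the height of [y] below the pole [e]; for large [z] the integral
    weighs small caps around [e]. *)
Definition laplace e (z : R) : R :=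
  (\int[sigma]_(y in Sph R d) expR (- (z * (1 - dotp e y))))%R.

Lemma Sph_dotp e y : enorm e = 1 -> Sph R d y -> -1 <= dotp e y <= 1.
Proof.
by move=> e1 Sy; rewrite -ler_norml (le_trans (normr_dotp_le _ _))// e1 Sy mulr1.
Qed.

Lemma measurable_laplacef e (z : R) :
  measurable_fun setT (fun y : Rd R d => expR (- (z * (1 - dotp e y)))).
Proof.
apply: measurableT_comp; first exact: measurable_expR.
apply: measurableT_comp => //; apply: measurable_funM => //.
apply: measurable_funB => //.
by apply: continuous_measurable_Rd; exact: continuous_dotp.
Qed.

Lemma integrable_laplacef e (z : R) : enorm e = 1 -> 0 <= z ->
  sigma.-integrable (Sph R d) (EFin \o (fun y : Rd R d => expR (- (z * (1 - dotp e y))))).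
Proof.
move=> e1 z0; apply: (integrable_Sph sm (c := 1)); first exact: measurable_laplacef.
move=> y Sy; rewrite ger0_norm ?expR_ge0// expR_le1 oppr_le0 mulr_ge0// subr_ge0.
by have /andP[] := Sph_dotp e1 Sy.
Qed.

Lemma laplace_ge0 e (z : R) : 0 <= laplace e z.
Proof. by apply: Rintegral_ge0 => y _; exact: expR_ge0. Qed.

Lemma laplace_le1 e (z : R) : enorm e = 1 -> 0 <= z -> laplace e z <= 1.
Proof.
move=> e1 z0; apply: (@le_trans _ _ (\int[sigma]_(y in Sph R d) 1)%R).
  apply: le_Rintegral; [exact: measurable_Sph|exact: integrable_laplacef| |].
    by apply: (integrable_Sph sm (c := 1)) => // y _; rewrite normr1.
  move=> y Sy; rewrite expR_le1 oppr_le0 mulr_ge0// subr_ge0.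
  by have /andP[] := Sph_dotp e1 Sy.
by rewrite Rintegral_cst ?(surface_measure_Sph sm) ?mul1r//; exact: measurable_Sph.
Qed.

Lemma laplace_rotation e e' (z : R) : enorm e = enorm e' -> laplace e z = laplace e' z.
Proof.
move=> ee; congr fine.
apply: (integral_dotp_rotation sm (h := fun t => expR (- (z * (1 - t)))) ee).
- apply: measurableT_comp; first exact: measurable_expR.
  by apply: measurableT_comp => //; apply: measurable_funM => //; apply: measurable_funB.
- by move=> t; exact: expR_ge0.
Qed.

(** Even powers of [dotp e y] peak at both poles, the exponential at [e] only; symmetrizing makes
    the two comparable pointwise. *)
Lemma double_laplace e (z : R) : enorm e = 1 -> 0 <= z -> 2 * laplace e z =
  (\int[sigma]_(y in Sph R d)
    (expR (- (z * (1 - dotp e y))) + expR (- (z * (1 + dotp e y)))))%R.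
Proof.
move=> e1 z0; have e1' : enorm (- e) = 1 by rewrite enormN.
rewrite mulr_natl mulr2n [X in _ + X](@laplace_rotation e (- e)) ?enormN//.
rewrite -RintegralD; last 3 first.
- exact: measurable_Sph.
- exact: integrable_laplacef.
- exact: integrable_laplacef.
by apply: eq_Rintegral => y _; rewrite dotpNl opprK.
Qed.

Lemma exprn_le_expR (w z : R) n : 0 <= w <= 1 -> z <= n%:R ->
  w ^+ n <= expR (- (z * (1 - w))).
Proof.
move=> /andP[w0 w1] zn.
have : w <= expR (w - 1) by have := expR_ge1Dx (w - 1); rewrite addrC subrK.
move=> /(lerXn2r n); rewrite !nnegrE expR_ge0 => /(_ w0 isT)/le_trans; apply.
by rewrite -expRM_natl ler_expR; nra.
Qed.

(** Near 1, w is at least exp(1 - 1/w), and the n-th power of this beats exp(-z(1 - w)) as soon as n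
    is at most z w, which holds for w > 1 - delta. For smaller w the exponential is below the tail
    term. *)
Lemma expR_le_exprn (w z delta : R) n : 0 <= w <= 1 -> 0 < delta < 1 -> 0 <= z ->
  n%:R <= z * (1 - delta) ->
  expR (- (z * (1 - w))) <= w ^+ n + expR (- (z * delta)).
Proof.
move=> /andP[w0 w1] /andP[d0 d1] z0 nz.
have [wd|wd] := leP w (1 - delta).
  rewrite (@le_trans _ _ (expR (- (z * delta))))//; last by rewrite lerDr exprn_ge0.
  by rewrite ler_expR; nra.
have {}w0 : 0 < w by apply: lt_trans wd; rewrite subr_gt0.
rewrite (@le_trans _ _ (w ^+ n))//; last by rewrite lerDl expR_ge0.
have : expR (1 - w^-1) <= w.
  rewrite -opprB expRN -[leRHS]invrK lef_pV2 ?posrE ?expR_gt0 ?invr_gt0//.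
  by have := expR_ge1Dx (w^-1 - 1); rewrite addrC subrK.
move=> /(lerXn2r n); rewrite !nnegrE expR_ge0 => /(_ isT (ltW w0)); apply: le_trans.
rewrite -expRM_natl ler_expR -subr_ge0.
have -> : n%:R * (1 - w^-1) - - (z * (1 - w)) = (1 - w) / w * (z * w - n%:R).
  by field; rewrite gt_eqF.
by rewrite mulr_ge0 ?divr_ge0 ?(ltW w0)//; nra.
Qed.

Lemma moment_le_laplace e (z : R) k : enorm e = 1 -> 0 <= z -> z <= k.*2%:R ->
  moment sigma e k <= 2 * laplace e z.
Proof.
move=> e1 z0 zk; rewrite double_laplace//.
have e1' : enorm (- e) = 1 by rewrite enormN.
apply: le_Rintegral; first exact: measurable_Sph.
- apply: (integrable_Sph sm (c := 1)).
    by apply: measurable_funX; apply: continuous_measurable_Rd; exact: continuous_dotp.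
  by move=> y Sy; rewrite normrX exprn_ile1// ler_norml Sph_dotp.
- have := integrableD (@measurable_Sph R d) (integrable_laplacef e1 z0) (integrable_laplacef e1' z0).
  by apply: eq_integrable => [|y _]; [exact: measurable_Sph|rewrite /= dotpNl opprK].
move=> y Sy; have /andP[u1 u2] := Sph_dotp e1 Sy.
have -> : dotp e y ^+ k.*2 = `|dotp e y| ^+ k.*2.
  by rewrite -normrX ger0_norm// -mul2n exprM exprn_ge0// sqr_ge0.
have ub : 0 <= `|dotp e y| <= 1 by rewrite normr_ge0 ler_norml u1.
apply: (le_trans (exprn_le_expR ub zk)).
(* The sign tells which of the two exponentials dominates the power; the other one is dropped. *)
case: (ger0P (dotp e y)) => _; first by rewrite lerDl expR_ge0.
by rewrite opprK lerDr expR_ge0.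
Qed.

Lemma laplace_le_moment e (z delta : R) k : enorm e = 1 -> 0 <= z ->
  0 < delta < 1 -> k.*2%:R <= z * (1 - delta) ->
  2 * laplace e z <= moment sigma e k + 2 * expR (- (z * delta)).
Proof.
move=> e1 z0 dd kz; rewrite double_laplace//.
have e1' : enorm (- e) = 1 by rewrite enormN.
have im : sigma.-integrable (Sph R d) (EFin \o (fun y : Rd R d => dotp e y ^+ k.*2)).
  apply: (integrable_Sph sm (c := 1)).
    by apply: measurable_funX; apply: continuous_measurable_Rd; exact: continuous_dotp.
  by move=> y Sy; rewrite normrX exprn_ile1// ler_norml Sph_dotp.
have ic : sigma.-integrable (Sph R d) (EFin \o (fun y : Rd R d => 2 * expR (- (z * delta)))).
  by apply: (integrable_Sph sm (c := `|2 * expR (- (z * delta))|)).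
have -> : moment sigma e k + 2 * expR (- (z * delta)) =
    (\int[sigma]_(y in Sph R d) (dotp e y ^+ k.*2 + 2 * expR (- (z * delta))))%R.
  rewrite RintegralD//; last exact: measurable_Sph.
  by rewrite Rintegral_cst ?(surface_measure_Sph sm) ?mulr1//; exact: measurable_Sph.
apply: le_Rintegral; first exact: measurable_Sph.
- have := integrableD (@measurable_Sph R d) (integrable_laplacef e1 z0) (integrable_laplacef e1' z0).
  by apply: eq_integrable => [|y _]; [exact: measurable_Sph|rewrite /= dotpNl opprK].
- by have := integrableD (@measurable_Sph R d) im ic.
move=> y Sy; have /andP[u1 u2] := Sph_dotp e1 Sy.
have -> : dotp e y ^+ k.*2 = `|dotp e y| ^+ k.*2.
  by rewrite -normrX ger0_norm// -mul2n exprM exprn_ge0// sqr_ge0.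
have ub : 0 <= `|dotp e y| <= 1 by rewrite normr_ge0 ler_norml u1.
have h := expR_le_exprn ub dd z0 kz.
have /andP[d0 d1] := dd.
(* The exponential of the opposite pole sees a height of at least 1, which exceeds [delta]. Its tail
   and the one from [expR_le_exprn] make up the factor 2. *)
have h2 (w : R) : 0 <= w -> expR (- (z * (1 + w))) <= expR (- (z * delta)).
  by move=> w0; rewrite ler_expR; nra.
rewrite mulr_natl mulr2n addrA.
move: h; case: (ger0P (dotp e y)) => u0 h.
  by rewrite lerD// h2.
move: h; rewrite opprK => h; rewrite addrC lerD//; apply: h2.
by rewrite oppr_ge0 ltW.
Qed.

End cap_asymptotics.

(** * Limits at infinity in a real variable *)

Section laplace_limit.
Context {R : realType}.

Lemma continuous_powR (s x : R) : 0 < x -> {for x, continuous (fun t : R => t `^ s)}.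
Proof.
move=> x0; have h := is_derive1_powR s x0.
by apply: differentiable_continuous; apply/derivable1_diffP; exact: ex_derive.
Qed.

Lemma cvgy_truncn (a : R) : 0 < a -> Num.trunc (a * z) @[z --> +oo] --> \oo.
Proof.
move=> a0 A [N _ NA].
apply: (filterS _ (nbhs_pinfty_ge (num_real (N%:R / a)))) => z hz.
apply: NA => /=; rewrite truncn_ge_nat.
  by rewrite mulrC -ler_pdivrMr.
by rewrite mulr_ge0 ?(ltW a0)// (le_trans _ hz)// divr_ge0// ltW.
Qed.

Lemma cvgy_div_truncn (a : R) : 0 < a ->
  (z / (Num.trunc (a * z)).+1%:R) @[z --> +oo] --> a^-1.
Proof.
move=> a0.
apply: (@squeeze_cvgr _ _ _ _ (fun z => (a + z^-1)^-1) (fun=> a^-1)).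
- have := nbhs_pinfty_gt (num_real (0 : R)); apply: filterS => z z0.
  have az : 0 < a * z by rewrite mulr_gt0.
  have /andP[t1 t2] := truncn_itv (ltW az).
  set k : R := _.+1%:R in t2 *.
  have k0 : 0 < k by [].
  have kE : k <= a * z + 1 by rewrite /k -natr1 lerD2r.
  apply/andP; split.
    rewrite ler_pdivlMr// mulrC ler_pdivrMr ?addr_gt0 ?invr_gt0//.
    by rewrite mulrDr divff ?gt_eqF// (mulrC z a).
  by rewrite ler_pdivrMr// mulrC ler_pdivlMr// mulrC ltW.
- apply: cvgV; first by rewrite gt_eqF.
  rewrite -[X in _ --> X]addr0; apply: cvgD; first exact: cvg_cst.
  apply/gtr0_cvgV0; last exact: cvg_id.
  exact: nbhs_pinfty_gt (num_real (0 : R)).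
- exact: cvg_cst.
Qed.

Lemma cvgy_powR_expRN (s delta : R) : 0 < s -> 0 < delta ->
  (z `^ s * expR (- (z * delta))) @[z --> +oo] --> (0 : R).
Proof.
move=> s0 d0.
pose K := delta `^ (- s) * (2 * s) `^ s.
apply: (@squeeze_cvgr _ _ _ _ (fun=> 0) (fun z => K * expR (- (z * (delta / 2))))).
- have := nbhs_pinfty_gt (num_real (0 : R)); apply: filterS => z z0.
  rewrite mulr_ge0 ?powR_ge0 ?expR_ge0//=.
  have zE : z `^ s = delta `^ (- s) * (z * delta) `^ s.
    rewrite powRM ?(ltW z0) ?(ltW d0)// mulrCA -powRD ?(gt_eqF d0) ?implybT//.
    by rewrite addNr powRr0 mulr1.
  rewrite zE /K -!mulrA ler_wpM2l ?powR_ge0//.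
  have zd : 0 <= z * delta by rewrite mulr_ge0 ?ltW.
  have := powR_le_expR s0 zd.
  move=> /(ler_wpM2r (expR_ge0 (- (z * delta))))/le_trans; apply.
  rewrite -mulrA ler_wpM2l ?powR_ge0// -expRD ler_expR; lra.
- exact: cvg_cst.
- rewrite -[X in _ --> X](mulr0 K); apply: cvgMr.
  apply: (cvg_comp (fun t : R => t * (delta / 2)) (fun t : R => expR (- t))); last exact: cvgr_expR.
  by apply: gt0_cvgMly => //; rewrite divr_gt0.
Qed.

End laplace_limit.

(** * The Laplace transform with its exact leading constant *)

Section laplace_limit_sphere.
Context {R : realType} {d : nat} (sigma : {measure set Rd R d -> \bar R}).
Context (sm : surface_measure sigma) (d2 : (2 <= d)%N).
Implicit Types (a b e y : 'rV[R]_d).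

(** Limit of z^((d-1)/2) times the Laplace transform. The factor 1/2 accounts for the two poles, and
    the power of 2 for the index of the matching moment, about z/2. *)
Definition cap_const : R :=
  2^-1 * 2 `^ ((d%:R - 1) / 2) * (Gamma (d%:R / 2) / Num.sqrt pi).

Let p : R := (d%:R - 1) / 2.
Let c0 : R := Gamma (d%:R / 2) / Num.sqrt pi.

Let p0 : 0 < p.
Proof. by rewrite divr_gt0// subr_gt0 ltr1n. Qed.

Lemma cvgy_moment i (a : R) : 0 < a ->
  (z `^ p * moment sigma (delta_mx ord0 i) (Num.trunc (a * z)).+1) @[z --> +oo]
    --> a^-1 `^ p * c0.
Proof.
move=> a0.
pose k (z : R) := Num.trunc (a * z).
apply: (@cvg_trans _ ((z / (k z).+1%:R) `^ p *
   ((k z).+1%:R `^ p * moment sigma (delta_mx ord0 i) (k z).+1) @[z --> +oo])).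
  apply: near_eq_cvg; have := nbhs_pinfty_gt (num_real (0 : R)).
  apply: filterS => z z0; rewrite mulrA -powRM ?divr_ge0 ?(ltW z0)//.
  by rewrite divfK.
apply: cvgM.
  apply: (@continuous_cvg _ _ _ _ _ _ (fun t : R => t `^ p)).
    by apply: continuous_powR; rewrite invr_gt0.
  exact: cvgy_div_truncn.
exact: (cvg_comp _ _ (cvgy_truncn a0) (cvg_moment sm i)).
Qed.

Lemma laplace_eventually e (eta : R) : enorm e = 1 -> 0 < eta ->
  \forall z \near +oo, cap_const - eta <= z `^ p * laplace sigma e z <= cap_const + eta.
Proof.
move=> e1 eta0.
pose i := Ordinal (ltnW d2).
have ei z : laplace sigma e z = laplace sigma (delta_mx ord0 i) z.
  by apply: (laplace_rotation sm); rewrite enorm_delta.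
have c00 : 0 <= c0 by rewrite divr_ge0 ?sqrtr_ge0// ltW// Gamma_gt0// divr_gt0// ltr0n ltnW.
have kE : cap_const = 2^-1 * ((2^-1)^-1 `^ p * c0).
  by rewrite /cap_const invrK -mulrA.
(* The lower bound uses moments of index about z/2. For the upper bound the degree must stay a fixed
   proportion below z, so the slope [a] is slightly less than 1/2, at a cost of [eta / 2]. *)
have [a [a0 a2 ac]] : exists a : R, [/\ 0 < a, a < 2^-1 & 2^-1 * (a^-1 `^ p * c0) < cap_const + eta / 2].
  have h : (2^-1 * (a^-1 `^ p * c0)) @[a --> (2^-1 : R)] --> cap_const.
    rewrite kE; apply: cvgMr; apply: cvgMl.
    apply: (@continuous_cvg _ _ _ _ _ _ (fun t : R => t `^ p)).
      by apply: continuous_powR; rewrite invr_gt0 invr_gt0.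
    by apply: cvgV; [rewrite invr_eq0 pnatr_eq0|exact: cvg_id].
  have {}h := cvg_at_left_filter h.
  have h1 : \forall a \near (2^-1 : R)^'-, 2^-1 * (a^-1 `^ p * c0) < cap_const + eta / 2.
    by apply: (cvgr_lt _ h); rewrite ltrDl divr_gt0.
  have h2 : \forall a \near (2^-1 : R)^'-, 0 < a by exact: nbhs_left_gt.
  have h3 : \forall a \near (2^-1 : R)^'-, a < 2^-1 by exact: nbhs_left_lt.
  have [a [? [? ?]]] := filter_ex (filterI h1 (filterI h2 h3)).
  by exists a.
(* Half of the gap [1 - 2 * a] feeds the tail; the other half absorbs the rounding of the index once
   [2 <= z * delta]. *)
pose delta := (1 - 2 * a) / 2.
have d0 : 0 < delta by rewrite /delta; lra.
have d1 : delta < 1 by rewrite /delta; lra.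
have dd : 0 < delta < 1 by rewrite d0.
have lo := cvgy_moment i (a := 2^-1) ltac:(by rewrite invr_gt0).
have hi := cvgy_moment i a0.
have ex := cvgy_powR_expRN p0 d0.
have {}lo : \forall z \near +oo, cap_const - eta <
    2^-1 * (z `^ p * moment sigma (delta_mx ord0 i) (Num.trunc (2^-1 * z)).+1).
  apply: (cvgr_gt _ (cvgMr lo)); rewrite -kE; lra.
have {}hi : \forall z \near +oo, 2^-1 * (z `^ p * moment sigma (delta_mx ord0 i) (Num.trunc (a * z)).+1)
     + z `^ p * expR (- (z * delta)) < cap_const + eta.
  apply: (cvgr_lt _ (cvgD (cvgMr hi) ex)); lra.
near=> z.
have z0 : 0 < z by near: z; exact: nbhs_pinfty_gt.
have zp : 0 < z `^ p by rewrite powR_gt0.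
apply/andP; split.
  have l : cap_const - eta < 2^-1 * (z `^ p * moment sigma (delta_mx ord0 i) (Num.trunc (2^-1 * z)).+1).
    by near: z.
  apply: (le_trans (ltW l)); rewrite mulrCA ler_pM2l// ei.
  rewrite -(ler_pM2l (ltr0Sn R 1)) mulrA divff// mul1r.
  apply: (moment_le_laplace sm); [exact: enorm_delta|exact: ltW|].
  have := truncnS_gt (2^-1 * z); rewrite -mul2n natrM; lra.
have l : 2^-1 * (z `^ p * moment sigma (delta_mx ord0 i) (Num.trunc (a * z)).+1)
     + z `^ p * expR (- (z * delta)) < cap_const + eta.
  by near: z.
apply: le_trans (ltW l); rewrite mulrCA -mulrDr ler_pM2l// ei.
rewrite -(ler_pM2l (ltr0Sn R 1)) mulrDr mulrA divff// mul1r.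
apply: (laplace_le_moment sm); [exact: enorm_delta|exact: ltW|exact: dd|].
have zd : 2 <= z * delta by rewrite -ler_pdivrMr//; near: z; exact: nbhs_pinfty_ge.
have az : 0 <= a * z by rewrite mulr_ge0 ?ltW.
have /andP[t1 _] := truncn_itv az.
rewrite -mul2n natrM -natr1; move: zd; rewrite /delta; nra.
Unshelve. all: by end_near. Qed.

(** Extends the asymptotics to all [z > 0], the range met when integrating in [t]. The error has a
    steeper exponent: it dominates for bounded [z], and is of lower order for large [z]. *)
Lemma laplace_bounds e (eta delta : R) : enorm e = 1 -> 0 < eta -> 0 < delta ->
  exists2 C : R, 0 <= C & forall z : R, 0 < z ->
   (cap_const - eta) * z `^ (- p) <= laplace sigma e z + C * z `^ (- (p + delta)) /\
   laplace sigma e z <= (cap_const + eta) * z `^ (- p) + C * z `^ (- (p + delta)).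
Proof.
move=> e1 eta0 dl0.
have [Z [Zr hZ]] := laplace_eventually e1 eta0.
pose M := Num.max 1 (Z + 1).
have M1 : 1 <= M by rewrite le_max lexx.
have M0 : 0 < M by exact: lt_le_trans M1.
have cc0 : 0 <= cap_const.
  rewrite mulr_ge0// ?mulr_ge0 ?powR_ge0//.
  by rewrite ltW// Gamma_gt0// divr_gt0// ltr0n ltnW.
(* Below the threshold [M] the first summand takes care of the transform, which is at most 1, and
   the second of the leading term. *)
exists (M `^ (p + delta) + cap_const * M `^ delta).
  by rewrite addr_ge0 ?powR_ge0// (mulr_ge0 cc0)// powR_ge0.
move=> z z0.
set A := z `^ (- p); have A0 : 0 < A by rewrite powR_gt0.
set B := z `^ (- (p + delta)); have B0 : 0 < B by rewrite powR_gt0.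
set C := M `^ _ + _.
have C0 : 0 <= C by rewrite addr_ge0 ?powR_ge0// (mulr_ge0 cc0)// powR_ge0.
have [zM|Mz] := leP M z.
  have /hZ /andP[h1 h2] : Z < z by apply: lt_le_trans zM; rewrite lt_max ltrDl ltr01 orbT.
  have LE : laplace sigma e z = z `^ p * laplace sigma e z * A.
    by rewrite mulrAC -powRD ?(gt_eqF z0) ?implybT// subrr powRr0 mul1r.
  by split; rewrite LE; have := mulr_ge0 C0 (ltW B0); nra.
have pd0 : 0 < p + delta by rewrite addr_gt0.
have h1 : 1 <= M `^ (p + delta) * B.
  rewrite /B powRN ler_pdivlMr ?powR_gt0// mul1r.
  by apply: ge0_ler_powR; rewrite ?nnegrE ?ltW.
have h2 : A <= M `^ delta * B.
  have -> : A = z `^ delta * B.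
    by rewrite /A /B -powRD ?(gt_eqF z0) ?implybT//; congr (_ `^ _); ring.
  rewrite ler_pM2r//; apply: ge0_ler_powR; rewrite ?nnegrE ?ltW//.
have L0 := laplace_ge0 sigma e z.
have L1 := laplace_le1 sm e1 (ltW z0).
have k1 : cap_const * A <= cap_const * (M `^ delta * B) by rewrite ler_wpM2l.
have k2 : 0 <= eta * A by rewrite mulr_ge0 ?ltW.
have k3 := mulr_ge0 cc0 (ltW A0).
have k4 : 0 <= cap_const * (M `^ delta * B) by exact: le_trans k1.
rewrite /C !mulrDl mulNr -mulrA; split; lra.
Qed.

End laplace_limit_sphere.

(** * Mass of the Poisson kernel *)

(** Restricting [m] to [setT] packages the finiteness hypothesis into a finite measure; the domains
    are traded for an extension of [f] by 0. *)
Lemma fubini_tonelli_in d (T : measurableType d) (R : realType)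
    (m : {measure set T -> \bar R}) (moo : (m setT < +oo)%E)
    (D : set T) (mD : measurable D) (E : set R) (mE : measurable E)
    (f : T * R -> \bar R) : measurable_fun setT f -> (forall z, 0 <= f z)%E ->
  (\int[m]_(x in D) \int[lebesgue_measure]_(t in E) f (x, t) =
   \int[lebesgue_measure]_(t in E) \int[m]_(x in D) f (x, t))%E.
Proof.
move=> mf f0; pose g := f \_ (D `*` E).
have mg : measurable_fun setT g.
  by apply/(measurable_restrictT f); [exact: measurableX|exact: measurable_funTS].
have g0 z : (0 <= g z)%E by apply: erestrict_ge0.
pose m' : {finite_measure set T -> \bar R} := mfrestr measurableT moo.
have mm' (h : T -> \bar R) : (\int[m']_x h x = \int[m]_x h x)%E.
  by apply: eq_measure_integral => A mA _; rewrite /m'/= /mfrestr /mrestr setIT.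
have := @fubini_tonelli _ _ T (measurableTypeR R) R m' lebesgue_measure g mg g0.
rewrite mm'; under [X in _ = X -> _]eq_integral do rewrite mm'.
move=> gE; rewrite integral_mkcond [RHS]integral_mkcond.
transitivity (\int[m]_x \int[lebesgue_measure]_y g (x, y))%E.
  apply: eq_integral => x _; rewrite patchE; case: ifPn => xD.
    rewrite integral_mkcond; apply: eq_integral => t _.
    by rewrite /g !patchE in_setX xD.
  rewrite integral0_eq// => t _.
  by rewrite /g patchE in_setX (negbTE xD).
rewrite gE; apply: eq_integral => t _; rewrite patchE; case: ifPn => tE.
  rewrite [RHS]integral_mkcond; apply: eq_integral => x _.
  by rewrite /g !patchE in_setX tE andbT.
rewrite integral0_eq// => x _.
by rewrite /g patchE in_setX (negbTE tE) andbF.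
Qed.

Section riesz_mass.
Context {R : realType} {d : nat} (sigma : {measure set Rd R d -> \bar R}).
Context (sm : surface_measure sigma) (d2 : (2 <= d)%N).
Local Notation leb := (@lebesgue_measure R).
Implicit Types (x e y : 'rV[R]_d).

(** The squared distance is affine in the height of [y], so exponentials of it integrate to the
    Laplace transform. *)
Lemma Sph_sqr_dist x y : Sph R d y -> 0 < enorm x ->
  enorm (x - y) ^+ 2 = (1 - enorm x) ^+ 2 +
    2 * enorm x * (1 - dotp ((enorm x)^-1 *: x) y).
Proof.
move=> Sy x0; rewrite sqr_enormB Sy dotpZl; field.
by rewrite gt_eqF.
Qed.

Lemma measurable_sqr_dist x :
  measurable_fun setT (fun y : Rd R d => enorm (x - y) ^+ 2).
Proof.
apply: measurable_funX.
have -> : (fun y : Rd R d => enorm (x - y)) = (fun y : Rd R d => enorm ((y : 'rV[R]_d) - x)).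
  by apply/funext => y; rewrite enorm_distC.
by apply: continuous_measurable_Rd; exact: continuous_enormB.
Qed.

Lemma measurable_sqr_dist_powR x (s : R) :
  measurable_fun setT (fun y : Rd R d => (enorm (x - y) ^+ 2) `^ s).
Proof.
apply: (measurableT_comp (f := fun t : R => t `^ s)); first exact: measurable_powR.
exact: measurable_sqr_dist.
Qed.

Lemma riesz_laplace x (a : R) : 0 < a -> 0 < enorm x -> enorm x != 1 ->
  ((\int[sigma]_(y in Sph R d) ((enorm (x - y) ^+ 2) `^ (- a))%:E) * (Gamma a)%:E =
  \int[leb]_(t in `]0%R, +oo[%classic)
    (t `^ (a - 1) * expR (- (t * (1 - enorm x) ^+ 2)) *
      laplace sigma ((enorm x)^-1 *: x) (2 * enorm x * t))%:E)%E.
Proof.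
move=> a0 x0 x1.
set r := enorm x; set e := r^-1 *: x.
have e1 : enorm e = 1.
  by rewrite enormZ ger0_norm ?invr_ge0 ?enorm_ge0// mulVf// gt_eqF.
have mq := measurable_sqr_dist x.
pose f (z : Rd R d * R) : \bar R := (z.2 `^ (a - 1) * expR (- (z.2 * enorm (x - z.1) ^+ 2)))%:E.
have mf : measurable_fun setT f.
  apply/measurable_EFinP; apply: measurable_funM.
    by apply: (measurableT_comp (f := fun t : R => t `^ (a - 1))); [exact: measurable_powR|exact: measurable_snd].
  apply: measurableT_comp; first exact: measurable_expR.
  apply: measurableT_comp => //; apply: measurable_funM; first exact: measurable_snd.
  by apply: (measurableT_comp mq); exact: measurable_fst.
have f0 z : (0 <= f z)%E by rewrite lee_fin mulr_ge0 ?powR_ge0 ?expR_ge0.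
have mS := @measurable_Sph R d.
have sT : (sigma setT < +oo)%E by exact: (surface_measure_fin sm).
rewrite -ge0_integralZr//=; last 3 first.
- apply/measurable_EFinP; apply: measurable_funTS.
  by apply: (measurableT_comp (measurable_powR _)).
- by move=> y _; rewrite lee_fin powR_ge0.
- by rewrite lee_fin ltW// Gamma_gt0.
transitivity (\int[sigma]_(y in Sph R d) \int[leb]_(t in `]0%R, +oo[%classic) f (y, t))%E.
  apply: eq_integral => y; rewrite inE => Sy.
  rewrite -egamma_fin// /f/= integral_gammaf_scale//.
  rewrite exprn_gt0// lt0r enorm_ge0 andbT; apply: contra x1 => /eqP xy.
  have := enorm_lipschitz x y; rewrite xy Sy normr_le0 subr_eq0//.
rewrite (fubini_tonelli_in sT mS (measurable_itv _) mf f0).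
apply: eq_integral => t; rewrite inE/= in_itv/= andbT => t0.
have z0 : 0 <= 2 * r * t by rewrite !mulr_ge0 ?enorm_ge0// ltW.
rewrite EFinM [X in (_ * X)%E]fineK; last first.
  by apply: integrable_fin_num => //; exact: (integrable_laplacef sm).
rewrite -ge0_integralZl_EFin//; last 2 first.
- by apply/measurable_EFinP; apply: measurable_funTS; exact: measurable_laplacef.
- by rewrite mulr_ge0 ?powR_ge0 ?expR_ge0.
apply: eq_integral => y; rewrite inE => Sy; rewrite /f/= -EFinM; congr EFin.
rewrite -[RHS]mulrA -expRD Sph_sqr_dist//; congr (_ * expR _).
by rewrite -/r -/e; ring.
Qed.

Let p : R := (d%:R - 1) / 2.

(** Heights are nonnegative on the sphere, so the transform is nonincreasing in [z]. *)
Lemma measurable_laplace e : enorm e = 1 -> measurable_fun setT (laplace sigma e).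
Proof.
move=> e1.
have int (z : R) : sigma.-integrable (Sph R d)
    (EFin \o (fun y : Rd R d => expR (- (z * (1 - dotp e y))))).
  apply: (integrable_Sph sm (c := expR (`|z| * 2))); first exact: measurable_laplacef.
  move=> y Sy; rewrite ger0_norm ?expR_ge0// ler_expR.
  have /andP[u1 u2] := Sph_dotp e1 Sy.
  have := ler_norm (- z); rewrite normrN; have := normr_ge0 z; nra.
apply: nonincreasing_measurable => // z z' zz.
apply: le_Rintegral => //; first exact: measurable_Sph.
move=> y Sy; rewrite ler_expR lerN2 ler_wpM2r// subr_ge0.
by have /andP[] := Sph_dotp e1 Sy.
Qed.

(** Integrates [laplace_bounds] with [delta = b / 2]. Any value strictly between 0 and [b] keeps the
    Gamma integral of the error convergent at 0 and makes the error less singular than the main term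
    as |x| tends to 1. *)
Lemma riesz_bounds e0 (b eta : R) : enorm e0 = 1 -> 0 < b -> 0 < eta < @cap_const R d ->
  exists2 C : R, 0 <= C & forall x, 0 < enorm x -> enorm x != 1 ->
  exists2 I : R,
   (\int[sigma]_(y in Sph R d) ((enorm (x - y) ^+ 2) `^ (- (p + b)))%:E = I%:E)%E &
   (@cap_const R d - eta) * (2 * enorm x) `^ (- p) *
     ((1 - enorm x) ^+ 2) `^ (- b) * Gamma b -
   C * (2 * enorm x) `^ (- (p + b / 2)) * ((1 - enorm x) ^+ 2) `^ (- (b / 2))
   <= I * Gamma (p + b) <=
   (@cap_const R d + eta) * (2 * enorm x) `^ (- p) *
     ((1 - enorm x) ^+ 2) `^ (- b) * Gamma b +
   C * (2 * enorm x) `^ (- (p + b / 2)) * ((1 - enorm x) ^+ 2) `^ (- (b / 2)).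
Proof.
move=> e01 b0 /andP[eta0 etak].
have bh : 0 < b / 2 by rewrite divr_gt0.
have [C C0 hC] := laplace_bounds sm d2 e01 eta0 bh.
exists (C * Gamma (b / 2)); first by rewrite mulr_ge0// ltW// Gamma_gt0.
move=> x x0 x1.
have p0 : 0 <= p by rewrite divr_ge0// subr_ge0 ler1n ltnW.
have pb : 0 < p + b by rewrite ltr_wpDl.
set r := enorm x in x0 x1 *; set e := r^-1 *: x.
have e1 : enorm e = 1.
  by rewrite enormZ ger0_norm ?invr_ge0 ?enorm_ge0// mulVf// gt_eqF.
have RL := riesz_laplace pb x0 x1.
rewrite -/r -/e in RL.
set A := (1 - r) ^+ 2 in RL *.
have A0 : 0 < A by rewrite lt0r sqrf_eq0 subr_eq0 eq_sym x1 sqr_ge0.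
have Gb := Gamma_gt0 b0; have Gbh := Gamma_gt0 bh; have Gpb := Gamma_gt0 pb.
pose g (s t : R) := t `^ (s - 1) * expR (- (t * A)).
have mg s : measurable_fun [set: R] (g s).
  by apply: measurable_funM; [exact: measurable_powR|exact: measurable_expRN].
have g0 s t : 0 <= g s t by rewrite mulr_ge0 ?powR_ge0 ?expR_ge0.
have mcg (s c : R) : measurable_fun (`]0, +oo[%classic : set R) (fun t => (c * g s t)%:E).
  by apply/measurable_EFinP; apply: measurable_funTS; apply: measurable_funM => //; exact: mg.
have Ig s (c : R) : 0 < s -> 0 <= c ->
    (\int[leb]_(t in `]0%R, +oo[%classic) (c * g s t)%:E = (c * A `^ (- s) * Gamma s)%:E)%E.
  move=> s0 c0; under eq_integral do rewrite EFinM.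
  rewrite ge0_integralZl_EFin//=; last 2 first.
  - by move=> t _; rewrite lee_fin.
  - by apply/measurable_EFinP; apply: measurable_funTS; exact: mg.
  by rewrite integral_gammaf_scale// egamma_fin// -!EFinM mulrA.
pose c1 := (@cap_const R d - eta) * (2 * r) `^ (- p).
pose c2 := (@cap_const R d + eta) * (2 * r) `^ (- p).
pose c3 := C * (2 * r) `^ (- (p + b / 2)).
have c10 : 0 <= c1 by rewrite mulr_ge0 ?powR_ge0// subr_ge0 ltW.
have c20 : 0 <= c2.
  by rewrite mulr_ge0 ?powR_ge0// addr_ge0 ?(ltW eta0)// ltW// (lt_trans eta0).
have c30 : 0 <= c3 by rewrite mulr_ge0 ?powR_ge0.
pose l t := t `^ (p + b - 1) * expR (- (t * A)) * laplace sigma e (2 * r * t).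
have l0 t : 0 <= l t by rewrite mulr_ge0 ?g0// laplace_ge0.
have ml : measurable_fun (`]0, +oo[%classic : set R) (fun t => (l t)%:E).
  apply/measurable_EFinP; apply: measurable_funTS.
  apply: measurable_funM; first exact: mg.
  apply: (measurableT_comp (f := laplace sigma e)); first exact: measurable_laplace.
  exact: measurable_funM.
have gE (s t : R) : 0 < t -> t `^ (p + b - 1) * expR (- (t * A)) * t `^ (- (p + s)) = g (b - s) t.
  move=> t0; rewrite mulrAC -powRD ?(gt_eqF t0) ?implybT//.
  by congr (_ `^ _ * _); ring.
have hl t : 0 < t -> c1 * g b t <= l t + c3 * g (b / 2) t /\ l t <= c2 * g b t + c3 * g (b / 2) t.
  move=> t0; have z0 : 0 < 2 * r * t by rewrite !mulr_gt0.
  have [h1 h2] := hC _ z0; rewrite -/p in h1 h2.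
  have Le : laplace sigma e (2 * r * t) = laplace sigma e0 (2 * r * t).
    by apply: (laplace_rotation sm); rewrite e1 e01.
  have G1 : t `^ (p + b - 1) * expR (- (t * A)) * t `^ (- p) = g b t.
    by rewrite -{2}(addr0 p) gE// subr0.
  have G2 : t `^ (p + b - 1) * expR (- (t * A)) * t `^ (- (p + b / 2)) = g (b / 2) t.
    by rewrite gE//; congr (g _ _); field.
  rewrite /c1 /c2 /c3 -G1 -G2 /l Le.
  move: h1 h2; rewrite !(@powRM _ (2 * r) t) ?mulr_ge0 ?(ltW x0) ?(ltW t0)//.
  set G := t `^ (p + b - 1) * _.
  have G0 : 0 <= G by rewrite mulr_ge0 ?powR_ge0 ?expR_ge0.
  move=> /(ler_wpM2l G0) h1 /(ler_wpM2l G0) h2.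
  by split; [move: h1|move: h2]; rewrite !mulrDr; congr (_ <= _); ring.
have up : (\int[leb]_(t in `]0%R, +oo[%classic) (l t)%:E <=
    (c2 * A `^ (- b) * Gamma b + c3 * A `^ (- (b / 2)) * Gamma (b / 2))%:E)%E.
  rewrite EFinD -!Ig// -ge0_integralD//=; last 4 first.
  - by move=> t _; rewrite lee_fin mulr_ge0.
  - exact: mcg.
  - by move=> t _; rewrite lee_fin mulr_ge0.
  - exact: mcg.
  apply: ge0_le_integral => //.
  - by move=> t _; rewrite lee_fin.
  - by apply: emeasurable_funD; exact: mcg.
  - by move=> t; rewrite /= in_itv/= andbT => /hl[_ h]; rewrite -EFinD lee_fin.
(* The error is put on the right-hand side, so that only nonnegative functions are integrated. *)
have lo : ((c1 * A `^ (- b) * Gamma b)%:E <= \int[leb]_(t in `]0%R, +oo[%classic) (l t)%:E +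
   (c3 * A `^ (- (b / 2)) * Gamma (b / 2))%:E)%E.
  rewrite -!Ig// -ge0_integralD//=; last 3 first.
  - by move=> t _; rewrite lee_fin.
  - by move=> t _; rewrite lee_fin mulr_ge0.
  - exact: mcg.
  apply: ge0_le_integral => //.
  - by move=> t _; rewrite lee_fin mulr_ge0.
  - exact: mcg.
  - by apply: emeasurable_funD => //; exact: mcg.
  - by move=> t; rewrite /= in_itv/= andbT => /hl[h _]; rewrite -EFinD lee_fin.
rewrite -RL in up lo.
set J := (\int[sigma]_(y in _) _)%E in up lo *.
have J0 : (0 <= J)%E by apply: integral_ge0 => y _; rewrite lee_fin powR_ge0.
have Jfin : J \is a fin_num.
  rewrite ge0_fin_numE//; move: up; case: J J0 {lo RL} => [j|_|]//; first by move=> *; rewrite ltry.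
  by rewrite gt0_mulye ?lte_fin.
exists (fine J); first by rewrite fineK.
move: up lo; rewrite -(fineK Jfin) -EFinM -EFinD !lee_fin => up lo.
rewrite (_ : C * Gamma (b / 2) * _ * _ = c3 * A `^ (- (b / 2)) * Gamma (b / 2)); last first.
  by rewrite /c3; ring.
by rewrite lerBlDr lo up.
Qed.

Definition kernel_const (alpha : R) : R := C2 R d alpha / Gamma (d%:R / 2).

(** Everything is expressed by squares, so that the kernel and [riesz_bounds] share the bases, with
    [b = (alpha - 1) / 2]. *)
Lemma PD_Sph (alpha : R) x y :
  PD alpha x y = kernel_const alpha *
    (((1 + enorm x) ^+ 2) `^ ((alpha - 1) / 2) * ((1 - enorm x) ^+ 2) `^ ((alpha - 1) / 2) *
     (enorm (x - y) ^+ 2) `^ (- (p + (alpha - 1) / 2))).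
Proof.
rewrite /PD -/(kernel_const alpha); congr (_ * (_ * _)).
  rewrite -powRM ?sqr_ge0// -exprMn (_ : _ * _ = 1 - enorm x ^+ 2); last by ring.
  rewrite (_ : alpha - 1 = 2%:R * ((alpha - 1) / 2)); last by field.
  rewrite powRrM powR_mulrn// distrC real_normK ?num_real//.
  by congr (_ `^ _); field.
rewrite powRN -powR_mulrn ?enorm_ge0// -powRrM.
by congr (_ `^ _)^-1; rewrite /p; field.
Qed.

Lemma cvg_sqr_powR0 (s : R) : 0 < s -> ((1 - r) ^+ 2) `^ s @[r --> (1 : R)] --> (0 : R).
Proof.
move=> s0; apply/cvgrPdist_lt => e e0.
have d0 : 0 < Num.sqrt (e `^ s^-1) by rewrite sqrtr_gt0 powR_gt0.
have : \forall r \near (1 : R), `|1 - r| < Num.sqrt (e `^ s^-1).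
  by apply/nbhs_ballP; exists (Num.sqrt (e `^ s^-1)).
apply: filterS => r rd.
rewrite sub0r normrN ger0_norm ?powR_ge0//.
have eE : e = (e `^ s^-1) `^ s by rewrite -powRrM mulVf ?gt_eqF// powRr1// ltW.
rewrite [ltRHS]eE; apply: gt0_ltr_powR; rewrite ?nnegrE ?sqr_ge0 ?powR_ge0//.
rewrite -real_normK ?num_real// -[ltRHS](sqr_sqrtr (powR_ge0 _ _)).
by rewrite ltr_sqr ?nnegrE ?(ltW d0).
Qed.

(** The vanishing factor of the kernel cancels the singularity in [riesz_bounds]; what remains at
    |x| = 1 is a product of constants, and the value of [C2] makes it 1. *)
Lemma kernel_mass (alpha eta : R) : 1 < alpha -> 0 < eta ->
  \forall r \near (1 : R), forall x, enorm x = r -> r != 1 ->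
   exists2 W : R, (\int[sigma]_(y in Sph R d) (PD alpha x y)%:E = W%:E)%E &
     1 - eta <= W <= 1 + eta.
Proof.
move=> a1 eta0.
pose b := (alpha - 1) / 2.
have b0 : 0 < b by rewrite divr_gt0// subr_gt0.
have bh : 0 < b / 2 by rewrite divr_gt0.
pose kappa := @cap_const R d.
have d20 : 0 < d%:R / 2 :> R by rewrite divr_gt0// ltr0n ltnW.
have Gd := Gamma_gt0 d20.
have Gb := Gamma_gt0 b0.
have sp0 : 0 < Num.sqrt pi :> R by rewrite sqrtr_gt0 pi_gt0.
have p0 : 0 <= p by rewrite divr_ge0// subr_ge0 ler1n ltnW.
have pb : 0 < p + b by rewrite ltr_wpDl.
have Gpb := Gamma_gt0 pb.
have k0 : 0 < kappa.
  by rewrite /kappa /cap_const !mulr_gt0 ?powR_gt0 ?invr_gt0.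
(* A relative error below [eta]; the minimum with 1 ensures [eta' < kappa], which [riesz_bounds]
   requires. *)
pose eta' := kappa * (Num.min eta 1 / 2).
have m0 : 0 < Num.min eta 1 by rewrite lt_min eta0 ltr01.
have e'0 : 0 < eta' by rewrite mulr_gt0// divr_gt0.
have e'k : eta' < kappa.
  have : Num.min eta 1 <= 1 by rewrite ge_min lexx orbT.
  by rewrite /eta' => m1; rewrite gtr_pMr//; lra.
have e'k2 : eta' / kappa < eta.
  have : Num.min eta 1 <= eta by rewrite ge_min lexx.
  by rewrite /eta' mulrAC divff ?gt_eqF// mul1r => m1; lra.
have ee : 0 < eta' < kappa by rewrite e'0.
have [C C0 hC] := riesz_bounds (enorm_delta (Ordinal (ltnW d2))) b0 ee.
rewrite -/kappa in hC.
pose K0 := kernel_const alpha / Gamma (p + b).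
have KE : K0 = Num.sqrt pi * 2 `^ (2 - alpha) / (Gamma b * Gamma (d%:R / 2)).
  rewrite /K0 /kernel_const /C2 -/b.
  rewrite (_ : (alpha + d%:R) / 2 - 1 = p + b); last by rewrite /p /b; field.
  move: (Gamma b) (Gamma (p + b)) (Gamma (d%:R / 2)) Gb Gpb Gd => u v w u0 v0 w0.
  by move: (2 `^ _) (Num.sqrt _) => s1 s2; field; rewrite !gt_eqF.
have K00 : 0 <= K0.
  by rewrite KE divr_ge0 ?mulr_ge0 ?powR_ge0 ?(ltW sp0) ?(ltW Gb) ?(ltW Gd).
(* The normalization: all Gamma values cancel, and the exponents of 2 add up to 1, which offsets the
   1/2 in [cap_const]. *)
have K0E : K0 * (4 `^ b * 2 `^ (- p) * Gamma b) * kappa = 1.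
  have E2 : 2 `^ (2 - alpha) * 4 `^ b * 2 `^ (- p) * (2 `^ p) = 2 :> R.
    have -> : 4 = 2 `^ 2%:R :> R by rewrite powR_mulrn// -natrX.
    have D2 (s t : R) : 2 `^ s * 2 `^ t = 2 `^ (s + t) :> R.
      by rewrite powRD// pnatr_eq0 implybT.
    rewrite -powRrM !D2.
    rewrite -[RHS]powRr1//; congr (_ `^ _); rewrite /b; by field.
  rewrite KE /kappa /cap_const -/p.
  transitivity (2^-1 * (2 `^ (2 - alpha) * 4 `^ b * 2 `^ (- p) * (2 `^ p))); last by rewrite E2 mulVf.
  move: (Gamma b) (Gamma (d%:R / 2)) Gb Gd => u w u0 w0.
  move: (Num.sqrt _) sp0 => s1 sp0.
  move: (2 `^ _) (4 `^ _) (2 `^ _) (2 `^ _) => t1 t2 t3 t4.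
  by field; rewrite !gt_eqF.
(* [G1] is the main term and [G2] the error of [riesz_bounds] once multiplied by the factors of the
   kernel; both are continuous through [r = 1]. *)
pose G1 (c r : R) := K0 * (((1 + r) ^+ 2) `^ b * (2 * r) `^ (- p) * Gamma b) * c.
pose G2 (r : R) := K0 * (C * ((1 + r) ^+ 2) `^ b * (2 * r) `^ (- (p + b / 2))) * ((1 - r) ^+ 2) `^ (b / 2).
have c1 : ((1 + r) ^+ 2) `^ b @[r --> (1 : R)] --> (4 `^ b : R).
  have -> : 4 = (1 + 1) ^+ 2 :> R by ring.
  apply: (@continuous_cvg _ _ _ _ _ _ (fun t : R => t `^ b)).
    by apply: continuous_powR; rewrite exprn_gt0.
  by apply: cvgM; apply: cvgD; (exact: cvg_cst || exact: cvg_id).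
have c2 (s : R) : (2 * r) `^ s @[r --> (1 : R)] --> (2 `^ s : R).
  rewrite -[X in _ --> X `^ _](mulr1 2).
  apply: (@continuous_cvg _ _ _ _ _ _ (fun t : R => t `^ s)).
    by apply: continuous_powR; rewrite mulr1.
  by apply: cvgMr; exact: cvg_id.
have cG1 c : G1 c r @[r --> (1 : R)] --> K0 * (4 `^ b * 2 `^ (- p) * Gamma b) * c.
  by apply: cvgMl; apply: cvgMr; apply: cvgMl; apply: cvgM; [exact: c1|exact: c2].
have cG2 : G2 r @[r --> (1 : R)] --> (0 : R).
  rewrite -[X in _ --> X](mulr0 (K0 * (C * 4 `^ b * 2 `^ (- (p + b / 2))))).
  apply: cvgM; last exact: cvg_sqr_powR0.
  by apply: cvgMr; apply: cvgM; [apply: cvgMr; exact: c1|exact: c2].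
have lo : \forall r \near (1 : R), 1 - eta < G1 (kappa - eta') r - G2 r.
  apply: (cvgr_gt _ (cvgB (cG1 _) cG2)).
  rewrite subr0 mulrBr K0E ltrD2l ltrN2 -[X in X * eta'](mulfK (lt0r_neq0 k0)) K0E.
  by rewrite mul1r mulrC.
have hi : \forall r \near (1 : R), G1 (kappa + eta') r + G2 r < 1 + eta.
  apply: (cvgr_lt _ (cvgD (cG1 _) cG2)).
  rewrite addr0 mulrDr K0E ltrD2l -[X in X * eta'](mulfK (lt0r_neq0 k0)) K0E.
  by rewrite mul1r mulrC.
near=> r; move=> x xr r1.
have r0 : 0 < r by near: r; exact: lt_nbhsr.
have [I IE IB] : exists2 I : R,
   (\int[sigma]_(y in Sph R d) ((enorm (x - y) ^+ 2) `^ (- (p + b)))%:E = I%:E)%E &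
   (kappa - eta') * (2 * r) `^ (- p) * ((1 - r) ^+ 2) `^ (- b) * Gamma b -
   C * (2 * r) `^ (- (p + b / 2)) * ((1 - r) ^+ 2) `^ (- (b / 2))
   <= I * Gamma (p + b) <=
   (kappa + eta') * (2 * r) `^ (- p) * ((1 - r) ^+ 2) `^ (- b) * Gamma b +
   C * (2 * r) `^ (- (p + b / 2)) * ((1 - r) ^+ 2) `^ (- (b / 2)).
  by have := hC x; rewrite xr; apply.
pose D := ((1 + r) ^+ 2) `^ b; pose A := ((1 - r) ^+ 2) `^ b.
have A2 : 0 < (1 - r) ^+ 2 by rewrite lt0r sqrf_eq0 subr_eq0 eq_sym r1 sqr_ge0.
have A0 : 0 < A by rewrite powR_gt0.
have D0 : 0 < D by rewrite powR_gt0// exprn_gt0// addr_gt0.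
have kc0 : 0 <= kernel_const alpha.
  by move: K00; rewrite /K0 pmulr_lge0// invr_gt0.
exists (kernel_const alpha * (D * A) * I).
  rewrite EFinM -IE -ge0_integralZl_EFin//=; last 4 first.
  - exact: measurable_Sph.
  - by move=> y _; rewrite lee_fin powR_ge0.
  - by apply/measurable_EFinP; apply: measurable_funTS; exact: measurable_sqr_dist_powR.
  - by rewrite (mulr_ge0 kc0)// mulr_ge0 ?ltW.
  apply: eq_integral => y _; rewrite PD_Sph -EFinM xr -/b; congr EFin.
  by rewrite /D /A !mulrA.
have lo' : 1 - eta < G1 (kappa - eta') r - G2 r by near: r.
have hi' : G1 (kappa + eta') r + G2 r < 1 + eta by near: r.
have AE1 : A * ((1 - r) ^+ 2) `^ (- b) = 1.
  by rewrite /A -powRD ?(gt_eqF A2) ?implybT// subrr powRr0.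
have AE2 : A * ((1 - r) ^+ 2) `^ (- (b / 2)) = ((1 - r) ^+ 2) `^ (b / 2).
  by rewrite /A -powRD ?(gt_eqF A2) ?implybT//; congr (_ `^ _); field.
have WE : kernel_const alpha * (D * A) * I = K0 * (D * A) * (I * Gamma (p + b)).
  by rewrite /K0; field; rewrite gt_eqF.
have K0DA : 0 <= K0 * (D * A) by rewrite (mulr_ge0 K00)// mulr_ge0 ?ltW.
have /andP[/(ler_wpM2l K0DA) I1 /(ler_wpM2l K0DA) I2] := IB.
have E (c P X g Q Y : R) : K0 * (D * A) * (c * P * X * g + C * Q * Y) =
    K0 * (D * P * g) * c * (A * X) + K0 * (C * D * Q) * (A * Y) by ring.
have E' (c P X g Q Y : R) : K0 * (D * A) * (c * P * X * g - C * Q * Y) =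
    K0 * (D * P * g) * c * (A * X) - K0 * (C * D * Q) * (A * Y) by ring.
rewrite E' AE1 AE2 mulr1 in I1; rewrite E AE1 AE2 mulr1 in I2.
by rewrite WE (le_trans (ltW lo') I1) (le_trans I2 (ltW hi')).
Unshelve. all: by end_near. Qed.

End riesz_mass.

(** * Differentiation of measures on the sphere *)

Lemma cvge_fin_lt (R : realType) (u : nat -> \bar R) (l x : R) :
  u n @[n --> \oo] --> l%:E -> l < x -> \forall n \near \oo, (u n < x%:E)%E.
Proof.
move=> /fine_cvgP[uf ul] lx; have ux : \forall n \near \oo, fine (u n) < x by exact: (cvgr_lt _ ul).
by apply: filterS2 uf ux => n un h; rewrite -(fineK un) lte_fin.
Qed.

(** * Regularity of finite Borel measures *)

Section regularity.
Context {R : realType} {d : nat} (m : {measure set Rd R d -> \bar R}).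
Context (moo : (m setT < +oo)%E).
Implicit Types (A U F : set (Rd R d)).

Let mfin A : measurable A -> (m A < +oo)%E.
Proof.
by move=> mA; apply: le_lt_trans moo; apply: le_measure; rewrite ?inE.
Qed.

(** Asking for both sides at once makes the class stable under complements. *)
Definition approximable A := forall e : R, 0 < e -> exists F U : set (Rd R d),
  [/\ closed (F : set 'rV[R]_d), open (U : set 'rV[R]_d), F `<=` A, A `<=` U & (m (U `\` F) < e%:E)%E].

Lemma closed_measurable_Rd F : closed (F : set 'rV[R]_d) -> measurable F.
Proof.
move=> cF; rewrite -[F]setCK; apply: measurableC; apply: open_measurable_Rd.
by rewrite openC.
Qed.

Lemma open_approximable U : open (U : set 'rV[R]_d) -> approximable U.
Proof.
move=> oU e e0.
(* The points at distance at least 1/(n + 1) from the complement of [U]. *)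
pose F (n : nat) : set (Rd R d) := ~` (\bigcup_(z in ~` U) eball (z : 'rV[R]_d) n.+1%:R^-1).
have cF n : closed (F n : set 'rV[R]_d).
  by rewrite closedC; apply: bigcup_open => z _; exact: open_eball.
have mF n : measurable (F n) := closed_measurable_Rd (cF n).
have FU n : F n `<=` U.
  move=> x Fx; apply: contrapT => Ux; apply: Fx; exists x => //.
  by rewrite /eball/= subrr enorm0 invr_gt0.
have mU : measurable U := open_measurable_Rd oU.
have UF : \bigcup_n F n = U.
  apply/seteqP; split=> [x [n _ /FU]//|x Ux].
  have /open_eballP /(_ _ Ux) [r r0 rU] := oU.
  have [n nr] : exists n : nat, n.+1%:R^-1 < r.
    exists (Num.trunc r^-1); rewrite -[ltRHS]invrK ltf_pV2 ?posrE ?invr_gt0//.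
    exact: truncnS_gt.
  exists n => // -[z Uz]; rewrite /eball/= => xz; apply: Uz; apply: rU.
  by rewrite /eball/= enorm_distC; exact: lt_trans nr.
have ndF : nondecreasing_seq F.
  move=> i j ij; apply/subsetPset => x Fx [z Uz zx]; apply: Fx; exists z => //.
  by apply: (lt_le_trans zx); rewrite lef_pV2 ?posrE// ler_nat.
have cv : m (F n) @[n --> \oo] --> m U.
  by rewrite -UF; apply: (nondecreasing_cvg_mu mF) => //; rewrite UF.
have mUfin : m U \is a fin_num by rewrite ge0_fin_numE ?measure_ge0 ?mfin.
have mFfin n : m (F n) \is a fin_num by rewrite ge0_fin_numE ?measure_ge0 ?mfin.
have {}cv : (m U - m (F n))%E @[n --> \oo] --> 0%:E.
  rewrite (_ : 0%:E = (m U - m U)%E); last by rewrite subee.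
  apply: cvgeB => //; first exact: fin_num_adde_defr.
  exact: cvg_cst.
have [n _ /(_ n (leqnn n)) h] := cvge_fin_lt cv e0.
exists (F n), U; split => //.
by rewrite measureD ?mfin// setIidr.
Qed.

Lemma measurable_approximable A : measurable A -> approximable A.
Proof.
apply: smallest_sub; last by move=> U; exact: open_approximable.
split.
- move=> e e0; exists set0, set0; split; [exact: (@closed0 'rV[R]_d)|exact: (@open0 'rV[R]_d)|by []|by []|].
  by rewrite setD0 measure0 lte_fin.
- move=> {}A hA e /hA [F [U [cF oU FA AU FUe]]].
  exists (~` U), (~` F); split.
  + by rewrite closedC.
  + by rewrite openC.
  + by move=> x Ux; split => // /AU.
  + by move=> x [_ Ax] /FA.
  + by rewrite setDE setCK setIC -setDE.
- move=> {}A hA e e0.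
  have e2 n : 0 < e / (2 ^ n.+2)%:R by rewrite divr_gt0// ltr0n expn_gt0.
  have /choice [F /choice [U hFU]] := fun n => hA n _ (e2 n).
  have mF n : measurable (F n) by have [cF _ _ _ _] := hFU n; exact: closed_measurable_Rd.
  have mU n : measurable (U n) by have [_ oU _ _ _] := hFU n; exact: open_measurable_Rd.
  pose UU := \bigcup_n U n.
  (* A countable union of closed sets need not be closed: finite unions are taken, and continuity
     from above supplies the index. The errors sum to [e / 2], which keeps the final inequality
     strict. *)
  pose FF n := \big[setU/set0]_(i < n) F i.
  have mUU : measurable UU by exact: bigcup_measurable.
  have mFF n : measurable (FF n) by exact: bigsetU_measurable.
  have lim : (m \o (fun n => UU `\` FF n)) n @[n --> \oo] --> m (\bigcap_n (UU `\` FF n)).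
    apply: nonincreasing_cvg_mu.
    - by apply: mfin; exact: measurableD.
    - by move=> n; exact: measurableD.
    - by apply: bigcap_measurable => // n _; exact: measurableD.
    - move=> i j ij; apply/subsetPset; apply: setDS; exact: subset_bigsetU.
  have le : (m (\bigcap_n (UU `\` FF n)) < e%:E)%E.
    apply: (@le_lt_trans _ _ (\sum_(0 <= n <oo) m (U n `\` F n))%E).
      apply: measure_sigma_subadditive.
      - by move=> n; exact: measurableD.
      - by apply: bigcap_measurable => // n _; exact: measurableD.
      - move=> x Ux; have [n _ Unx] := (Ux 0%N I).1.
        exists n => //; split => // Fnx; have [_] := Ux n.+1 I; apply.
        by rewrite /FF -bigcup_mkord; exists n => //=.
    apply: (@le_lt_trans _ _ (\sum_(0 <= n <oo) (e / 2 / (2 ^ n.+1)%:R)%:E)%E).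
      apply: lee_nneseries => [n *|n *]; first exact: measure_ge0.
      have [_ _ _ _ /ltW] := hFU n.
      by rewrite expnS natrM invfM mulrA.
    apply: (le_lt_trans (epsilon_trick0 _ _)); first by rewrite divr_ge0// ltW.
    by rewrite lte_fin; lra.
  have : \forall n \near \oo, (m (UU `\` FF n) < e%:E)%E.
    move: lim le; set l := m (\bigcap_n _).
    have lfin : l \is a fin_num.
      rewrite ge0_fin_numE ?measure_ge0//; apply: mfin.
      by apply: bigcap_measurable => // n _; exact: measurableD.
    by rewrite -(fineK lfin) lte_fin => lim le; exact: cvge_fin_lt lim le.
  case=> n _ /(_ n (leqnn n)) h.
  exists (FF n), UU; split => //.
  + rewrite /FF; apply: closed_bigsetU => i _.
    by have [] := hFU i.
  + by apply: bigcup_open => i _; have [] := hFU i.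
  + rewrite /FF -bigcup_mkord => x [i _ Fix]; exists i => //.
    by have [_ _ FA _ _] := hFU i; exact: FA.
  + move=> x [i _ Aix]; exists i => //.
    by have [_ _ _ AU _] := hFU i; exact: AU.
Qed.

End regularity.

Lemma measure_seq_subadditive d (T : measurableType d) (R : realType)
    (m : {measure set T -> \bar R}) (I : Type) (s : seq I) (F : I -> set T) :
  (forall i, measurable (F i)) ->
  (m (\big[setU/set0]_(i <- s) F i) <= \sum_(i <- s) m (F i))%E.
Proof.
move=> mF; elim: s => [|i s IH]; first by rewrite !big_nil measure0.
rewrite !big_cons; apply: (le_trans (measureU2 _ _ _)) => //.
  exact: bigsetU_measurable.
by rewrite leeD2l.
Qed.

(** * Finite Vitali covering *)

Section vitali.
Context {R : realType} {d : nat}.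
Local Notation ballof i := (eball (i.1 : 'rV[R]_d) (i.2 : R)).

Lemma eball_meet_sub (y z : 'rV[R]_d) (r s : R) : r <= s ->
  eball y r `&` eball z s !=set0 -> eball y r `<=` eball z (3 * s).
Proof.
move=> rs [w [/= wy wz]] x xy; rewrite /eball/= in xy wy wz *.
have h1 := enorm_dist_triangle y x z.
have h2 := enorm_dist_triangle w y z.
rewrite (enorm_distC y w) in h2; lra.
Qed.

Lemma seq_max (T : eqType) (g : T -> R) (x : T) (s : seq T) :
  exists2 j, j \in x :: s & forall i, i \in x :: s -> g i <= g j.
Proof.
elim: s x => [|y s IH] x.
  by exists x; rewrite ?mem_head// => i; rewrite inE => /eqP ->.
have [j js hj] := IH y.
have [xj|jx] := leP (g x) (g j).
  exists j; first by rewrite inE js orbT.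
  by move=> i; rewrite inE => /orP[/eqP ->//|/hj].
exists x; first by rewrite mem_head.
by move=> i; rewrite inE => /orP[/eqP ->//|/hj/le_trans]; apply; exact: ltW.
Qed.

(** Greedy choice: keep a ball of largest radius, drop those meeting it, which lie in its triple,
    and recurse. Disjointness is recorded as additivity of every measure, the form in which it is
    applied. *)
Lemma vitali_finite (s : seq ('rV[R]_d * R)%type) :
  (forall i, i \in s -> 0 < i.2) ->
  exists D : seq ('rV[R]_d * R)%type,
  [/\ {subset D <= s}, forall i, i \in s -> exists2 j, j \in D & ballof i `<=` eball j.1 (3 * j.2)
    & forall m : {measure set Rd R d -> \bar R},
      (m (\big[setU/set0]_(j <- D) ballof j) = \sum_(j <- D) m (ballof j))%E].
Proof.
have [n] := ubnP (size s); elim: n s => // n IH [|x0 s0] sn s0gt.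
  by exists [::]; split => // m; rewrite !big_nil measure0.
set s := x0 :: s0 in sn s0gt *.
have [j js hj] := seq_max (fun i : 'rV[R]_d * R => i.2) x0 s0.
pose meets i := `[< ballof i `&` ballof j !=set0 >].
have jj : meets j.
  apply/asboolP; exists j.1; rewrite /eball/= subrr enorm0.
  by have := s0gt _ js.
pose s' := [seq i <- s | ~~ meets i].
have s'n : (size s' < n)%N.
  rewrite -ltnS; apply: leq_trans sn; rewrite ltnS size_filter.
  have := count_predC meets s; rewrite -[in X in _ = X]/(size s) => <-.
  by rewrite -[X in (X < _)%N]add0n ltn_add2r -has_count; apply/hasP; exists j.
have [|D [Ds Dcov Dm]] := IH s' s'n.
  by move=> i; rewrite mem_filter => /andP[_ /s0gt].
exists (j :: D); split.
- by move=> i; rewrite inE => /orP[/eqP ->//|/Ds]; rewrite mem_filter => /andP[].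
- move=> i si; have [im|im] := boolP (meets i).
    exists j; first by rewrite mem_head.
    by apply: eball_meet_sub (hj _ si) _; exact/asboolP.
  have [|k kD ik] := Dcov i; first by rewrite mem_filter im.
  by exists k => //; rewrite inE kD orbT.
- move=> m; rewrite !big_cons measureU; first by congr (_ + _)%E; exact: Dm.
  + exact: measurable_eball.
  + by apply: bigsetU_measurable => i _; exact: measurable_eball.
  + apply/seteqP; split=> // x [xj]; rewrite -bigcup_seq => -[i /= /Ds].
    rewrite mem_filter => /andP[/asboolP im _] xi; apply: im.
    by exists x.
Qed.

End vitali.

(** * Doubling and density on the sphere *)

Section doubling.
Context {R : realType} {d : nat} (sigma : {measure set Rd R d -> \bar R}).
Context (sm : surface_measure sigma).
Implicit Types (y z w : 'rV[R]_d).

Lemma sigma_eball_rotation y z (r : R) : Sph R d y -> Sph R d z ->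
  sigma (eball y r) = sigma (eball z r).
Proof.
move=> Sy Sz; have [_ _ rot] := sm.
have [|Q QQ yQ] := @orthogonal_transitive R d y z; first by rewrite Sy Sz.
rewrite -[RHS](rot Q QQ); last exact: measurable_eball.
congr (sigma _); apply/seteqP; split => x; rewrite /eball/=.
  by rewrite -yQ -mulmxBl enorm_orthogonal.
by rewrite -yQ -mulmxBl enorm_orthogonal.
Qed.

Lemma sigma_setISph (A : set (Rd R d)) : measurable A -> sigma (A `&` Sph R d) = sigma A.
Proof.
move=> mA; have [_ s0 _] := sm; have mS := @measurable_Sph R d.
apply/eqP; rewrite eq_le; apply/andP; split.
  by apply: le_measure; rewrite ?inE//; exact: measurableI.
rewrite (_ : (_ <= _)%E = (sigma A <= sigma (A `&` Sph R d) + sigma (~` Sph R d))%E); last first.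
  by congr (_ <= _)%E; rewrite -[LHS]adde0; congr (_ + _)%E; exact: esym s0.
apply: (@le_trans _ _ (sigma ((A `&` Sph R d) `|` ~` Sph R d))).
  apply: le_measure; rewrite ?inE//.
    by apply: measurableU; [exact: measurableI|exact: measurableC].
  by move=> x Ax; have [Sx|Sx] := pselect (Sph R d x); [left|right].
by apply: measureU2; [exact: measurableI|exact: measurableC].
Qed.

(* The ball of radius [3r] is cut into at most [(6 (d + 1))^d] grid cells of
   diameter less than [r]; each cell meeting the sphere lies in a ball of
   radius [r] centred on the sphere. *)
Lemma sigma_doubling : exists2 M : R, 0 < M & forall y (r : R), Sph R d y -> 0 < r ->
  (sigma (eball y (3 * r)) <= M%:E * sigma (eball y r))%E.
Proof.
pose N := (6 * d.+1)%N.
have N0 : (0 < N)%N by rewrite muln_gt0.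
pose K := {ffun 'I_d -> 'I_N}.
exists (#|K|%:R + 1) => [|y r Sy r0]; first by rewrite ltr_wpDl.
(* With this side, two points of one cell are at distance at most [d * h < r], and an interval of
   length 6r holds [N] cells. *)
pose h := r / d.+1%:R.
have h0 : 0 < h by rewrite divr_gt0.
(* The shift by 3r makes the quotient nonnegative on the ball; there the truncation is below [N],
   and the default is not taken. *)
pose key w : K := [ffun i => odflt (Ordinal N0) (insub (Num.trunc ((w ord0 i - y ord0 i + 3 * r) / h)))].
pose B : set (Rd R d) := eball y (3 * r) `&` Sph R d.
have keyE w i : eball y (3 * r) w ->
    (key w i)%:R <= (w ord0 i - y ord0 i + 3 * r) / h < (key w i).+1%:R.
  move=> wB; rewrite /key ffunE.
  have wi : `|w ord0 i - y ord0 i| < 3 * r.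
    by apply: le_lt_trans wB; have := enorm_entry (w - y) i; rewrite !mxE.
  move: wi; rewrite ltr_norml => /andP[w1 w2].
  have t0 : 0 <= (w ord0 i - y ord0 i + 3 * r) / h.
    by rewrite divr_ge0 ?(ltW h0)//; lra.
  have tN : (Num.trunc ((w ord0 i - y ord0 i + 3 * r) / h) < N)%N.
    rewrite -(@ltr_nat R); apply: (le_lt_trans (andP (truncn_itv t0)).1).
    rewrite ltr_pdivrMr// /h /N natrM mulrACA mulrA.
    rewrite mulfK ?pnatr_eq0//; lra.
  by rewrite insubT/=; exact: truncn_itv.
have close w w' : eball y (3 * r) w -> eball y (3 * r) w' -> key w = key w' -> eball w' r w.
  move=> wB wB' kk; rewrite /eball/=.
  apply: (@le_lt_trans _ _ (d%:R * h)).
    apply: enorm_le_entries => i; rewrite !mxE ltW// ltr_norml.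
    have /andP[a1 a2] := keyE _ i wB; have /andP[b1 b2] := keyE _ i wB'.
    rewrite kk in a1 a2; move: a1 a2 b1 b2; rewrite -natr1.
    rewrite !ler_pdivlMr// !ltr_pdivrMr// !mulrDl mul1r => a1 a2 b1 b2.
    by apply/andP; split; lra.
  by rewrite /h mulrA ltr_pdivrMr// mulrC ltr_pM2l// ltr_nat.
pose pt (k : K) := [set w | B w /\ key w = k].
pose F (k : K) : set (Rd R d) := if pselect (pt k !=set0) is left e then eball (projT1 (cid e)) r else set0.
have mF k : measurable (F k).
  by rewrite /F; case: pselect => [e|_]//; exact: measurable_eball.
have sF k : (sigma (F k) <= sigma (eball y r))%E.
  rewrite /F; case: pselect => [e|_]; last by rewrite measure0.
  case: cid => /= w [[_ Sw] _].
  by rewrite (sigma_eball_rotation r Sw Sy).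
have BF : B `<=` \big[setU/set0]_(k <- enum K) F k.
  move=> w Bw; rewrite -bigcup_seq; exists (key w); first by rewrite /= mem_enum.
  rewrite /F; case: pselect => [e|]; last by case; exists w.
  case: cid => /= w' [[Bw' Sw'] kk]; apply: close => //; exact: Bw.1.
have mB : measurable B by apply: measurableI; [exact: measurable_eball|exact: measurable_Sph].
rewrite -(sigma_setISph (measurable_eball _ _)) -/B.
apply: (@le_trans _ _ (sigma (\big[setU/set0]_(k <- enum K) F k))).
  by apply: le_measure; rewrite ?inE//; exact: bigsetU_measurable.
apply: (le_trans (measure_seq_subadditive _ _ mF)).
apply: (@le_trans _ _ (\sum_(k <- enum K) sigma (eball y r))%E).
  by apply: lee_sum => k _.
have cf : sigma (eball y r) \is a fin_num.
  rewrite ge0_fin_numE ?measure_ge0//; apply: (surface_measure_fin sm).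
  exact: measurable_eball.
rewrite -(fineK cf) sumEFin -EFinM lee_fin big_enum/= sumr_const -[leLHS]mulr_natl.
by rewrite ler_wpM2r ?fine_ge0 ?measure_ge0// lerDl.
Qed.

Section differentiation.
Context (tau : {measure set Rd R d -> \bar R}) (tauoo : (tau setT < +oo)%E).

Lemma compact_closedISph (F : set (Rd R d)) : closed (F : set 'rV[R]_d) ->
  compact (F `&` Sph R d : set 'rV[R]_d).
Proof.
move=> cF; apply: bounded_closed_compact.
  exists 1; split; first exact: num_real.
  move=> c c1 x [_ Sx]; change (mx_norm x <= c); rewrite mx_normrE.
  apply: bigmax_le; first by rewrite ltW// (lt_trans _ c1).
  move=> [i j] _ /=; rewrite (ord1 i); apply: ltW; apply: le_lt_trans c1.
  by rewrite -Sx; exact: enorm_entry.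
apply: closedI => //.
rewrite (_ : Sph R d = @enorm R d @^-1` [set 1])//.
by apply: preimage_closed; [move=> x _; exact: continuous_enorm|exact: (accessible_closed_set1 (hausdorff_accessible (@Rhausdorff R)))].
Qed.

(** The balls form an infinite family, so [W] is replaced, up to [e], by a closed subset whose trace
    on the sphere is compact. On a finite subcover the Vitali selection applies, and doubling pays
    for the tripled radii. *)
Lemma sigma_vitali_le (M c : R) (U W : set (Rd R d)) (r : 'rV[R]_d -> R)
    (Bad : set 'rV[R]_d) : 0 < M -> 0 < c ->
  (forall y (r : R), Sph R d y -> 0 < r ->
    (sigma (eball y (3 * r)) <= M%:E * sigma (eball y r))%E) ->
  measurable U -> Bad `<=` Sph R d ->
  (forall y, Bad y -> [/\ 0 < r y, eball y (r y) `<=` U &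
     (c%:E * sigma (eball y (r y)) <= tau (eball y (r y)))%E]) ->
  W = \bigcup_(y in Bad) eball y (r y) ->
  (sigma W <= (M / c)%:E * tau U)%E.
Proof.
move=> M0 c0 dbl mU BS hr WE.
have oW : open (W : set 'rV[R]_d).
  by rewrite WE; apply: bigcup_open => y _; exact: open_eball.
have mW := open_measurable_Rd oW.
have sT : (sigma setT < +oo)%E by exact: (surface_measure_fin sm).
apply/lee_addgt0Pr => e e0.
have [F [U' [cF oU' FW WU' UF]]] := open_approximable sT oW e0.
have mF := closed_measurable_Rd cF.
have mU' := open_measurable_Rd oU'.
have : compact (F `&` Sph R d : set 'rV[R]_d) by exact: compact_closedISph.
rewrite compact_cover => /(_ 'rV[R]_d Bad (fun y => eball y (r y))) [].
- by move=> y _; exact: open_eball.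
- by move=> x [/FW]; rewrite WE.
move=> D' D'Bad D'cov.
pose s : seq ('rV[R]_d * R)%type := [seq (y, r y) | y <- finmap.enum_fset D'].
have sP i : i \in s -> exists2 y, Bad y & i = (y, r y).
  by move=> /mapP[y yD' ->]; exists y => //; apply/set_mem/D'Bad.
have [|D [Ds Dcov Dsum]] := @vitali_finite R d s.
  by move=> i /sP[y /hr[r0 _ _] ->].
have mb (j : 'rV[R]_d * R) : measurable (eball j.1 j.2) by exact: measurable_eball.
have mb3 (j : 'rV[R]_d * R) : measurable (eball j.1 (3 * j.2)) by exact: measurable_eball.
have sF : (sigma F <= (M / c)%:E * tau U)%E.
  rewrite -(sigma_setISph mF).
  apply: (@le_trans _ _ (sigma (\big[setU/set0]_(j <- D) eball j.1 (3 * j.2)))).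
    apply: le_measure; rewrite ?inE.
    - by apply: measurableI => //; exact: measurable_Sph.
    - by apply: bigsetU_measurable => j _; exact: mb3.
    - move=> x /D'cov [y /= yD' xy].
      have [|j jD hj] := Dcov (y, r y); first by apply/mapP; exists y.
      by rewrite -bigcup_seq; exists j => //; exact: hj.
  apply: (le_trans (measure_seq_subadditive _ _ mb3)).
  apply: (@le_trans _ _ (\sum_(j <- D) ((M / c)%:E * tau (eball j.1 j.2)))%E).
    rewrite big_seq [leRHS]big_seq; apply: lee_sum => j /Ds /sP[y By ->]/=.
    have [r0 _ hc] := hr _ By.
    apply: (le_trans (dbl _ _ (BS _ By) r0)).
    rewrite EFinM -muleA lee_pmul2l// lee_pdivlMl//.
  rewrite -ge0_sume_distrr//.
  rewrite -Dsum lee_pmul2l ?lte_fin ?divr_gt0//.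
  apply: le_measure; rewrite ?inE//.
    by apply: bigsetU_measurable => j _; exact: mb.
  move=> x; rewrite -bigcup_seq => -[j /= /Ds /sP[y By ->]].
  by have [_ yU _] := hr _ By; exact: yU.
apply: (@le_trans _ _ (sigma F + sigma (U' `\` F))%E).
  apply: (@le_trans _ _ (sigma (F `|` (U' `\` F)))).
    apply: le_measure; rewrite ?inE//.
      by apply: measurableU => //; exact: measurableD.
    by move=> x Wx; have [Fx|Fx] := pselect (F x); [left|right; split => //; exact: WU'].
  by apply: measureU2 => //; exact: measurableD.
by apply: leeD => //; exact: ltW.
Qed.

(** Regularity puts [E] in open sets of small [tau]-mass, and each bad point has a ball inside on
    which [tau] outweighs c times [sigma]. The bad set is enclosed in measurable sets [W n], as its
    own measurability is not established. *)
Lemma density_null (E : set (Rd R d)) (c : R) : measurable E -> tau E = 0%E -> 0 < c ->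
  sigma.-negligible [set y : Rd R d | [/\ Sph R d y, E y &
    forall delta : R, 0 < delta -> exists2 r : R, 0 < r < delta &
      (c%:E * sigma (eball y r) < tau (eball y r))%E]].
Proof.
move=> mE tE c0.
have [M M0 dbl] := sigma_doubling.
set Bad := [set y | _].
have ex n : exists W : set (Rd R d), [/\ measurable W, Bad `<=` W &
    (sigma W <= ((M / c) / n.+1%:R)%:E)%E].
  have n0 : 0 < n.+1%:R^-1 :> R by rewrite invr_gt0.
  have [F [U [cF oU FE EU UF]]] := measurable_approximable tauoo mE n0.
  have mF := closed_measurable_Rd cF; have mU := open_measurable_Rd oU.
  have tU : (tau U < (n.+1%:R^-1)%:E)%E.
    apply: le_lt_trans UF.
    have -> : tau U = tau ((U `\` F) `|` F).
      by congr (tau _); rewrite setUC setDUK//; exact: (subset_trans FE).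
    apply: (le_trans (measureU2 _ _ _)) => //; first exact: measurableD.
    by rewrite -[leRHS]adde0 leeD2l// -tE le_measure ?inE.
  (* The radius gets the value 0 off [Bad], so that [choice] yields a total function. *)
  have hr y : exists r : R, Bad y -> [/\ 0 < r, eball y r `<=` U &
     (c%:E * sigma (eball y r) <= tau (eball y r))%E].
    have [By|nBy] := pselect (Bad y); last by exists 0.
    have [_ Ey hy] := By.
    have /open_eballP /(_ _ (EU _ Ey)) [e e0 eU] := oU.
    have [r /andP[r0 re] /ltW hr] := hy _ e0.
    exists r => _; split => //; apply: subset_trans eU => z.
    by rewrite /eball/= => /lt_trans; apply.
  have /choice [r {}hr] := hr.
  exists (\bigcup_(y in Bad) eball y (r y)); split.
  - by apply: open_measurable_Rd; apply: bigcup_open => y _; exact: open_eball.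
  - by move=> y By; exists y => //; have [r0 _ _] := hr _ By; rewrite /eball/= subrr enorm0.
  - apply: (le_trans (sigma_vitali_le (Bad := Bad) M0 c0 dbl mU _ hr erefl)).
      by move=> y [].
    by rewrite [X in (_ <= X)%E]EFinM lee_pmul2l ?lte_fin ?divr_gt0// ltW.
have /choice [W hW] := ex.
exists (\bigcap_n W n); split.
- by apply: bigcap_measurable => // n _; have [] := hW n.
- apply/eqP; rewrite eq_le measure_ge0 andbT; apply/lee_addgt0Pr => e e0; rewrite add0e.
  have [n ne] : exists n : nat, (M / c) / n.+1%:R <= e.
    exists (Num.trunc (e^-1 * (M / c))); rewrite ler_pdivrMr// -ler_pdivrMl//.
    by rewrite ltW// truncnS_gt.
  have [mW _ sW] := hW n.
  apply: (@le_trans _ _ (sigma (W n))).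
    apply: le_measure; rewrite ?inE//.
    - by apply: bigcap_measurable => // k _; have [] := hW k.
    - exact: bigcap_inf.
  by apply: (le_trans sW); rewrite lee_fin.
- by move=> y By n _; have [_ + _] := hW n; apply.
Qed.


End differentiation.

End doubling.

(** * Nontangential limits *)

Section levels.
Context d (T : measurableType d) (R : realType).
Implicit Types (h u : R) (H : nat) (m : {measure set T -> \bar R}) (D : set T) (phi : T -> R).

(** Counts with weight [h] the levels h, 2h, ..., Hh strictly below [u]; its integral is a finite
    sum of measures of superlevel sets. *)
Let stair (h : R) (H : nat) (u : R) : R := \sum_(j < H) h * (j.+1%:R * h < u)%R%:R.

Lemma stair_ge0 h H u : 0 <= h -> 0 <= stair h H u.
Proof. by move=> h0; apply: sumr_ge0 => j _; rewrite mulr_ge0. Qed.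

Lemma stair_le h H u : 0 < h -> 0 <= u -> stair h H u <= u.
Proof.
move=> h0 u0; elim: H => [|H IH]; first by rewrite /stair big_ord0.
have [Hu|Hu] := ltP (H.+1%:R * h) u.
  apply: le_trans (ltW Hu); rewrite /stair.
  apply: (@le_trans _ _ (\sum_(j < H.+1) h)).
    by apply: ler_sum => j _; rewrite ler_piMr ?(ltW h0)//; case: (_ < _)%R.
  by rewrite sumr_const card_ord mulr_natl.
by rewrite /stair big_ord_recr/= (ltNge (H.+1%:R * h)) Hu/= mulr0 addr0.
Qed.

Lemma le_stair h H u : 0 < h -> u <= H%:R * h -> u <= h + stair h H u.
Proof.
move=> h0; elim: H => [|H IH].
  by rewrite mul0r => u0; rewrite (le_trans u0)// addr_ge0 ?stair_ge0 ?ltW.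
move=> uH; have [uh|hu] := leP u (H%:R * h).
  apply: (le_trans (IH uh)); rewrite /stair [in leRHS]big_ord_recr/= lerD2l lerDl.
  by rewrite mulr_ge0// ltW.
rewrite /stair big_ord_recr/= addrA.
have -> : \sum_(j < H) h * (j.+1%:R * h < u)%R%:R = H%:R * h.
  rewrite mulr_natl -[in RHS](card_ord H) -sumr_const; apply: eq_bigr => j _.
  by rewrite (le_lt_trans _ hu) ?mulr1// ler_wpM2r ?(ltW h0)// ler_nat.
apply: le_trans (_ : h + H%:R * h <= _); last by rewrite lerDl mulr_ge0 ?(ltW h0).
by rewrite -[X in X + _]mul1r -mulrDl nat1r.
Qed.

Lemma measurable_level D phi (l : R) : measurable D -> measurable_fun D phi ->
  measurable (D `&` [set x | l < phi x]%R).
Proof.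
move=> mD mphi; have := mphi mD `]l, +oo[%classic (measurable_itv _).
by congr measurable; apply/seteqP; split => x /=; rewrite in_itv/= andbT.
Qed.

Lemma indic_level D phi (l : R) x : x \in D ->
  \1_(D `&` [set x | l < phi x]%R) x = (l < phi x)%R%:R :> R.
Proof.
rewrite inE => Dx; rewrite indicE; congr ((nat_of_bool _)%:R).
by apply/idP/idP => [|lx]; rewrite inE/= => // -[].
Qed.

Lemma integral_stair m D phi h H : measurable D -> measurable_fun D phi -> 0 <= h ->
  (\int[m]_(x in D) (stair h H (phi x))%:E =
   \sum_(j < H) h%:E * m (D `&` [set x | j.+1%:R * h < phi x]%R))%E.
Proof.
move=> mD mphi h0.
have mA j := measurable_level (j.+1%:R * h) mD mphi.
have E x : x \in D -> (stair h H (phi x))%:E = (\sum_(j < H)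
    h%:E * (\1_(D `&` [set x | j.+1%:R * h < phi x]%R) x)%:E)%E.
  move=> Dx; rewrite /stair -sumEFin; apply: eq_bigr => j _.
  by rewrite indic_level// EFinM.
rewrite (eq_integral _ _ E).
rewrite ge0_integral_sum//=; last 2 first.
- move=> j; apply: measurable_funeM; apply/measurable_EFinP; exact: measurable_indic.
- by move=> j x _; rewrite mule_ge0.
apply: eq_bigr => j _.
rewrite ge0_integralZl//=; last first.
  by apply/measurable_EFinP; exact: measurable_indic.
by rewrite integral_indic// setIC setIA setIid.
Qed.

(** Since [phi] is bounded, finitely many levels approximate it within [h], and finiteness of [m1 D]
    controls the discretization error. *)
Lemma le_integral_levels m1 m2 D phi (K a c : R) :
  measurable D -> (m1 D < +oo)%E -> measurable_fun D phi ->
  (forall x, D x -> 0 <= phi x <= K) -> 0 <= a -> 0 <= c ->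
  (forall l : R, 0 < l -> (a%:E * m1 (D `&` [set x | l < phi x]%R) <=
     c%:E * m2 (D `&` [set x | l < phi x]%R))%E) ->
  (a%:E * \int[m1]_(x in D) (phi x)%:E <= c%:E * \int[m2]_(x in D) (phi x)%:E)%E.
Proof.
move=> mD m1D mphi phiK a0 c0 lev; apply/lee_addgt0Pr => e e0.
pose M := fine (m1 D).
have M0 : 0 <= M by rewrite fine_ge0.
have m1DE : m1 D = M%:E by rewrite fineK// ge0_fin_numE.
(* The error [a * h * M] is then at most [e]; the 1 keeps the denominator positive. *)
pose h : R := e / (a * M + 1).
have aM0 : 0 < a * M + 1 by rewrite ltr_pwDr// mulr_ge0.
have h0 : 0 < h by rewrite divr_gt0.
pose H := (Num.trunc (K / h)).+1.
have KH : K <= H%:R * h by rewrite -ler_pdivrMr// ltW// truncnS_gt.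
have mst : measurable_fun D (fun x => (stair h H (phi x))%:E).
  apply/measurable_EFinP; apply: measurable_sum => j.
  apply: measurable_funM; first exact: measurable_cst.
  apply: (eq_measurable_fun (\1_(D `&` [set x | j.+1%:R * h < phi x]%R) : T -> R)).
    by move=> x Dx; rewrite indic_level.
  by apply: measurable_indic; exact: measurable_level.
apply: (@le_trans _ _ (a%:E * (h%:E * m1 D + \int[m1]_(x in D) (stair h H (phi x))%:E))%E).
  apply: lee_wpmul2l => //.
  rewrite -integral_cst// -ge0_integralD//=; last 2 first.
  - by move=> x _; rewrite lee_fin ltW.
  - by move=> x _; rewrite lee_fin stair_ge0// ltW.
  apply: ge0_le_integral => //=.
  - by move=> x Dx; rewrite lee_fin; have /andP[] := phiK _ Dx.
  - exact/measurable_EFinP.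
  - by apply: emeasurable_funD => //; exact: measurable_cst.
  - move=> x Dx; rewrite -EFinD lee_fin le_stair//.
    by apply: le_trans KH; have /andP[] := phiK _ Dx.
rewrite ge0_muleDr//; last 2 first.
- by rewrite mule_ge0// lee_fin ltW.
- by apply: integral_ge0 => x _; rewrite lee_fin stair_ge0// ltW.
rewrite addeC leeD//; last first.
  rewrite m1DE -!EFinM lee_fin.
  have -> : a * (h * M) = (e * (a * M)) / (a * M + 1) by rewrite /h; ring.
  by rewrite ler_pdivrMr// ler_pM2l// lerDl.
apply: (@le_trans _ _ (c%:E * \int[m2]_(x in D) (stair h H (phi x))%:E)%E).
  rewrite !integral_stair ?(ltW h0)// !ge0_sume_distrr; last 2 first.
  - by move=> j _; rewrite mule_ge0// lee_fin ltW.
  - by move=> j _; rewrite mule_ge0// lee_fin ltW.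
  apply: lee_sum => j _; rewrite !(muleCA _ h%:E) lee_wpmul2l// ?lee_fin ?(ltW h0)//.
  by apply: lev; rewrite mulr_gt0.
apply: lee_wpmul2l => //; apply: ge0_le_integral => //=.
- by move=> x Dx; rewrite lee_fin stair_ge0// ltW.
- exact/measurable_EFinP.
- by move=> x Dx; rewrite lee_fin stair_le//; have /andP[] := phiK _ Dx.
Qed.

End levels.

(** * Pointwise estimates of the kernel *)

Section kernel_estimates.
Context {R : realType} {d : nat} (alpha : R) (d2 : (2 <= d)%N) (alpha1 : 1 < alpha).
Implicit Types (x y z : 'rV[R]_d).
Local Notation kc := (@kernel_const R d alpha).
Local Notation q := ((d%:R - 1) / 2 + (alpha - 1) / 2 : R).
Local Notation b := ((alpha - 1) / 2 : R).

Let b_gt0 : 0 < b. Proof. by rewrite divr_gt0// subr_gt0. Qed.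

Let q_gt0 : 0 < q.
Proof.
by rewrite ltr_wpDl// divr_ge0// subr_ge0 ler1n (leq_trans _ d2).
Qed.

Lemma kernel_const_gt0 : 0 < kc.
Proof.
have d1 : 2 <= d%:R :> R by rewrite ler_nat.
rewrite /kernel_const /C2 !divr_gt0 ?Gamma_gt0//.
- apply: mulr_gt0; last first.
    apply: Gamma_gt0; rewrite subr_gt0 ltr_pdivlMr// mul1r (le_lt_trans d1)// ltrDr.
    exact: lt_trans alpha1.
  by rewrite mulr_gt0 ?sqrtr_gt0 ?pi_gt0 ?powR_gt0.
- by rewrite divr_gt0// (lt_le_trans _ d1).
Qed.

Lemma PD_ge0 x y : 0 <= PD alpha x y.
Proof.
apply: mulr_ge0; first exact: (ltW kernel_const_gt0).
by rewrite divr_ge0 ?powR_ge0.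
Qed.

Lemma measurable_PD x : measurable_fun setT (fun y : Rd R d => PD alpha x y).
Proof.
rewrite (funext (PD_Sph alpha x)); apply: measurable_funM => //.
by apply: measurable_funM => //; exact: measurable_sqr_dist_powR.
Qed.

Lemma Sph_dist_ge x y : Sph R d y -> `|1 - enorm x| <= enorm (x - y).
Proof. by move=> Sy; rewrite -[X in `|X - _|]Sy distrC enorm_lipschitz. Qed.

Lemma Sph_dist_gt0 x y : Sph R d y -> enorm x != 1 -> 0 < enorm (x - y).
Proof.
by move=> Sy x1; rewrite (lt_le_trans _ (Sph_dist_ge _ Sy))// normr_gt0 subr_eq0 eq_sym.
Qed.

Lemma PD_comparison (L : R) x x' y : Sph R d y -> enorm x != 1 -> enorm x = enorm x' ->
  0 < L -> enorm (x' - y) <= L * enorm (x - y) ->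
  PD alpha x y <= (L ^+ 2) `^ q * PD alpha x' y.
Proof.
move=> Sy x1 xx' L0 xL; rewrite !PD_Sph -xx'.
have xy := Sph_dist_gt0 Sy x1; have x'y : 0 < enorm (x' - y) by apply: Sph_dist_gt0; rewrite -?xx'.
rewrite [leRHS]mulrCA ler_wpM2l ?(ltW kernel_const_gt0)// [leRHS]mulrCA ler_wpM2l ?mulr_ge0 ?powR_ge0//.
rewrite !powRN ler_pdivlMr ?powR_gt0 ?exprn_gt0// mulrC ler_pdivrMr ?powR_gt0 ?exprn_gt0//.
rewrite -powRM ?sqr_ge0// -exprMn; apply: ge0_ler_powR; rewrite ?nnegrE ?sqr_ge0 ?(ltW q_gt0)//.
by rewrite ler_sqr ?nnegrE ?mulr_ge0 ?(ltW L0) ?enorm_ge0.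
Qed.

Lemma radial_sqr_dist (r : R) y0 y : Sph R d y0 -> Sph R d y ->
  enorm (r *: y0 - y) ^+ 2 = (1 - r) ^+ 2 + r * enorm (y - y0) ^+ 2.
Proof.
move=> S0 Sy; rewrite !sqr_enormB enormZ S0 Sy dotpZl (dotpC y y0) mulr1 real_normK ?num_real//.
by ring.
Qed.

(* Comparing with the radial point [enorm x *: y0] absorbs the aperture of the cone. *)
Lemma PD_ntcone (beta : R) x y0 y : 0 < beta -> Sph R d y0 -> Sph R d y -> ntcone R d beta y0 x ->
  PD alpha x y <= ((3 + beta) ^+ 2) `^ q * PD alpha (enorm x *: y0) y.
Proof.
move=> beta0 S0 Sy [x1 xc].
apply: PD_comparison => //.
- exact/eqP.
- by rewrite enormZ S0 mulr1 ger0_norm ?enorm_ge0.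
- by rewrite addr_gt0.
(* The path from [enorm x *: y0] to [y] through [y0] and [x] has pieces of length at most 1, 1 +
   beta and 1 times |x - y|; the sum is 3 + beta. *)
- have h1 := enorm_dist_triangle y0 (enorm x *: y0) y.
  have h2 := enorm_dist_triangle x y0 y; rewrite (enorm_distC y0 x) in h2.
  have h3 : enorm (enorm x *: y0 - y0) = `|1 - enorm x|.
    by rewrite -[X in _ - X]scale1r -scalerBl enormZ S0 mulr1 distrC.
  have h4 := Sph_dist_ge x Sy.
  have h5 : (1 + beta) * `|1 - enorm x| <= (1 + beta) * enorm (x - y).
    by rewrite ler_pM2l// addr_gt0.
  by rewrite !mulrDl mul1r in h5 xc *; lra.
Qed.

Lemma lt_sqrtr (a c : R) : 0 <= a -> (a < Num.sqrt c) = (a ^+ 2 < c).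
Proof.
move=> a0; have [c0|c0] := leP c 0.
  by rewrite ler0_sqrtr// !ltNge a0 (le_trans c0) ?sqr_ge0.
by rewrite -{1}[a]ger0_norm// -sqrtr_sqr ltr_sqrt.
Qed.

Lemma PD_level (r l : R) y0 : Sph R d y0 -> 0 < r -> r != 1 -> 0 < l ->
  exists s : R, Sph R d `&` [set y | l < PD alpha (r *: y0) y] = Sph R d `&` eball y0 s.
Proof.
move=> S0 r0 r1 l0.
have nr : enorm (r *: y0) = r by rewrite enormZ S0 mulr1 gtr0_norm.
pose A := kc * (((1 + r) ^+ 2) `^ b * ((1 - r) ^+ 2) `^ b).
have A0 : 0 < A.
  rewrite mulr_gt0 ?kernel_const_gt0// mulr_gt0// powR_gt0//.
    by rewrite exprn_gt0 ?addr_gt0.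
  by rewrite lt0r sqr_ge0 sqrf_eq0 subr_eq0 eq_sym r1.
(* The kernel exceeds [l] exactly when the squared distance to [r *: y0] is below [B];
   [radial_sqr_dist] converts this into a distance to [y0]. *)
pose B := (A / l) `^ q^-1.
have Bq : B `^ q = A / l.
  by rewrite -powRrM mulVf ?gt_eqF// powRr1// divr_ge0 ?ltW.
(* When no point reaches the level [l] the argument is nonpositive, the root is 0, and the ball is
   empty. *)
exists (Num.sqrt ((B - (1 - r) ^+ 2) / r)).
have E y : Sph R d y -> (l < PD alpha (r *: y0) y) = (enorm (y - y0) < Num.sqrt ((B - (1 - r) ^+ 2) / r)).
  move=> Sy; rewrite lt_sqrtr ?enorm_ge0// ltr_pdivlMr// ltrBrDl mulrC -radial_sqr_dist//.
  rewrite PD_Sph nr mulrA -/A powRN.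
  have t0 : 0 < enorm (r *: y0 - y) ^+ 2.
    by rewrite exprn_gt0// Sph_dist_gt0// nr.
  rewrite ltr_pdivlMr ?powR_gt0// mulrC -ltr_pdivlMr// -Bq.
  apply/idP/idP => [|tB]; last first.
    by apply: gt0_ltr_powR; rewrite ?nnegrE ?powR_ge0 ?(ltW t0).
  apply: contraTT; rewrite -!leNgt => Bt.
  by apply: ge0_ler_powR; rewrite ?nnegrE ?powR_ge0 ?(ltW t0) ?(ltW q_gt0).
by apply/seteqP; split => y [Sy]; rewrite /eball/= ?E// -E//.
Qed.

(** At positive distance from the pole only the vanishing factor survives; 9 bounds (1 + r)^2 for
    [r <= 2]. *)
Lemma PD_le_dist (r t : R) x y : enorm x = r -> r <= 2 -> 0 <= r -> 0 < t -> t <= enorm (x - y) ^+ 2 ->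
  PD alpha x y <= kc * (9 `^ b * t `^ (- q)) * ((1 - r) ^+ 2) `^ b.
Proof.
move=> xr r2 r0 t0 txy; rewrite PD_Sph xr.
have -> : kc * (9 `^ b * t `^ (- q)) * ((1 - r) ^+ 2) `^ b =
   kc * (9 `^ b * ((1 - r) ^+ 2) `^ b * t `^ (- q)) by ring.
rewrite ler_wpM2l ?(ltW kernel_const_gt0)//.
apply: ler_pM; rewrite ?mulr_ge0 ?powR_ge0//.
  rewrite ler_wpM2r ?powR_ge0//; apply: ge0_ler_powR; rewrite ?nnegrE ?sqr_ge0 ?(ltW b_gt0)//.
  have -> : 9 = 3 ^+ 2 :> R by ring.
  by rewrite ler_sqr ?nnegrE ?addr_ge0//; lra.
rewrite !powRN lef_pV2 ?posrE ?powR_gt0//; last exact: lt_le_trans txy.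
by apply: ge0_ler_powR; rewrite ?nnegrE ?(ltW q_gt0) ?sqr_ge0 ?(ltW t0).
Qed.

Lemma PD_bounded x : enorm x != 1 -> exists K : R, forall y, Sph R d y -> 0 <= PD alpha x y <= K.
Proof.
move=> x1; pose t := (1 - enorm x) ^+ 2.
have t0 : 0 < t by rewrite lt0r sqr_ge0 sqrf_eq0 subr_eq0 eq_sym x1.
exists (kc * (((1 + enorm x) ^+ 2) `^ b * ((1 - enorm x) ^+ 2) `^ b * t `^ (- q))) => y Sy.
rewrite PD_ge0/= PD_Sph ler_wpM2l ?(ltW kernel_const_gt0)// ler_wpM2l ?mulr_ge0 ?powR_ge0//.
have tx : t <= enorm (x - y) ^+ 2.
  rewrite /t -real_normK ?num_real// ler_sqr ?nnegrE ?enorm_ge0//.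
  exact: Sph_dist_ge.
rewrite !powRN lef_pV2 ?posrE ?powR_gt0//; last exact: lt_le_trans tx.
by apply: ge0_ler_powR; rewrite ?nnegrE ?(ltW q_gt0) ?sqr_ge0 ?(ltW t0).
Qed.

End kernel_estimates.

(** * Vanishing of the integral at points of density zero *)

Section small_density.
Context {R : realType} {d : nat} (sigma : {measure set Rd R d -> \bar R}).
Context (sm : surface_measure sigma) (alpha : R) (d2 : (2 <= d)%N) (alpha1 : 1 < alpha).
Implicit Types (x y : 'rV[R]_d) (tau : {measure set Rd R d -> \bar R}).
Local Notation kc := (@kernel_const R d alpha).
Local Notation q := ((d%:R - 1) / 2 + (alpha - 1) / 2 : R).
Local Notation b := ((alpha - 1) / 2 : R).
Local Notation SS := (Sph R d : set (Rd R d)).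
Local Notation mS := (@measurable_Sph R d).

Lemma measurable_PD_in (D : set (Rd R d)) x : measurable D ->
  measurable_fun D (fun y : Rd R d => (PD alpha x y)%:E).
Proof.
move=> mD; apply/measurable_EFinP; apply: measurable_funTS.
exact: measurable_PD.
Qed.

(** The norm is continuous at [y0], so estimates near radius 1, uniform on the cone, become
    statements about the filter of the nontangential limit. *)
Lemma near1_norm (beta : R) (y0 : 'rV[R]_d) (F : 'rV[R]_d -> Prop) : Sph R d y0 ->
  (\forall r \near (1 : R), forall x, enorm x = r -> ntcone R d beta y0 x -> F x) ->
  \forall x \near within (ntcone R d beta y0) (nbhs y0), F x.
Proof.
move=> S0 nF; rewrite /prop_near1 /within /=.
have c0 : enorm x @[x --> y0] --> (1 : R).
  by have := @continuous_enorm R d y0; rewrite /continuous_at S0.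
apply: (@filterS _ _ (nbhs_filter y0) _ _ _ (c0 _ nF)) => x Fx cx; exact: Fx.
Qed.

Lemma poisson_small tau y0 (eta beta : R) : (tau setT < +oo)%E -> Sph R d y0 ->
  (forall c : R, 0 < c -> exists2 delta : R, 0 < delta & forall rho : R, 0 < rho < delta ->
     (tau (eball y0 rho) <= c%:E * sigma (eball y0 rho))%E) ->
  0 < eta -> 0 < beta ->
  \forall r \near (1 : R), forall x, enorm x = r -> ntcone R d beta y0 x ->
    (\int[tau]_(y in Sph R d) (PD alpha x y)%:E <= eta%:E)%E.
Proof.
move=> tauoo S0 dens eta0 beta0.
pose L := ((3 + beta) ^+ 2) `^ q.
have L0 : 0 < L by rewrite powR_gt0// exprn_gt0// addr_gt0.
(* In the denominator, [L] is the cost of passing to the radial pole, one factor 2 bounds the kernel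
   mass of [sigma], and the other leaves half of [eta] for the far part. *)
have [|delta delta0 hdelta] := dens (eta / (4 * L)); first by rewrite divr_gt0// mulr_gt0.
pose B : set (Rd R d) := eball y0 (delta / 2).
have mB : measurable B := measurable_eball _ _.
have mD1 : measurable (SS `&` B) by apply: measurableI => //; exact: mS.
have mD2 : measurable (SS `\` B) by apply: measurableD => //; exact: mS.
have tfin (A : set (Rd R d)) : measurable A -> (tau A < +oo)%E.
  by move=> mA; rewrite (le_lt_trans _ tauoo)// le_measure ?inE.
pose M := fine (tau setT).
have M0 : 0 <= M by rewrite fine_ge0.
(* For [r >= 1/2] and [y] outside [B], [radial_sqr_dist] bounds the squared distance to [r *: y0]
   below by this value. *)
pose t := (delta / 2) ^+ 2 / 2.
have t0 : 0 < t by rewrite divr_gt0// exprn_gt0// divr_gt0.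
pose C := L * (kc * (9 `^ b * t `^ (- q))).
have C0 : 0 <= C.
  by rewrite mulr_ge0 ?(ltW L0)// mulr_ge0 ?(ltW (kernel_const_gt0 _ _))// mulr_ge0 ?powR_ge0.
have b0 : 0 < b by rewrite divr_gt0// subr_gt0.
have n1 : \forall r \near (1 : R), ((1 - r) ^+ 2) `^ b < (eta / 2) / (C * M + 1).
  have e0 : 0 < (eta / 2) / (C * M + 1) by rewrite !divr_gt0// ltr_pwDr// mulr_ge0.
  have /cvgrPdist_lt/(_ _ e0) := cvg_sqr_powR0 b0.
  by apply: filterS => r; rewrite sub0r normrN; apply: le_lt_trans; rewrite ler_norm.
have n2 : \forall r \near (1 : R), `|1 - r| < 2^-1.
  by apply/nbhs_ballP; exists (2^-1) => //=; rewrite invr_gt0.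
near=> r => x xr cx.
have r1 : r != 1.
  by apply/eqP => r1; case: cx => nS _; apply: nS; rewrite /Sph/= xr.
have rb : 2^-1 <= r <= 2.
  have : `|1 - r| < 2^-1 by near: r.
  by rewrite ltr_norml => /andP[? ?]; apply/andP; split; lra.
have [rge rle] := andP rb.
have r0 : 0 < r by apply: lt_le_trans rge; rewrite invr_gt0.
have x1 : enorm x != 1 by rewrite xr.
have nx0 : enorm (r *: y0) = r by rewrite enormZ S0 mulr1 gtr0_norm.
have x01 : enorm (r *: y0) != 1 by rewrite nx0.
have cmp y : Sph R d y -> PD alpha x y <= L * PD alpha (r *: y0) y.
  by move=> Sy; rewrite -xr; exact: PD_ntcone.
(* [kernel_mass] with tolerance 1: the mass is at most 2. *)
have [W WE /andP[_ W2]] : exists2 W : R,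
    (\int[sigma]_(y in Sph R d) (PD alpha (r *: y0) y)%:E = W%:E)%E & 1 - 1 <= W <= 1 + 1.
  suff : forall x, enorm x = r -> r != 1 -> exists2 W : R,
     (\int[sigma]_(y in Sph R d) (PD alpha x y)%:E = W%:E)%E & 1 - 1 <= W <= 1 + 1 by exact.
  by near: r; exact: kernel_mass.
have PD0 z y : (0 <= (PD alpha z y)%:E)%E by rewrite lee_fin PD_ge0.
have [K hK] := PD_bounded d2 alpha1 x01.
have near_part : (\int[tau]_(y in SS `&` B) (PD alpha x y)%:E <= (eta / 2)%:E)%E.
  apply: (@le_trans _ _ (L%:E * \int[tau]_(y in SS `&` B) (PD alpha (r *: y0) y)%:E)%E).
    rewrite -ge0_integralZl//; [|exact: measurable_PD_in|by rewrite lee_fin ltW].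
    apply: ge0_le_integral => //.
    - exact: measurable_PD_in.
    - by apply: measurable_funeM; exact: measurable_PD_in.
    - by move=> y [Sy _]; rewrite -EFinM lee_fin cmp.
  have := @le_integral_levels _ _ R tau sigma (SS `&` B) (PD alpha (r *: y0)) K 1
    (eta / (4 * L)) mD1 (tfin _ mD1).
  rewrite mul1e => lev.
  apply: (@le_trans _ _ (L%:E * ((eta / (4 * L))%:E * W%:E))%E); last first.
    rewrite -!EFinM lee_fin; have -> : L * (eta / (4 * L) * W) = eta / 4 * W.
      by field; rewrite gt_eqF.
    have -> : eta / 2 = eta / 4 * 2 by field.
    by rewrite ler_pM2l ?divr_gt0//.
  apply: lee_wpmul2l; first by rewrite lee_fin ltW.
  have eL0 : 0 <= eta / (4 * L) by rewrite divr_ge0 ?(ltW eta0)// mulr_ge0// ltW.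
  apply: le_trans (lev _ _ _ eL0 _) _ => //.
  - by apply: measurable_funTS; exact: measurable_PD.
  - by move=> y [Sy _]; exact: hK.
  - move=> l l0; rewrite mul1e.
    have [s sE] := PD_level d2 alpha1 S0 r0 r1 l0.
    (* A superlevel set cut by [B] is again a cap centred at [y0], of radius below [delta], so the
       density hypothesis applies to it. *)
    have DE : SS `&` B `&` [set y | l < PD alpha (r *: y0) y] =
        eball y0 (Num.min s (delta / 2)) `&` Sph R d.
      rewrite setIAC sE; apply/seteqP; split => y; rewrite /B /eball/= lt_min.
        by move=> [[? ->] ->].
      by move=> [/andP[-> ->] ?].
    have [m0|m0] := leP (Num.min s (delta / 2)) 0.
      rewrite DE (_ : eball _ _ = set0) ?set0I ?measure0 ?mule0//.
      by apply/seteqP; split => // y; rewrite /eball/= ltNge (le_trans m0)// enorm_ge0.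
    rewrite DE (sigma_setISph sm)//; last exact: measurable_eball.
    apply: (@le_trans _ _ (tau (eball y0 (Num.min s (delta / 2))))).
      apply: le_measure; rewrite ?inE//; last exact: measurable_eball.
      by apply: measurableI; [exact: measurable_eball|exact: mS].
    apply: hdelta; rewrite m0/= gt_min; apply/orP; right.
    by rewrite ltr_pdivrMr// ltr_pMr// ltr1n.
  - apply: lee_wpmul2l; first by rewrite lee_fin.
    rewrite -WE; apply: ge0_subset_integral => //; [exact: mS|exact: measurable_PD_in mS].
have far_part : (\int[tau]_(y in SS `\` B) (PD alpha x y)%:E <= (eta / 2)%:E)%E.
  apply: (@le_trans _ _ (\int[tau]_(y in SS `\` B) (C * ((1 - r) ^+ 2) `^ b)%:E)%E).
    apply: ge0_le_integral => //.
    - exact: measurable_PD_in.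
    - move=> y [Sy By]; rewrite lee_fin (le_trans (cmp _ Sy))// /C -mulrA ler_wpM2l ?(ltW L0)//.
      apply: PD_le_dist => //; first exact: ltW.
      rewrite radial_sqr_dist// /t.
      have h : (delta / 2) ^+ 2 <= enorm (y - y0) ^+ 2.
        by rewrite ler_sqr ?nnegrE ?enorm_ge0 ?divr_ge0 ?(ltW delta0)// leNgt; apply/negP.
      have := sqr_ge0 (1 - r).
      have : 2^-1 * (delta / 2) ^+ 2 <= r * enorm (y - y0) ^+ 2.
        by apply: ler_pM => //; rewrite ?sqr_ge0.
      by rewrite mulrC => ? ?; lra.
  rewrite integral_cst//.
  apply: (@le_trans _ _ ((C * ((1 - r) ^+ 2) `^ b)%:E * M%:E)%E).
    apply: lee_wpmul2l; first by rewrite lee_fin mulr_ge0// powR_ge0.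
    by rewrite /M fineK ?ge0_fin_numE// le_measure ?inE.
  rewrite -EFinM lee_fin.
  have CM0 : 0 < C * M + 1 by rewrite ltr_pwDr// mulr_ge0.
  have h : ((1 - r) ^+ 2) `^ b < (eta / 2) / (C * M + 1) by near: r.
  rewrite ltr_pdivlMr// in h; apply: le_trans (ltW h).
  rewrite mulrAC mulrC ler_wpM2l ?powR_ge0//.
  by rewrite lerDl.
have SE : SS = (SS `&` B) `|` (SS `\` B) by rewrite setUIDK.
rewrite [X in (\int[_]_(_ in X) _)%E]SE ge0_integral_setU//; last 2 first.
- by apply: measurable_PD_in; exact: measurableU.
- by apply/disj_setPS => y [[_ ?] [_ ?]].
have -> : (eta%:E = (eta / 2)%:E + (eta / 2)%:E)%E by rewrite -EFinD; congr (_%:E); field.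
exact: leeD.
Unshelve. all: by end_near.
Qed.

End small_density.

(** * Positive measures with a density off a null set *)

Section positive_measure.
Context {R : realType} {d : nat} (sigma : {measure set Rd R d -> \bar R}).
Context (sm : surface_measure sigma) (alpha : R) (d2 : (2 <= d)%N) (alpha1 : 1 < alpha).
Context (m : {measure set Rd R d -> \bar R}) (moo : (m setT < +oo)%E) (g : Rd R d -> R).
Local Notation SS := (Sph R d : set (Rd R d)).
Local Notation mS := (@measurable_Sph R d : measurable SS).
Context (ig : sigma.-integrable SS (EFin \o g)) (Z : set (Rd R d)) (mZ : measurable Z).
Context (sZ : sigma Z = 0%E) (mg : forall A : set (Rd R d), measurable A -> A `<=` SS `\` Z ->
  m A = (\int[sigma]_(y in A) (g y)%:E)%E).
Implicit Types (x y : 'rV[R]_d) (A : set (Rd R d)).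

Let measurable_g : measurable_fun SS g.
Proof. by have /integrableP[/measurable_EFinP] := ig. Qed.

Let mSZ : measurable (SS `\` Z).
Proof. by apply: measurableD => //; exact: mS. Qed.

Let integrable_g A : measurable A -> A `<=` SS -> sigma.-integrable A (EFin \o g).
Proof. by move=> mA AS; apply: integrableS ig => //; exact: mS. Qed.

Let integrable_c A (c : R) : measurable A -> sigma.-integrable A (EFin \o cst c).
Proof.
move=> mA; apply/integrableP; split.
  by apply/measurable_EFinP; exact: measurable_cst.
rewrite [X in (X < _)%E](_ : _ = \int[sigma]_(y in A) (`|c|)%:E)%E; last exact: eq_integral.
by rewrite integral_cst// lte_mul_pinfty// (surface_measure_fin sm).
Qed.

Lemma density_ge A (l : R) : measurable A -> A `<=` SS `\` Z -> (forall y, A y -> l <= g y) ->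
  (l%:E * sigma A <= m A)%E.
Proof.
move=> mA AS lg; rewrite mg// -integral_cst//; apply: le_integral => //.
- exact: integrable_c.
- by apply: integrable_g => //; apply: subset_trans AS _; exact: subDsetl.
- by move=> y; rewrite inE lee_fin => /lg.
Qed.

Lemma density_le A (l : R) : measurable A -> A `<=` SS `\` Z -> (forall y, A y -> g y <= l) ->
  (m A <= l%:E * sigma A)%E.
Proof.
move=> mA AS lg; rewrite mg// -integral_cst//; apply: le_integral => //.
- by apply: integrable_g => //; apply: subset_trans AS _; exact: subDsetl.
- exact: integrable_c.
- by move=> y; rewrite inE lee_fin => /lg.
Qed.

(** On [A n] the density bound makes [m] nonpositive unless [sigma] vanishes there, while [m] is a
    positive measure. *)
Lemma negligible_neg : sigma.-negligible [set y | (SS `\` Z) y /\ g y < 0].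
Proof.
pose A n : set (Rd R d) := (SS `\` Z) `&` [set y | g y <= - n.+1%:R^-1].
have mA n : measurable (A n).
  have := measurable_funS mS (@subDsetl _ SS Z) measurable_g.
  move=> /(_ mSZ `]-oo, (- n.+1%:R^-1)]%classic (measurable_itv _)).
  by congr measurable; apply/seteqP; split => x /=; rewrite in_itv/=.
have A0 n : sigma (A n) = 0%E.
  have n0 : 0 < n.+1%:R^-1 :> R by rewrite invr_gt0.
  have : (m (A n) <= (- n.+1%:R^-1)%:E * sigma (A n))%E.
    by apply: density_le => //; [exact: subIsetl|move=> y []].
  have := surface_measure_fin sm (mA n); have := measure_ge0 sigma (A n).
  move=> s0 soo; have sf : sigma (A n) \is a fin_num by rewrite ge0_fin_numE.
  move=> /(le_trans (measure_ge0 m _)); rewrite -(fineK sf) -EFinM lee_fin mulNr oppr_ge0.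
  rewrite pmulr_rle0// => h; congr (_%:E); apply/eqP; rewrite eq_le h/=.
  exact: fine_ge0.
apply: (@negligibleS _ _ _ sigma (\bigcup_n A n)).
  move=> y [Sy gy]; exists (Num.trunc (- g y)^-1) => //; split => //=.
  have gN : 0 < - g y by rewrite oppr_gt0.
  rewrite lerNr -[leRHS]invrK lef_pV2 ?posrE ?invr_gt0//.
  by rewrite ltW// truncnS_gt.
by apply: negligible_bigcup => n; exists (A n); split.
Qed.

(** The window is wider than the slice of values by [h] on each side, which leaves room for the
    kernel off [E] and for the error on the total mass. *)
Lemma level_limit (a h : R) : 0 <= a -> 0 < h ->
  sigma.-negligible [set y | ((SS `\` Z) y /\ a <= g y < a + h) /\
    ~ (forall beta : R, 0 < beta -> \forall r \near (1 : R), forall x, enorm x = r ->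
       ntcone R d beta y x -> exists2 U : R,
         (\int[m]_(z in SS) (PD alpha x z)%:E = U%:E)%E & a - h <= U <= a + 2 * h)].
Proof.
move=> a0 h0.
pose E : set (Rd R d) := (SS `\` Z) `&` [set y | a <= g y < a + h].
have mE : measurable E.
  have := measurable_funS mS (@subDsetl _ SS Z) measurable_g.
  move=> /(_ mSZ `[a, (a + h)[%classic (measurable_itv _)).
  by congr measurable; apply/seteqP; split => x /=; rewrite in_itv/=.
have mEC : measurable (~` E) by exact: measurableC.
pose tau : {measure set Rd R d -> \bar R} := mrestr (measure_add m sigma) mEC.
have tauE A : tau A = (m (A `&` ~` E) + sigma (A `&` ~` E))%E.
  by rewrite -measure_addE.
have tauoo : (tau setT < +oo)%E.
  rewrite tauE setTI lte_add_pinfty//; last exact: (surface_measure_fin sm).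
  by rewrite (le_lt_trans _ moo)// le_measure ?inE.
have tau0 : tau E = 0%E by rewrite tauE setICr !measure0 adde0.
pose bad n := [set y | [/\ Sph R d y, E y & forall delta : R, 0 < delta ->
   exists2 r : R, 0 < r < delta & ((n.+1%:R^-1)%:E * sigma (eball y r) < tau (eball y r))%E]].
have bad0 n : sigma.-negligible (bad n) by apply: density_null.
apply: (@negligibleS _ _ _ sigma (\bigcup_n bad n)); last exact: negligible_bigcup.
move=> y [[SZy gy]]; apply: contra_notP => nbad beta beta0.
have [Sy _] := SZy.
have Ey : E y by [].
have dens c : 0 < c -> exists2 delta : R, 0 < delta & forall rho : R, 0 < rho < delta ->
     (tau (eball y rho) <= c%:E * sigma (eball y rho))%E.
  move=> c0; have [n nc] : exists n : nat, n.+1%:R^-1 <= c.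
    exists (Num.trunc c^-1); rewrite -[leRHS]invrK lef_pV2 ?posrE ?invr_gt0//.
    by rewrite ltW// truncnS_gt.
  apply: contrapT => ndelta; apply: nbad; exists n => //; split => // delta delta0.
  apply: contrapT => nr; apply: ndelta; exists delta => // rho rd.
  rewrite leNgt; apply/negP => lt; apply: nr; exists rho => //.
  by apply: le_lt_trans lt; rewrite lee_wpmul2r.
(* Chosen so that [2 * a * eta <= h] and [(a + h) * (1 + eta) + eta <= a + 2 * h], the two losses
   met at the end. *)
pose eta := h / (2 * (a + h + 1)).
have ah0 : 0 < a + h + 1 by rewrite ltr_wpDl// addr_ge0// ltW.
have eta0 : 0 < eta by rewrite divr_gt0// mulr_gt0.
have etaE : 2 * (a + h + 1) * eta = h by rewrite /eta; field; rewrite gt_eqF.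
have n1 := poisson_small sm d2 alpha1 tauoo Sy dens eta0 beta0.
have n2 := kernel_mass sm d2 alpha1 eta0.
near=> r => x xr cx.
have r1 : r != 1.
  by apply/eqP => r1; case: cx => nS _; apply: nS; rewrite /Sph/= xr.
have V0 : (\int[tau]_(y in Sph R d) (PD alpha x y)%:E <= eta%:E)%E.
  suff : forall x, enorm x = r -> ntcone R d beta y x ->
    (\int[tau]_(y in Sph R d) (PD alpha x y)%:E <= eta%:E)%E by apply.
  by near: r; exact: n1.
have [W WE /andP[W1 W2]] : exists2 W : R,
    (\int[sigma]_(y in Sph R d) (PD alpha x y)%:E = W%:E)%E & 1 - eta <= W <= 1 + eta.
  suff : forall x, enorm x = r -> r != 1 -> exists2 W : R,
     (\int[sigma]_(y in Sph R d) (PD alpha x y)%:E = W%:E)%E & 1 - eta <= W <= 1 + eta by apply.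
  by near: r; exact: n2.
have x1 : enorm x != 1 by rewrite xr.
have [K hK] := PD_bounded d2 alpha1 x1.
have PD0 z : (0 <= (PD alpha x z)%:E)%E by rewrite lee_fin PD_ge0.
have mES : measurable (SS `\` E) by apply: measurableD => //; exact: mS.
have ES : E `<=` SS by move=> z [[]].
have SE : SS = E `|` (SS `\` E) by rewrite setDUK.
have split_int (m' : {measure set Rd R d -> \bar R}) :
    (\int[m']_(z in SS) (PD alpha x z)%:E =
     \int[m']_(z in E) (PD alpha x z)%:E + \int[m']_(z in SS `\` E) (PD alpha x z)%:E)%E.
  rewrite [X in (\int[_]_(_ in X) _)%E = _]SE ge0_integral_setU//.
    by apply: measurable_PD_in; exact: measurableU.
  by apply/disj_setPS => z [? []].
(* Domination by [tau] of the part off [E], known on sets, is passed to integrals through superlevel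
   sets. *)
have rest (m' : {measure set Rd R d -> \bar R}) : (m' setT < +oo)%E ->
    (forall A, measurable A -> (m' (A `&` ~` E) <= tau A)%E) ->
    (\int[m']_(z in SS `\` E) (PD alpha x z)%:E <= eta%:E)%E.
  move=> m'oo m't; apply: le_trans V0.
  apply: (@le_trans _ _ (\int[tau]_(z in SS `\` E) (PD alpha x z)%:E)%E); last first.
    by apply: ge0_subset_integral => //; [exact: mS|exact: measurable_PD_in mS].
  have := @le_integral_levels _ _ R m' tau (SS `\` E) (PD alpha x) K 1 1 mES.
  rewrite !mul1e; apply => //.
  - by rewrite (le_lt_trans _ m'oo)// le_measure ?inE.
  - by apply: measurable_funTS; exact: measurable_PD.
  - by move=> z [Sz _]; exact: hK.
  - move=> l l0; rewrite !mul1e; apply: le_trans (m't _ _).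
      have sub : (SS `\` E) `&` [set z | l < PD alpha x z]%R `<=` ~` E by move=> z [[]].
      by rewrite (setIidl sub).
    by apply: measurable_level => //; apply: measurable_funTS; exact: measurable_PD.
have I1 : (\int[m]_(z in SS `\` E) (PD alpha x z)%:E <= eta%:E)%E.
  by apply: rest => // A _; rewrite tauE leeDl.
have I2 : (\int[sigma]_(z in SS `\` E) (PD alpha x z)%:E <= eta%:E)%E.
  apply: rest => [|A _]; first exact: (surface_measure_fin sm).
  by rewrite tauE leeDr.
have mPE : measurable_fun E (PD alpha x) by apply: measurable_funTS; exact: measurable_PD.
have finE (m' : {measure set Rd R d -> \bar R}) : (m' setT < +oo)%E -> (m' E < +oo)%E.
  by move=> m'oo; rewrite (le_lt_trans _ m'oo)// le_measure ?inE.
have hKE z : E z -> 0 <= PD alpha x z <= K by move/ES; exact: hK.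
have mL l := measurable_level l mE mPE.
have L1 : (a%:E * \int[sigma]_(z in E) (PD alpha x z)%:E <= \int[m]_(z in E) (PD alpha x z)%:E)%E.
  rewrite -[leRHS]mul1e; apply: (le_integral_levels (K := K)) => //.
    by apply: finE; exact: (surface_measure_fin sm).
  move=> l l0; rewrite mul1e; apply: density_ge; first exact: mL.
    by move=> z [[]].
  by move=> z [[_ /andP[]]].
have L2 : (\int[m]_(z in E) (PD alpha x z)%:E <=
    (a + h)%:E * \int[sigma]_(z in E) (PD alpha x z)%:E)%E.
  rewrite -[leLHS]mul1e; apply: (le_integral_levels (K := K)) => //.
  - exact: finE.
  - by rewrite addr_ge0// ltW.
  move=> l l0; rewrite mul1e; apply: density_le; first exact: mL.
    by move=> z [[]].
  by move=> z [[_ /andP[_ /ltW]]].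
have ge0E (m' : {measure set Rd R d -> \bar R}) (D : set (Rd R d)) :
  (0 <= \int[m']_(z in D) (PD alpha x z)%:E)%E by apply: integral_ge0.
rewrite split_int; rewrite split_int in WE.
move: WE I1 I2 L1 L2 (ge0E sigma E) (ge0E sigma (SS `\` E)) (ge0E m E) (ge0E m (SS `\` E)).
case: (\int[sigma]_(z in E) _)%E => [p| |]//; case: (\int[sigma]_(z in SS `\` E) _)%E => [j| |]//.
case: (\int[m]_(z in SS `\` E) _)%E => [v| |]//.
move=> [WE]; rewrite -!EFinM; case: (\int[m]_(z in E) _)%E => [u| |]//.
rewrite !lee_fin => v1 j1 u1 u2 p0 j0 u0 v0; exists (u + v) => //.
have h1 : a * (1 - 2 * eta) <= a * p by rewrite ler_wpM2l//; lra.
have h2 : (a + h) * p <= (a + h) * (1 + eta) by rewrite ler_wpM2l// ?addr_ge0 ?(ltW h0)//; lra.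
have h3 : 0 <= h * eta by rewrite mulr_ge0// ltW.
have h4 : 0 <= a * eta by rewrite mulr_ge0// ltW.
by apply/andP; split; move: etaE h1 h2; rewrite !mulrDr !mulrDl; lra.
Unshelve. all: by end_near.
Qed.

(** Cutting the values of [g] into windows of width 1/(n + 1) leaves countably many exceptional
    sets; a point outside all of them serves every precision and every aperture. *)
Lemma poisson_integral_nt_limit :
  sigma.-negligible [set y | Sph R d y /\
    ~ nt_limit R d (fun x => \int[m]_(z in SS) (PD alpha x z)%:E)%E y (g y)%:E].
Proof.
pose h n : R := n.+1%:R^-1.
have h0 n : 0 < h n by rewrite invr_gt0.
pose bad n k := [set y | ((SS `\` Z) y /\ k%:R * h n <= g y < k%:R * h n + h n) /\
    ~ (forall beta : R, 0 < beta -> \forall r \near (1 : R), forall x, enorm x = r ->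
       ntcone R d beta y x -> exists2 U : R,
         (\int[m]_(z in SS) (PD alpha x z)%:E = U%:E)%E &
         k%:R * h n - h n <= U <= k%:R * h n + 2 * h n)].
have badN : sigma.-negligible (\bigcup_n \bigcup_k bad n k).
  apply: negligible_bigcup => n; apply: negligible_bigcup => k.
  by apply: level_limit => //; rewrite mulr_ge0// ltW.
have ZN : sigma.-negligible Z by exists Z; split.
apply: negligibleS (negligibleU ZN (negligibleU negligible_neg badN)).
move=> y [Sy]; apply: contra_notP => good beta beta0.
have nZ : ~ Z y by move=> Zy; apply: good; left.
have gy0 : 0 <= g y by rewrite leNgt; apply/negP => gy; apply: good; right; left.
have near_g e : 0 < e -> \forall x \near within (ntcone R d beta y) (nbhs (y : 'rV[R]_d)),
    exists2 U : R, (\int[m]_(z in SS) (PD alpha x z)%:E = U%:E)%E & `|g y - U| <= e.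
  (* With [g y] in the window [k], the value [U] is within [2 * h n] of it, and [n] makes this at
     most [e]. *)
  move=> e0; pose n := Num.trunc (2 / e); pose k := Num.trunc (g y / h n).
  have hn : 2 * h n <= e.
    by rewrite /h ler_pdivrMr// mulrC -ler_pdivrMr// ltW// truncnS_gt.
  have gk : k%:R * h n <= g y < k%:R * h n + h n.
    have /truncn_itv : 0 <= g y / h n by rewrite divr_ge0// ltW.
    by rewrite -/k ler_pdivlMr// ltr_pdivrMr// -natr1 mulrDl mul1r.
  have [badnk|gnk] := pselect (bad n k y).
    by exfalso; apply: good; right; right; exists n => //; exists k.
  apply: near1_norm => //.
  have lim : forall beta : R, 0 < beta -> \forall r \near (1 : R), forall x, enorm x = r ->
       ntcone R d beta y x -> exists2 U : R,
         (\int[m]_(z in SS) (PD alpha x z)%:E = U%:E)%E &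
         k%:R * h n - h n <= U <= k%:R * h n + 2 * h n.
    by apply: contrapT => nlim; apply: gnk.
  apply: filterS (lim _ beta0) => r + x xr cx => /(_ x xr cx)[U UE /andP[U1 U2]].
  exists U => //; have /andP[g1 g2] := gk; have := h0 n.
  by rewrite ler_norml => ?; apply/andP; split; lra.
have F := within_filter (ntcone R d beta y) (nbhs_filter (y : 'rV[R]_d)).
apply/(@fine_cvgP _ _ _ F); split.
  have := near_g _ ltr01; apply: (@filterS _ _ F) => x [U UE _].
  by rewrite UE.
apply/(@cvgrPdist_le _ _ _ _ F) => e e0.
have := near_g _ e0; apply: (@filterS _ _ F) => x [U UE Ue].
by rewrite /= UE.
Qed.

End positive_measure.

(** * Signed measures *)

Unset Implicit Arguments.

Theorem theorem3p11 (R : realType) (d : nat) (alpha : R)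
  (hd : (2 <= d)%N) (halpha : 1 < alpha < 2)
  (* sigma : the normalized surface measure on S, i.e. the rotation-invariant
     Borel probability measure carried by S *)
  (sigma : {measure set Rd R d -> \bar R})
  (sigma1 : sigma setT = 1%E)
  (sigmaS : sigma (~` Sph R d) = 0%E)
  (sigma_rot : forall Q : 'M[R]_d, Q *m Q^T = 1%:M ->
     forall A : set (Rd R d), measurable A ->
       sigma [set x : Rd R d | A (x *m Q)] = sigma A)
  (* mu : a finite signed Borel measure on S *)
  (mu : {charge set Rd R d -> \bar R})
  (muS : forall A : set (Rd R d), measurable A -> A `<=` ~` Sph R d -> mu A = 0%E)
  (* Lebesgue decomposition mu = f sigma + nu, f in L^1(sigma), nu _|_ sigma *)
  (f : Rd R d -> R) (nu : {charge set Rd R d -> \bar R})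
  (hf : sigma.-integrable (Sph R d) (EFin \o f))
  (hnu : exists2 N : set (Rd R d), measurable N /\ sigma N = 0%E &
           forall A : set (Rd R d), measurable A -> nu (A `\` N) = 0%E)
  (hdec : forall A : set (Rd R d), measurable A ->
     mu A = (\int[sigma]_(y in A) (f y)%:E + nu A)%E)
  (* a Hahn decomposition of mu, used to integrate against mu *)
  (P N : set (Rd R d)) (PN : hahn_decomposition mu P N) :
  {ae sigma, forall y : Rd R d, Sph R d y ->
     nt_limit R d (PD_int R d alpha mu P N PN) y (f y)%:E}.
Proof.
have [alpha1 _] := andP halpha.
have sm : surface_measure sigma by split.
have mS : measurable (Sph R d : set (Rd R d)) := @measurable_Sph R d.
have [[mP _] [mN _] PUN PIN] := PN.
have [Z [mZ sZ] nuZ] := hnu.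
(* Every measurable set disjoint from [Z] is null for [nu], so [mu] has density [f] there. *)
have muE (A Q : set (Rd R d)) : measurable A -> measurable Q -> A `<=` Sph R d `\` Z ->
    mu (A `&` Q) = (\int[sigma]_(y in A `&` Q) (f y)%:E)%E.
  move=> mA mQ AS; rewrite hdec; last exact: measurableI.
  rewrite (_ : A `&` Q = (A `&` Q) `\` Z).
    by rewrite nuZ ?adde0//; exact: measurableI.
  by apply/seteqP; split => y [] // Ay Qy; split => //; have [_] := AS _ Ay.
have patchEFin (h : Rd R d -> R) (Q : set (Rd R d)) :
    EFin \o (h \_ Q) = (EFin \o h) \_ Q.
  by apply/funext => y /=; rewrite !patchE; case: ifPn.
have int_patch (h : Rd R d -> R) (A Q : set (Rd R d)) :
    (\int[sigma]_(y in A) ((h \_ Q) y)%:E = \int[sigma]_(y in A `&` Q) (h y)%:E)%E.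
  by rewrite integral_mkcondr -patchEFin.
have hNf : sigma.-integrable (Sph R d) (EFin \o (fun y => - f y)).
  by rewrite (_ : _ \o _ = (fun y => - (f y)%:E)%E)//; exact: integrableN.
have ipatch (h : Rd R d -> R) (Q : set (Rd R d)) : measurable Q ->
    sigma.-integrable (Sph R d) (EFin \o h) ->
    sigma.-integrable (Sph R d) (EFin \o (h \_ Q)).
  move=> mQ ih; rewrite patchEFin.
  apply/(integrable_restrict sigma mQ mS).
  by apply: integrableS ih => //; exact: measurableI.
(* [jordan_pos PN A] is the [mu]-measure of the part of [A] in [P], which turns the density into [f]
   cut off to [P]; likewise with [- f] and [N] for the negative part. *)
have posE (A : set (Rd R d)) : measurable A -> A `<=` Sph R d `\` Z ->
    jordan_pos PN A = (\int[sigma]_(y in A) ((f \_ P) y)%:E)%E.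
  move=> mA AS; rewrite jordan_posE cjordan_posE /crestr0 mem_set// /crestr muE//.
have negE (A : set (Rd R d)) : measurable A -> A `<=` Sph R d `\` Z ->
    jordan_neg PN A = (\int[sigma]_(y in A) (((fun y => - f y) \_ N) y)%:E)%E.
  move=> mA AS; rewrite jordan_negE cjordan_negE /crestr0 mem_set// /crestr muE//.
  rewrite int_patch -integralN//; apply: integrable_add_def; first exact: measurableI.
  apply: integrableS hf => //; first exact: measurableI.
  by move=> y [/AS[]].
have negl1 := poisson_integral_nt_limit sm hd alpha1 (m := jordan_pos PN) _ (ipatch _ _ mP hf) mZ sZ posE.
have negl2 := poisson_integral_nt_limit sm hd alpha1 (m := jordan_neg PN) _ (ipatch _ _ mN hNf) mZ sZ negE.
have moo1 : (jordan_pos PN setT < +oo)%E by rewrite ltey_eq fin_num_measure.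
have moo2 : (jordan_neg PN setT < +oo)%E by rewrite ltey_eq fin_num_measure.
apply: negligibleS (negligibleU (negl1 moo1) (negl2 moo2)) => y /= /not_implyP[Sy nlim].
apply: contrapT => /not_orP[/not_andP[//|/contrapT l1] /not_andP[//|/contrapT l2]].
apply: nlim => beta beta0.
have F := within_filter (ntcone R d beta y) (nbhs_filter (y : 'rV[R]_d)).
(* [P] and [N] partition the space, so the two limits recombine to [f y]; both are finite, so limits
   can be subtracted. *)
have -> : (f y)%:E = (((f \_ P) y)%:E - (((fun y => - f y) \_ N) y)%:E)%E.
  rewrite !patchE -EFinB; congr (_%:E).
  have : (P `|` N) y by rewrite PUN.
  have : ~ (P `&` N) y by rewrite PIN.
  have [Py|Py] := pselect (P y); have [Ny|Ny] := pselect (N y); rewrite /setI /setU/=.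
  - by tauto.
  - by rewrite mem_set// memNset// subr0.
  - by rewrite memNset// mem_set// sub0r opprK.
  - by tauto.
by apply: (@cvgeB _ _ F _ _ _ _ _ _ (l1 _ beta0) (l2 _ beta0)).
Qed.
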